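(* Assume that $\mathbf{E}\xi_i(1)=0$ and $\sigma_i^2=\mathbf{E}\xi_i(1)^2<\infty$ for $i=1,2$. Let $s>0$, $b>0$, $x\in\mathbb{R}$, $k\ge\max\{x,b\}$, $r\le\min\{x,b\}$, and $s_i=\sqrt{2s}/\sigma_i$, $i=1,2$. Then $$\lim_{B\to\infty}\mathbf{E}\left[e^{-s\overline\tau_{xB}^{kB}(bB)/B^2}\right]=\frac{\sigma_1e^{-(b-x)s_1}}{\sigma_1\cosh((k-b)s_2)+\sigma_2\sinh((k-b)s_2)},\qquad x\le b,$$ $$\lim_{B\to\infty}\mathbf{E}\left[e^{-s\overline\tau_{xB}^{kB}(bB)/B^2}\right]=\frac{\sigma_1\cosh((x-b)s_2)+\sigma_2\sinh((x-b)s_2)}{\sigma_1\cosh((k-b)s_2)+\sigma_2\sinh((k-b)s_2)},\qquad x\in[b,k];$$ $$\lim_{B\to\infty}\mathbf{E}\left[e^{-s\underline\tau_{rB}^{xB}(bB)/B^2}\right]=\frac{\sigma_2e^{-(x-b)s_2}}{\sigma_1\sinh((b-r)s_1)+\sigma_2\cosh((b-r)s_1)},\qquad x\ge b,$$ $$\lim_{B\to\infty}\mathbf{E}\left[e^{-s\underline\tau_{rB}^{xB}(bB)/B^2}\right]=\frac{\sigma_1\sinh((b-x)s_1)+\sigma_2\cosh((b-x)s_1)}{\sigma_1\sinh((b-r)s_1)+\sigma_2\cosh((b-r)s_1)},\qquad x\in[r,b].$$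
   Context: Underlying processes. For $i=1,2$ let $\xi_i(t)=\sum_{k=0}^{N_i(t)}\xi^i_k-a_it$, $t\ge0$, where $a_i>0$, $\xi^i_0=0$, $(\xi^i_k)_{k\ge1}$ are i.i.d. strictly positive random variables with distribution function $F_i$, and $N_i$ is a Poisson process of rate $\lambda_i$, $N_i(0)=0$, independent of $(\xi^i_k)$. Passage times. $\inf\emptyset=\infty$. $\tau_i^-(x)=\inf\{t:\xi_i(t)\le-x\}$; $\tau_i^+(x)=\inf\{t:\xi_i(t)>x\}$, $T_i^+(x)=\xi_i(\tau_i^+(x))-x$, for $x\ge0$. Oscillating process. For a fixed switching level $b>0$ and $x\in\mathbb{R}$, $\xi(x,t)$, $t\ge0$, $\xi(x,0)=x$, is defined recursively. If $x>b$: $\xi(x,t)=x+\xi_2(t)$ for $0\le t<\tau_2^-(x-b)$ and $\xi(x,t)=\xi(b,t-\tau_2^-(x-b))$ for $t\ge\tau_2^-(x-b)$. If $x\le b$: $\xi(x,t)=x+\xi_1(t)$ for $0\le t<\tau_1^+(b-x)$ and $\xi(x,t)=\xi(b+T_1^+(b-x),t-\tau_1^+(b-x))$ for $t\ge\tau_1^+(b-x)$. At each switching time the process restarts afresh from its current position, independently of the past given that position (strong Markov property), so it moves like $\xi_2$ when above $b$ until it hits $b$, and like $\xi_1$ when at or below $b$ until it jumps above $b$. Functionals. For the process with switching level $b$ started from $x$: $\underline\tau_r^x(b)=\inf\{t:\xi(x,t)\le r\}$ for $r\le\min\{x,b\}$, and $\overline\tau_x^k(b)=\inf\{t:\xi(x,t)>k\}$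 for $k\ge\max\{x,b\}$. Thus $\overline\tau_{xB}^{kB}(bB)$ and $\underline\tau_{rB}^{xB}(bB)$ refer to the process with switching level $bB$ started from $xB$ (the laws of $\xi_1,\xi_2$ do not depend on $B$). Convention: $e^{-s\cdot\infty}=0$. *)

(* Defs.v *)
From HB Require Import structures.
From mathcomp Require Export all_boot all_order all_algebra finmap.
From mathcomp Require Export all_classical all_reals all_analysis.
Export Order.TTheory GRing.Theory Num.Theory.
Export numFieldNormedType.Exports.

Set Implicit Arguments.
Unset Strict Implicit.
Unset Printing Implicit Defensive.

Local Open Scope classical_set_scope.
Local Open Scope ring_scope.

Definition cosh {R : realType} (x : R) : R := (expR x + expR (- x)) / 2.
Definition sinh {R : realType} (x : R) : R := (expR x - expR (- x)) / 2.

Definition mutually_independent d (T : measurableType d) (R : realType)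
    (P : probability T R) (I : eqType) (X : I -> {RV P >-> R}) : Prop :=
  forall (J : seq I) (A : I -> set R), uniq J ->
    (forall j, j \in J -> measurable (A j)) ->
    P (\bigcap_(j in [set` J]) (X j @^-1` A j)) =
    (\prod_(j <- J) P (X j @^-1` A j))%E.

(* Number of n with u n <= t; the value is 0 if there are infinitely many such
   n, which is a null event in both uses below. *)
Definition count_by {R : realType} (u : nat -> \bar R) (t : R) : nat :=
  #|` fset_set [set n | (u n <= t%:E)%E]|.

(* Path of the Poisson process whose successive interarrival times are gap 0,
   gap 1, ... (i.i.d. exponential variables in the theorem). *)
Definition poisson_path {R : realType} (gap : nat -> R) (t : R) : nat :=
  count_by (fun n => (\sum_(k < n.+1) gap k)%:E) t.

(* jump k stands for xi_(k+1); the term xi_0 = 0 is dropped from the sum. *)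
Definition xi_path {R : realType} (a : R) (gap jump : nat -> R) (t : R) : R :=
  (\sum_(k < poisson_path gap t) jump k) - a * t.

Definition tau_minus {R : realType} (p : R -> R) (x : R) : \bar R :=
  ereal_inf [set t%:E | t in [set t | 0 <= t /\ p t <= - x]].

Definition tau_plus {R : realType} (p : R -> R) (x : R) : \bar R :=
  ereal_inf [set t%:E | t in [set t | 0 <= t /\ p t > x]].

(* Only meaningful when tau_plus p x is finite. *)
Definition overshoot {R : realType} (p : R -> R) (x : R) : R :=
  p (fine (tau_plus p x)) - x.

(* p i n is the path of the n-th copy of xi_1 (i = false) or of xi_2
   (i = true).  switching p b x n = (y, u) where u is the n-th time at which
   the oscillating process changes regime (+oo if there is none) and y is its
   position at that time; from then on, until the next change of regime, the
   process follows the n-th copy, which has not been used before. *)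
Fixpoint switching {R : realType} (p : bool -> nat -> R -> R) (b x : R)
    (n : nat) : R * \bar R :=
  if n is m.+1 then
    let: (y, u) := switching p b x m in
    if b < y then (b, (u + tau_minus (p true m) (y - b))%E)
    else (b + overshoot (p false m) (b - y),
          (u + tau_plus (p false m) (b - y))%E)
  else (x, 0%E).

Definition oscillating {R : realType} (p : bool -> nat -> R -> R) (b x t : R)
    : R :=
  let n := count_by (fun m => (switching p b x m.+1).2) t in
  let: (y, u) := switching p b x n in
  y + p (b < y) n (t - fine u).

Definition lower_passage {R : realType} (p : bool -> nat -> R -> R)
    (b x r : R) : \bar R :=
  ereal_inf [set t%:E | t in [set t | 0 <= t /\ oscillating p b x t <= r]].

Definition upper_passage {R : realType} (p : bool -> nat -> R -> R)
    (b x k : R) : \bar R :=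
  ereal_inf [set t%:E | t in [set t | 0 <= t /\ oscillating p b x t > k]].

(* E exp(- s tau); expeR -oo = 0 gives the convention exp(- s * oo) = 0. *)
Definition laplace d (T : measurableType d) (R : realType)
    (P : probability T R) (s : R) (tau : T -> \bar R) : \bar R :=
  'E_P[fun w => fine (expeR (- (s%:E * tau w))%E)].

(* gap i n k and jump i n k, k = 0, 1, ..., are the interarrival times and the
   jumps of the n-th copy of xi_1 (i = false) or of xi_2 (i = true). *)
Definition copies d (T : measurableType d) (R : realType)
    (P : probability T R) (a : bool -> R)
    (gap jump : bool -> nat -> nat -> {RV P >-> R}) (w : T)
    (i : bool) (n : nat) : R -> R :=
  xi_path (a i) (fun k => gap i n k w) (fun k => jump i n k w).

Definition sources d (T : measurableType d) (R : realType)
    (P : probability T R) (gap jump : bool -> nat -> nat -> {RV P >-> R})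
    (j : (bool * nat * nat) + (bool * nat * nat)) : {RV P >-> R} :=
  match j with
  | inl (i, n, k) => gap i n k
  | inr (i, n, k) => jump i n k
  end.

(* Main.v *)
Require Import Defs.
From mathcomp Require Import measurable_realfun lra ring.
Set Implicit Arguments.
Unset Strict Implicit.
Unset Printing Implicit Defensive.
Local Open Scope classical_set_scope.
Local Open Scope ring_scope.

(** Put [s1 = sqrt (2 s) / sigma1] and [s2 = sqrt (2 s) / sigma2].  On the scale
    [B] in space and [B^2] in time, a compound Poisson path minus its drift looks
    like a Brownian motion with variance [sigma_i^2], so the limits should be the
    Laplace transforms of passage times of a process which diffuses with
    [sigma1] below [b] and with [sigma2] above [b].  These solve
    [sigma^2 / 2 f'' = s f] on each side of [b], with [f] and [f'] continuous at
    [b]; for the upward passage [f] must decay at [-oo], which gives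
    [sigma1 exp ((x - b) s1)] below [b] and
    [sigma1 cosh ((x - b) s2) + sigma2 sinh ((x - b) s2)] above it, up to a
    factor.  This is [profile], and the limit is
    [profile (x - b) / profile (k - b)].  The downward passage is the mirror
    image, with [sigma1] and [sigma2] exchanged.

    The convergence is proved by comparison and not through a functional limit
    theorem.  Observing the process at its jumps, and when its drift meets [b] (or
    [r]), gives a chain driven by independent exponential gaps and by jumps.  A
    function [psi >= 0] which does not increase on average in one discounted step of
    this chain and is at least 1 on the target, a supersolution, dominates the
    transform; a subsolution, with the opposite inequalities, is dominated by it
    ([supersolution_bound], [subsolution_bound]).  Between two
    jumps the chain follows a line, so integrating along it reduces the one-step
    inequality to one for the generator, which on scale [B] reads
    [lambda_i E f (z + X / B) <= (lambda_i + s / B^2) f z + a_i f' z / B] with [X]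
    a jump ([one_step_le] and its variants).  A Taylor expansion of order two
    turns this into [sigma_i^2 / 2 f'' <= s f], up to an error controlled by the
    tail of the second moment of [X] ([scaled_generator]); the first-order terms
    cancel because [lambda_i E X = a_i], and [lambda_i E X^2 = sigma_i^2].

    The profile raised or lowered by a small constant, and truncated beyond the
    target, satisfies these inequalities with room for the error
    ([upper_transform_le], [upper_transform_ge], [lower_transform_le],
    [lower_transform_ge]).  The only obstruction is the interface, where [f'']
    jumps: a path at [b] follows the rules of one side while its next jump
    explores the other.  The jump of [f''] has the favourable sign for one of the
    two inequalities only; for the other the interface of the test function is
    moved from [b] to [b + eps] ([interface_le], [interface_ge]), which costs
    nothing in the limit.

    Two further facts support the argument.  The chain survives [m] discounted
    steps with a weight that decays geometrically ([survival_decay]); this removes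
    the remainder after [m] steps in the comparison, and also shows that regimes
    and jumps do not accumulate, so that almost every path can be decomposed
    along the chain ([payoff_upper], [payoff_lower]).  And the moments of [X] are
    recovered from those of [xi_i 1] by a renewal argument at the first claim
    ([jump_moments_of_path]). *)

(** * Integrals without measurability *)

Section ae_integral.
Import HBNNSimple.
Context d (T : measurableType d) (R : realType).
Variable mu : {measure set T -> \bar R}.
Local Open Scope ereal_scope.

(** The integral of a nonnegative function is a supremum over the simple functions
    below it, whether or not it is measurable, and a simple function below [f] can be
    set to 0 on the exceptional null set without changing its integral.  Passage
    times are infima over uncountably many instants; this lemma lets them be
    integrated as they are. *)
Lemma ge0_ae_le_integral_nomeas (f g : T -> \bar R) :
  (forall x, 0 <= f x) -> (forall x, 0 <= g x) ->
  {ae mu, forall x, f x <= g x} -> \int[mu]_x f x <= \int[mu]_x g x.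
Proof.
move=> f0 g0 [N [mN N0 subN]].
rewrite /integral !patch_setT.
have -> : f^\- = cst 0 by apply/funext => x; exact: ge0_funenegE (in_setT x).
have -> : g^\- = cst 0 by apply/funext => x; exact: ge0_funenegE (in_setT x).
apply: leeD2r.
have -> : f^\+ = f by apply/funext => x; exact: ge0_funeposE (in_setT x).
have -> : g^\+ = g by apply/funext => x; exact: ge0_funeposE (in_setT x).
apply: ge_ereal_sup => _ [h /= hf <-].
(* [h] cut to 0 on the null set where the inequality may fail *)
pose k := proj_nnsfun h (measurableC mN).
have -> : sintegral mu h = sintegral mu k.
  rewrite -!integralT_nnsfun.
  apply: ge0_ae_eq_integral => //.
  - by apply/measurable_EFinP.
  - by apply/measurable_EFinP.
  - by move=> x _; rewrite lee_fin.
  - by move=> x _; rewrite lee_fin.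
  exists N; split=> // x /= hk; apply: contrapT => Nx; apply: hk => _.
  by rewrite mindicE mem_set ?mulr1.
apply: ereal_sup_ubound; exists k => //= x.
rewrite mindicE; case: (boolP (x \in ~` N)) => [|_]; last by rewrite mulr0.
rewrite inE => Nx; rewrite mulr1 (le_trans (hf x))//.
by apply: contrapT => h1; apply: Nx; exact: subN.
Qed.

Lemma ge0_ae_eq_integral_nomeas (f g : T -> \bar R) :
  (forall x, 0 <= f x) -> (forall x, 0 <= g x) ->
  {ae mu, forall x, f x = g x} -> \int[mu]_x f x = \int[mu]_x g x.
Proof.
move=> f0 g0 fg; apply/eqP; rewrite eq_le !ge0_ae_le_integral_nomeas//.
- by apply: filterS fg => x ->.
- by apply: filterS fg => x ->.
Qed.

Lemma ae_eq_integral_nomeas (f g : T -> \bar R) :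
  {ae mu, forall x, f x = g x} -> \int[mu]_x f x = \int[mu]_x g x.
Proof.
move=> fg; rewrite integralE [RHS]integralE; congr (_ - _).
  by apply: ge0_ae_eq_integral_nomeas => //; apply: filterS fg => x fx;
    rewrite !funeposE fx.
by apply: ge0_ae_eq_integral_nomeas => //; apply: filterS fg => x fx;
  rewrite !funenegE fx.
Qed.
End ae_integral.

Lemma integral_probability_cst d (T : measurableType d) (R : realType)
    (P : probability T R) (c : R) : (\int[P]_x c%:E = c%:E)%E.
Proof. by rewrite integral_cst// [X in (_ * X)%E]probability_setT mule1. Qed.

(** * Densities, image laws and product laws *)

Section density.
Import HBNNSimple.
Context d (T : measurableType d) (R : realType).
Variables (nu mu : {measure set T -> \bar R}) (p : T -> R).
Hypothesis p0 : forall x, 0 <= p x.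
Hypothesis mp : measurable_fun setT p.
Hypothesis nuE : forall A, measurable A ->
  nu A = (\int[mu]_(x in A) (p x)%:E)%E.
Local Open Scope ereal_scope.

Lemma integral_density_indic (A : set T) : measurable A ->
  \int[nu]_x (\1_A x)%:E = \int[mu]_x ((p x)%:E * (\1_A x)%:E).
Proof.
move=> mA; rewrite integral_indic// setIT nuE// integral_mkcond.
apply: eq_integral => x _; rewrite patchE indicE.
by case: (x \in A); rewrite ?mule1 ?mule0.
Qed.

Lemma integral_density_nnsfun (f : {nnsfun T >-> R}) :
  \int[nu]_x (f x)%:E = \int[mu]_x ((p x)%:E * (f x)%:E).
Proof.
under [LHS]eq_integral do rewrite fimfunE -fsumEFin//.
rewrite [LHS]ge0_integral_fsum//; last 2 first.
- by move=> r; exact/measurable_EFinP/measurableT_comp.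
- by move=> r x _; rewrite EFinM nnfun_muleindic_ge0.
transitivity (\int[mu]_x (\sum_(y \in range f)
    ((p x)%:E * (y * \1_(f @^-1` [set y]) x)%:E))); last first.
  apply: eq_integral => x _; rewrite fimfunE -fsumEFin// ge0_mule_fsumr//.
  by move=> r; rewrite EFinM nnfun_muleindic_ge0.
rewrite [RHS]ge0_integral_fsum//; last 2 first.
- move=> r; apply/emeasurable_funM; first exact/measurable_EFinP.
  exact/measurable_EFinP/measurableT_comp.
- move=> r x _; apply: mule_ge0; first by rewrite lee_fin.
  by rewrite EFinM nnfun_muleindic_ge0.
apply: eq_fsbigr => r; rewrite inE => -[x _ <-].
under eq_integral do rewrite EFinM.
under [RHS]eq_integral do rewrite EFinM muleCA.
have r0 : 0 <= (f x)%:E by rewrite lee_fin.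
rewrite !ge0_integralZl//; last 3 first.
- by apply/emeasurable_funM; apply/measurable_EFinP.
- by move=> y _; rewrite mule_ge0 ?lee_fin.
- by apply/measurable_EFinP.
by congr (_ * _); exact: integral_density_indic.
Qed.

(** Extension from indicators to simple functions and then to monotone limits. *)
Lemma ge0_integral_density (f : T -> \bar R) :
  measurable_fun setT f -> (forall x, 0 <= f x) ->
  \int[nu]_x f x = \int[mu]_x ((p x)%:E * f x).
Proof.
move=> mf f0; pose f_ := nnsfun_approx measurableT mf.
have fE x : f x = limn (fun n => (f_ n x)%:E).
  by apply/esym/cvg_lim => //; exact: cvg_nnsfun_approx.
have ndf x : {homo (fun n => (f_ n x)%:E) : a b / (a <= b)%N >-> a <= b}.
  by move=> a b ab; rewrite lee_fin; exact/lefP/nd_nnsfun_approx.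
transitivity (limn (fun n => \int[nu]_x (f_ n x)%:E)).
  rewrite -monotone_convergence//=.
  - by apply: eq_integral => x _; rewrite fE.
  - by move=> n; exact/measurable_EFinP.
  - by move=> n x _; rewrite lee_fin.
transitivity (limn (fun n => \int[mu]_x ((p x)%:E * (f_ n x)%:E))).
  by apply: congr_lim; apply/funext => n; exact: integral_density_nnsfun.
rewrite -monotone_convergence//=.
- apply: eq_integral => x _; rewrite fE limeMl//.
  exact: ereal_nondecreasing_is_cvgn.
- by move=> n; apply/emeasurable_funM; apply/measurable_EFinP.
- by move=> n x _; rewrite mule_ge0 ?lee_fin.
- move=> x _ a b ab; apply: lee_wpmul2l; rewrite ?lee_fin//; exact: ndf.
Qed.

End density.

Section exponential_integral.
Context (R : realType).
Variables (nu : {measure set (measurableTypeR R) -> \bar R}) (rate : R).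
Hypothesis rate_gt0 : 0 < rate.
Hypothesis nuE : forall A : set R, measurable A -> nu A = exponential_prob rate A.

Lemma ge0_integral_exponential (f : R -> \bar R) :
  measurable_fun setT f -> (forall x, 0 <= f x)%E ->
  (\int[nu]_x f x =
   \int[lebesgue_measure]_(x in `[0%R, +oo[) ((rate * expR (- rate * x))%:E * f x))%E.
Proof.
move=> mf f0.
rewrite (@ge0_integral_density _ _ _ nu lebesgue_measure (exponential_pdf rate)) //.
- rewrite [RHS]integral_mkcond; apply: eq_integral => x _.
  rewrite !patchE /exponential_pdf patchE.
  by case: ifP => //; rewrite mul0e.
- by move=> x; apply: exponential_pdf_ge0; exact: ltW.
- exact: measurable_exponential_pdf.
Qed.
End exponential_integral.

Lemma exists_image_measure d1 d2 (T1 : measurableType d1)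
    (T2 : measurableType d2) (R : realType) (m : {measure set T1 -> \bar R})
    (f : T1 -> T2) : measurable_fun setT f ->
  exists m' : {measure set T2 -> \bar R}, forall C, m' C = m (f @^-1` C).
Proof.
move=> mf; unshelve eexists (pushforward m f : {measure set T2 -> \bar R}).
  exact: mf.
by [].
Qed.

Definition image_law d1 d2 (T1 : measurableType d1) (T2 : measurableType d2)
    (R : realType) (P : probability T1 R) (f : T1 -> T2) (mf : measurable_fun setT f) :
  probability T2 R := distribution P (mfun_Sub (mem_set mf)).

Section image_law.
Context d1 d2 (T1 : measurableType d1) (T2 : measurableType d2) (R : realType).
Variables (P : probability T1 R) (mu : probability T2 R) (f : T1 -> T2).
Hypotheses (mf : measurable_fun setT f)
  (muE : forall A, measurable A -> mu A = P (f @^-1` A)).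

Lemma ae_preimage (Q : T2 -> Prop) :
  {ae mu, forall v, Q v} -> {ae P, forall w, Q (f w)}.
Proof.
move=> [N [mN N0 subN]]; exists (f @^-1` N); split.
- by rewrite -[X in measurable X]setTI; exact: mf.
- by rewrite -muE.
- by move=> w Qw; apply: subN.
Qed.

(** Holds first for the push-forward, and [mu] has the same values on measurable sets. *)
Lemma ge0_integral_image (g : T2 -> \bar R) : measurable_fun setT g ->
  (forall v, 0 <= g v)%E -> (\int[mu]_v g v = \int[P]_w g (f w))%E.
Proof.
move=> mg g0; have [m' m'E] := exists_image_measure P mf.
transitivity (\int[m']_v g v)%E.
  by apply: eq_measure_integral => A mA _; rewrite m'E; exact: muE.
transitivity (\int[pushforward P f]_v g v)%E.
  by apply: eq_measure_integral => A mA _; rewrite m'E.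
by rewrite ge0_integral_pushforward.
Qed.

End image_law.

Section product_space.
Context (I : eqType) (R : realType).

Definition cylinder : set (set (I -> R)) :=
  [set C | exists (J : seq I) (A : I -> set R),
    [/\ uniq J, (forall j, measurable (A j))
      & C = \bigcap_(j in [set` J]) [set v | A j (v j)]]].

(** The sigma-algebra is the one generated by finite-dimensional rectangles, so that
    laws are determined by their finite-dimensional marginals and a map into the space
    is measurable as soon as its coordinates are. *)
Definition env : measurableType _ := g_sigma_algebraType cylinder.

Lemma cylinderI : setI_closed cylinder.
Proof.
move=> _ _ [J1 [A1 [u1 m1 ->]]] [J2 [A2 [u2 m2 ->]]].
exists (undup (J1 ++ J2)), (fun j =>
  (if j \in J1 then A1 j else setT) `&` (if j \in J2 then A2 j else setT)).
split=> [|j|]; first exact: undup_uniq.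
  by apply: measurableI; case: ifP.
apply/seteqP; split=> v /=.
  by move=> [h1 h2] j /=; rewrite mem_undup mem_cat => _; split;
    case: ifPn => // jJ; [exact: h1|exact: h2].
move=> h; split=> j /= jJ; have := h j; rewrite /= mem_undup mem_cat jJ ?orbT.
  by case/(_ isT).
by case/(_ isT).
Qed.

Lemma cylinder_setT : cylinder setT.
Proof.
exists [::], (fun=> setT); split=> //.
by apply/seteqP; split=> v.
Qed.

Lemma measurable_coord (j : I) : measurable_fun setT (fun v : env => v j).
Proof.
move=> _ A mA; rewrite setTI; apply: sub_sigma_algebra.
exists [:: j], (fun i => if i == j then A else setT); split=> //.
  by move=> i; case: ifP.
apply/seteqP; split=> v /=; first by move=> Av i; rewrite /= inE => /eqP ->; rewrite eqxx.
by move=> /(_ j); rewrite /= inE eqxx; exact.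
Qed.

Lemma measurable_to_env d (T : measurableType d) (f : T -> env) :
  (forall j, measurable_fun setT (fun x => f x j)) -> measurable_fun setT f.
Proof.
move=> mf; have mE : @measurable _ env = <<s cylinder >> by [].
apply: (@measurability _ _ T env setT f cylinder mE).
move=> _ [_ [J [A [uJ mA ->]]] <-]; rewrite setTI preimage_bigcap.
apply: fin_bigcap_measurable; first exact: finite_seq.
move=> j _; have := mf j measurableT _ (mA j); rewrite setTI; exact.
Qed.

Lemma measurable_reindex (e : I -> I) :
  measurable_fun setT (fun v : env => (v \o e : env)).
Proof. by apply: measurable_to_env => j; exact: measurable_coord. Qed.

Lemma env_measure_unique (m1 m2 : {measure set env -> \bar R}) :
  (m1 setT < +oo)%E -> (forall C, cylinder C -> m1 C = m2 C) ->
  forall A, measurable A -> m1 A = m2 A.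
Proof.
move=> fin m12 A mA.
have mE : @measurable _ env = <<s cylinder >> by [].
apply: (@measure_unique _ R env cylinder (fun=> setT) mE cylinderI) => //.
- by move=> _; exact: cylinder_setT.
- by rewrite bigcup_const.
Qed.

Section product_law.
Variables (law : I -> probability (measurableTypeR R) R).
Variable mu : probability env R.

Definition product_law := forall (J : seq I) (A : I -> set R), uniq J ->
  (forall j, measurable (A j)) ->
  mu (\bigcap_(j in [set` J]) [set v | A j (v j)]) =
  (\prod_(j <- J) law j (A j))%E.

Hypothesis prodP : product_law.
Variables (i0 : I) (e : I -> I).
Hypotheses (inje : injective e) (ei0 : forall i, e i <> i0).
Hypothesis law_e : forall i, law (e i) = law i.

(** The coordinate [i0] is independent of the others, and the family [v \o e] of
    coordinates reached by [e], which avoid [i0], has again the law [mu].  On cylinders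
    both sides are products of the same numbers, and cylinders determine a measure.
    This single fact is the source of the Markov property of the chain below. *)
Lemma product_law_split (A : set R) (B : set env) : measurable A -> measurable B ->
  mu [set v | A (v i0) /\ B (v \o e)] = (law i0 A * mu B)%E.
Proof.
move=> mA mB.
have mA0 : @measurable _ env [set v : env | A (v i0)].
  by have := @measurable_coord i0 measurableT _ mA; rewrite setTI.
have fA : (law i0 A) \is a fin_num by exact: fin_num_measure.
have c0 : 0 <= fine (law i0 A) by exact: fine_ge0.
pose m2 := mscale (NngNum c0) mu.
have [m1 m1P] := exists_image_measure (mrestr mu mA0) (measurable_reindex e).
have m1E C : m1 C = mu [set v | A (v i0) /\ C (v \o e)].
  rewrite m1P /mrestr; congr (mu _).
  by apply/seteqP; split=> v /= [].
rewrite -m1E.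
have m2E C : m2 C = (law i0 A * mu C)%E by rewrite /m2 /mscale/= fineK.
rewrite -m2E.
apply: env_measure_unique => //.
  rewrite m1E; apply: le_lt_trans (ltry 1); apply: probability_le1.
  by rewrite (_ : [set _ | _] = [set v : env | A (v i0)])//; apply/seteqP; split=> v // [].
move=> _ [J [C [uJ mC ->]]].
rewrite m1E -[RHS]/(m2 _) m2E prodP//.
(* constraint on the coordinate [i]; an empty intersection is the whole line *)
pose C' i := if i == i0 then A else
  \bigcap_(j in [set j | e j = i]) C j.
have eC j : C' (e j) = C j.
  rewrite /C' ifF; last by apply/eqP; exact: ei0.
  by apply/seteqP; split=> x /= => [/(_ j erefl)//|Cx j' /= /inje ->].
transitivity (mu (\bigcap_(j in [set` i0 :: map e J]) [set v | C' j (v j)])).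
  congr (mu _); apply/seteqP; split=> v /=.
    move=> [Av Cv] j /=; rewrite inE => /orP[/eqP ->|/mapP[i iJ ->]].
      by rewrite /C' eqxx.
    by rewrite eC; exact: Cv.
  move=> h; split; first by have := h i0; rewrite /= inE eqxx /C' eqxx; exact.
  move=> j /= jJ; have := h (e j); rewrite /= inE map_f// orbT eC; exact.
rewrite prodP//; last 2 first.
- rewrite /= map_inj_uniq// uJ andbT; apply/mapP => -[j _ /esym]; exact: ei0.
- move=> j; rewrite /C'; case: ifP => // _.
  have [[i eij]|nej] := pselect (exists i, e i = j).
    rewrite (_ : \bigcap_(_ in _) _ = C i)//.
    by apply/seteqP; split=> x /= => [/(_ i eij)//|Cx j' /=]; rewrite -eij => /inje ->.
  rewrite (_ : \bigcap_(_ in _) _ = setT)//.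
  by apply/seteqP; split=> x //= _ j' /= ej; exfalso; apply: nej; exists j'.
rewrite big_cons {1}/C' eqxx; congr (_ * _)%E.
by rewrite big_map; apply: eq_bigr => j _; rewrite eC law_e.
Qed.

(** The image of [mu] under [v |-> (v i0, v \o e)] is the product measure, by its value
    on rectangles. *)
Lemma product_law_fubini (H : R * env -> \bar R) :
  measurable_fun setT H -> (forall x, 0 <= H x)%E ->
  (\int[mu]_v H (v i0, (v \o e : env)) =
   \int[law i0]_g \int[mu]_v H (g, v))%E.
Proof.
move=> mH H0.
pose phi (v : env) : measurableTypeR R * env := (v i0, v \o e).
have mphi : measurable_fun setT phi.
  by apply/measurable_fun_pair; [exact: measurable_coord|exact: measurable_reindex].
rewrite -(fubini_tonelli1 (m1 := law i0) (m2 := mu))//.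
transitivity (\int[pushforward mu phi]_z H z)%E.
  by rewrite ge0_integral_pushforward.
have [m' m'E] := exists_image_measure mu mphi.
transitivity (\int[m']_z H z)%E.
  by apply: eq_measure_integral => A mA _; rewrite m'E.
apply: eq_measure_integral => A mA _.
apply/esym/product_measure_unique => // B C mB mC.
by rewrite m'E -product_law_split.
Qed.

Lemma product_law_integral_reindex (H : env -> \bar R) :
  measurable_fun setT H -> (forall x, 0 <= H x)%E ->
  (\int[mu]_v H (v \o e : env) = \int[mu]_v H v)%E.
Proof.
move=> mH H0.
have mH2 : measurable_fun setT (H \o (snd : R * env -> env)).
  exact: measurableT_comp.
by rewrite (product_law_fubini mH2)//= integral_cst// [X in (_ * X)%E]probability_setT mule1.
Qed.
End product_law.
End product_space.

(** * Passage times of one compound Poisson path *)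

Section first_time.
Context (R : realType).
Implicit Types (S : R -> Prop) (d t : R).

Definition first_time S : \bar R :=
  ereal_inf [set t%:E | t in [set t | 0 <= t /\ S t]].

Lemma first_time_ge0 S : (0 <= first_time S)%E.
Proof. by apply: le_ereal_inf_tmp => _ [t [t0 _] <-]; rewrite lee_fin. Qed.

Lemma first_time_at S d : 0 <= d -> S d ->
  (forall t, 0 <= t -> t < d -> ~ S t) -> first_time S = d%:E.
Proof.
move=> d0 Sd Sn; apply/eqP; rewrite eq_le; apply/andP; split.
  by apply: ereal_inf_lbound; exists d.
apply: le_ereal_inf_tmp => _ [t [t0 St] <-]; rewrite lee_fin leNgt.
by apply/negP => td; exact: (Sn t).
Qed.

Lemma first_time_shift S S' d : 0 <= d ->
  (forall t, 0 <= t -> t < d -> ~ S t) ->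
  (forall t, 0 <= t -> (S (d + t) <-> S' t)) ->
  first_time S = (d%:E + first_time S')%E.
Proof.
move=> d0 Sn SS'; apply/eqP; rewrite eq_le; apply/andP; split.
  rewrite -leeBlDl//; apply: le_ereal_inf_tmp => _ [t [t0 St] <-].
  rewrite leeBlDl// -EFinD; apply: ereal_inf_lbound; exists (d + t) => //.
  by split; [exact: addr_ge0|exact/SS'].
apply: le_ereal_inf_tmp => _ [t [t0 St] <-].
have dt : d <= t by rewrite leNgt; apply/negP => td; exact: (Sn t).
rewrite -leeBrDl// -EFinB; apply: ereal_inf_lbound; exists (t - d) => //.
by split; [rewrite subr_ge0|apply/SS'; rewrite ?subr_ge0// subrKC].
Qed.

End first_time.

Section counting.
Context (R : realType).

(** With [u] nondecreasing the counted indices are exactly those below [n]; in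
    particular there are finitely many. *)
Lemma count_by_bracket (u : nat -> \bar R) (t : R) (n : nat) :
  {homo u : i j / (i <= j)%N >-> (i <= j)%E} ->
  (t%:E < u n)%E -> (forall m, (m < n)%N -> (u m <= t%:E)%E) ->
  count_by u t = n.
Proof.
move=> ndu tn un; rewrite /count_by.
apply: card_fset_set; rewrite (_ : [set _ | _] = `I_n)//.
apply/seteqP; split=> m /=; last exact: un.
by rewrite ltnNge => umt; apply/negP => nm; have := lt_le_trans tn (ndu _ _ nm); rewrite ltNge umt.
Qed.

Definition partial (g : nat -> R) (n : nat) : R := \sum_(k < n) g k.

(** Excludes the null event of infinitely many jumps in bounded time, on which
    [count_by] has a conventional value. *)
Definition proper (g : nat -> R) : Prop :=
  (forall k, 0 < g k) /\ (forall t, exists n, t < partial g n).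

Lemma partialS (g : nat -> R) n : partial g n.+1 = g 0 + partial (g \o succn) n.
Proof. by rewrite /partial big_ord_recl. Qed.

Lemma proper_tail (g : nat -> R) : proper g -> proper (g \o succn).
Proof.
move=> [g0 gy]; split=> [k|t]; first exact: g0.
have [[|n]] := gy (g 0 + t); rewrite ?partialS ?ltrD2l; last by exists n.
by rewrite /partial big_ord0 => h; exists 0; rewrite big_ord0; have := g0 0; lra.
Qed.

Lemma partial_nd (g : nat -> R) : proper g ->
  {homo partial g : i j / (i <= j)%N >-> i <= j}.
Proof.
move=> [g0 _]; apply: homo_leq => //; first exact: le_trans.
by move=> n; rewrite /partial big_ord_recr /= lerDl ltW.
Qed.

Lemma partial_bracket (g : nat -> R) (t : R) : proper g -> 0 <= t ->
  exists n, partial g n <= t < partial g n.+1.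
Proof.
move=> pg t0; have [_ /(_ t) tn] := pg.
have [[|n]] := ex_minnP tn; first by rewrite /partial big_ord0 ltNge t0.
move=> tSn minn; exists n; rewrite tSn andbT leNgt; apply/negP => /minn.
by rewrite ltnn.
Qed.

Lemma poisson_path_bracket (g : nat -> R) (t : R) n : proper g ->
  partial g n <= t < partial g n.+1 -> poisson_path g t = n.
Proof.
move=> pg /andP[nt tn]; apply: count_by_bracket => [i j ij||m mn].
- by rewrite lee_fin; exact: partial_nd.
- by rewrite lte_fin.
- by rewrite lee_fin; apply: le_trans nt; exact: partial_nd.
Qed.

Lemma poisson_path_first (g : nat -> R) (t : R) : proper g ->
  0 <= t -> t < g 0 -> poisson_path g t = 0%N.
Proof.
move=> pg t0 tg; apply: poisson_path_bracket => //.
by rewrite partialS /partial !big_ord0 addr0 t0.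
Qed.

Lemma poisson_path_tail (g : nat -> R) (t : R) : proper g -> 0 <= t ->
  poisson_path g (g 0 + t) = (poisson_path (g \o succn) t).+1.
Proof.
move=> pg t0; have [n tn] := partial_bracket (proper_tail pg) t0.
rewrite (poisson_path_bracket (proper_tail pg) tn).
by apply: poisson_path_bracket => //; rewrite (partialS g n) (partialS g n.+1) lerD2l ltrD2l.
Qed.

Lemma xi_path_first a (g z : nat -> R) (t : R) : proper g ->
  0 <= t -> t < g 0 -> xi_path a g z t = - (a * t).
Proof. by move=> pg t0 tg; rewrite /xi_path poisson_path_first// big_ord0 sub0r. Qed.

(** Renewal at the first jump, path by path: what follows is driven by the remaining
    gaps and jumps, from the height that has been reached. *)
Lemma xi_path_tail a (g z : nat -> R) (t : R) : proper g -> 0 <= t ->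
  xi_path a g z (g 0 + t) =
  z 0 - a * g 0 + xi_path a (g \o succn) (z \o succn) t.
Proof.
move=> pg t0; rewrite /xi_path poisson_path_tail// big_ord_recl/=.
by rewrite mulrDr; lra.
Qed.

Lemma xi_path0 a (g z : nat -> R) : proper g -> xi_path a g z 0 = 0.
Proof. by move=> pg; rewrite xi_path_first ?mulr0 ?oppr0//; case: pg. Qed.

Section passage.
Variables (a : R) (g z : nat -> R).
Hypotheses (a0 : 0 < a) (pg : proper g) (z0 : forall k, 0 < z k).
Let p := xi_path a g z.
Let p' := xi_path a (g \o succn) (z \o succn).
Let g0 : 0 < g 0 := proj1 pg 0%N.

(** The path decreases between jumps, so it can only exceed a level at a jump. *)
Lemma tau_plus_now x : 0 <= x -> x < z 0 - a * g 0 ->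
  tau_plus p x = (g 0)%:E /\ overshoot p x = z 0 - a * g 0 - x.
Proof.
move=> x0 xz.
have pg0 : p (g 0) = z 0 - a * g 0.
  by rewrite /p -[X in xi_path _ _ _ X]addr0 xi_path_tail// xi_path0 ?addr0//; exact: proper_tail.
have E : tau_plus p x = (g 0)%:E.
  apply: first_time_at; [exact: ltW|by rewrite pg0|move=> t t0 tg].
  by rewrite /p xi_path_first// => h; have := mulr_ge0 (ltW a0) t0; lra.
by rewrite /overshoot E/= pg0.
Qed.

Lemma tau_plus_later x : 0 <= x ->
  tau_plus p x = ((g 0)%:E + tau_plus p' (x - (z 0 - a * g 0)))%E /\
  ((tau_plus p' (x - (z 0 - a * g 0)) < +oo)%E ->
   overshoot p x = overshoot p' (x - (z 0 - a * g 0))).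
Proof.
move=> x0.
have E : tau_plus p x = ((g 0)%:E + tau_plus p' (x - (z 0 - a * g 0)))%E.
  apply: first_time_shift; first exact: ltW.
    by move=> t t0 tg; rewrite /p xi_path_first// => h; have := mulr_ge0 (ltW a0) t0; lra.
  by move=> t t0; rewrite /p xi_path_tail// -/p' ltrBlDl.
split=> // foo; rewrite /overshoot E.
have f0 : (0 <= tau_plus p' (x - (z 0 - a * g 0)))%E by exact: first_time_ge0.
move: foo f0; case: (tau_plus p' _) => //= r _; rewrite lee_fin => r0.
by rewrite /p xi_path_tail// -/p'; lra.
Qed.

(** Before the first jump the path is the line of slope [- a], which meets every level. *)
Lemma tau_minus_now x : 0 < x -> x < a * g 0 -> tau_minus p x = (x / a)%:E.
Proof.
move=> x0 xg; have xa : x / a < g 0 by rewrite ltr_pdivrMr// mulrC.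
have xa0 : 0 <= x / a by rewrite divr_ge0// ltW.
apply: first_time_at => //.
- by rewrite /p xi_path_first// mulrC divfK ?gt_eqF.
- move=> t t0 tx; rewrite /p xi_path_first ?(lt_trans tx xa)//.
  by move: tx; rewrite ltr_pdivlMr// => tx h; nra.
Qed.

Lemma tau_minus_later x : 0 < x -> a * g 0 <= x ->
  tau_minus p x = ((g 0)%:E + tau_minus p' (x + (z 0 - a * g 0)))%E.
Proof.
move=> x0 xg; apply: first_time_shift; first exact: ltW.
  by move=> t t0 tg; rewrite /p xi_path_first// => h; nra.
by move=> t t0; rewrite /p xi_path_tail// -/p' opprD lerBrDl.
Qed.
End passage.
End counting.

(** * The oscillating path across a change of regime *)

Section switching.
Context (R : realType) (b : R).
Implicit Types (p : bool -> nat -> R -> R) (y d t : R).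

Definition position p y n : R := (switching p b y n).1.
Definition epoch p y n : \bar R := (switching p b y n).2.

Definition regime_duration p y n : \bar R :=
  if b < y then tau_minus (p true n) (y - b) else tau_plus (p false n) (b - y).

Definition regime_exit p y n : R :=
  if b < y then b else b + overshoot (p false n) (b - y).

Lemma switchingS p y n : switching p b y n.+1 =
  (regime_exit p (position p y n) n,
   (epoch p y n + regime_duration p (position p y n) n)%E).
Proof.
rewrite /= /regime_exit /regime_duration /position /epoch.
by case: (switching p b y n) => y' u /=; case: ifP.
Qed.

Lemma positionS p y n :
  position p y n.+1 = regime_exit p (position p y n) n.
Proof. by rewrite {1}/position switchingS. Qed.

Lemma epochS p y n :
  epoch p y n.+1 = (epoch p y n + regime_duration p (position p y n) n)%E.
Proof. by rewrite {1}/epoch switchingS. Qed.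

Lemma regime_duration_ge0 p y n : (0 <= regime_duration p y n)%E.
Proof. by rewrite /regime_duration; case: ifP => _; exact: first_time_ge0. Qed.

Lemma regime_duration_neqNy p y n : (regime_duration p y n != -oo)%E.
Proof. by rewrite gt_eqF// (lt_le_trans ltNy0) ?regime_duration_ge0. Qed.

Lemma epoch_nd p y : {homo epoch p y : i j / (i <= j)%N >-> (i <= j)%E}.
Proof.
apply: homo_leq => //; first by move=> u v w; exact: le_trans.
by move=> n; rewrite epochS leeDl// regime_duration_ge0.
Qed.

Lemma epoch_ge0 p y n : (0 <= epoch p y n)%E.
Proof. exact: (@epoch_nd p y 0%N). Qed.

Lemma oscillating_bracket p y n t :
  (epoch p y n <= t%:E)%E -> (t%:E < epoch p y n.+1)%E ->
  oscillating p b y t =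
  position p y n + p (b < position p y n) n (t - fine (epoch p y n)).
Proof.
move=> nt tn.
have E : count_by (fun m => (switching p b y m.+1).2) t = n.
  apply: count_by_bracket => // [i j ij|m mn]; first exact: epoch_nd.
  by apply: le_trans nt; exact: epoch_nd.
by rewrite /oscillating E /position /epoch; case: (switching p b y n).
Qed.

(** Guarantees that every instant lies in some regime; otherwise [oscillating] has a
    conventional value. *)
Definition nonexplosive p y := forall t, exists n, (t%:E < epoch p y n.+1)%E.

Lemma epoch_bracket p y t : nonexplosive p y -> 0 <= t ->
  exists n, (epoch p y n <= t%:E)%E /\ (t%:E < epoch p y n.+1)%E.
Proof.
move=> /(_ t) ne t0; have [[|n] tn minn] := ex_minnP ne.
  by exists 0%N; split=> //; rewrite /epoch/= lee_fin.
exists n.+1; split=> //; rewrite leNgt; apply/negP => /minn.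
by rewrite ltnn.
Qed.

Section switch.
Variables (p p' : bool -> nat -> R -> R) (y y' d : R).
Hypothesis first : switching p b y 1 = (y', d%:E).
Hypothesis pp' : forall i n, p i n.+1 = p' i n.

Lemma switching_switch n :
  switching p b y n.+1 = (position p' y' n, (d%:E + epoch p' y' n)%E).
Proof.
elim: n => [|n IHn]; first by rewrite first /position /epoch /= adde0.
have posE : position p y n.+1 = position p' y' n by rewrite /position IHn.
have epoE : epoch p y n.+1 = (d%:E + epoch p' y' n)%E by rewrite /epoch IHn.
rewrite switchingS posE epoE positionS epochS addeA.
by rewrite /regime_exit /regime_duration !pp'.
Qed.

Lemma epoch_gt_switch t n : ((t - d)%:E < epoch p' y' n.+1)%E ->
  (t%:E < epoch p y n.+2)%E.
Proof.
move=> tn.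
by rewrite /epoch switching_switch/= -lteBlDl// -EFinB.
Qed.

(** After a change of regime only copies with a larger index are used, so the path
    goes on as the oscillating path built on the shifted family of copies. *)
Lemma oscillating_switch t : nonexplosive p' y' -> 0 <= t ->
  oscillating p b y (d + t) = oscillating p' b y' t.
Proof.
move=> ne t0; have [n [nt tn]] := epoch_bracket ne t0.
rewrite (oscillating_bracket nt tn) (@oscillating_bracket _ _ n.+1).
- rewrite /position /epoch switching_switch/= pp'; congr (_ + p' _ _ _).
  rewrite fineD//; first by rewrite /= -/(epoch p' y' n); lra.
  by rewrite ge0_fin_numE ?epoch_ge0// (le_lt_trans nt) ?ltry.
- by rewrite /epoch switching_switch/= EFinD leeD2l.
- by rewrite /epoch switching_switch/= EFinD lteD2lE.
Qed.
End switch.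

Section stay.
Variables (p p' : bool -> nat -> R -> R) (y y' d : R).
Hypothesis side : (b < y) = (b < y').
Hypothesis duration : regime_duration p y 0 = (d%:E + regime_duration p' y' 0)%E.
Hypothesis exit : (regime_duration p' y' 0 < +oo)%E ->
  regime_exit p y 0 = regime_exit p' y' 0.
Hypothesis pp' : forall i n, p i n.+1 = p' i n.+1.

Lemma epoch_stay n : epoch p y n.+1 = (d%:E + epoch p' y' n.+1)%E /\
  ((epoch p' y' n.+1 < +oo)%E -> position p y n.+1 = position p' y' n.+1).
Proof.
elim: n => [|n [IHe IHp]].
  by rewrite !epochS !positionS /epoch /position /= !add0e.
rewrite !(epochS _ _ n.+1) !(positionS _ _ n.+1) IHe.
have [fin|] := boolP (epoch p' y' n.+1 < +oo)%E.
  rewrite -(IHp fin) addeA; split=> [|_].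
    by rewrite /regime_duration !pp'.
  by rewrite /regime_exit !pp'.
rewrite -leNgt leye_eq => /eqP ->; split=> //.
  by rewrite !addye ?regime_duration_neqNy.
by rewrite addye ?regime_duration_neqNy// ltxx.
Qed.

Lemma epoch_gt_stay t n : ((t - d)%:E < epoch p' y' n.+1)%E ->
  (t%:E < epoch p y n.+1)%E.
Proof.
move=> tn; by rewrite (epoch_stay n).1 -lteBlDl// -EFinB.
Qed.

(** Here the first jump does not end the regime: the current copy is replaced by what
    remains of it, and all other copies are unchanged. *)
Lemma oscillating_stay t : nonexplosive p' y' -> 0 <= t -> 0 <= d ->
  (forall t, 0 <= t -> y + p (b < y) 0 (d + t) = y' + p' (b < y) 0 t) ->
  oscillating p b y (d + t) = oscillating p' b y' t.
Proof.
move=> ne t0 d0 pE; have [[|n] [nt tn]] := epoch_bracket ne t0.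
  rewrite (oscillating_bracket nt tn) (@oscillating_bracket _ _ 0).
  - by rewrite /position /epoch/= !subr0 -side pE.
  - by rewrite /epoch/= lee_fin addr_ge0.
  - by rewrite (epoch_stay 0).1 EFinD lteD2lE.
have [E1 P1] := epoch_stay n; have [E2 P2] := epoch_stay n.+1.
have foo : (epoch p' y' n.+1 < +oo)%E by rewrite (le_lt_trans nt) ?ltry.
rewrite (oscillating_bracket nt tn) (@oscillating_bracket _ _ n.+1).
- rewrite P1// E1 pp'; congr (_ + p' _ _ _).
  rewrite fineD//; first by rewrite /=; lra.
  by rewrite ge0_fin_numE ?epoch_ge0.
- by rewrite E1 EFinD leeD2l.
- by rewrite E2 EFinD lteD2lE.
Qed.
End stay.

Lemma oscillating_before p y t : 0 <= t -> (t%:E < regime_duration p y 0)%E ->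
  oscillating p b y t = y + p (b < y) 0 t.
Proof.
move=> t0 td; rewrite (@oscillating_bracket _ _ 0).
- by rewrite /position /epoch /= subr0.
- by rewrite /epoch /= lee_fin.
- by rewrite epochS /epoch /= add0e.
Qed.
End switching.

(** * The chain of levels and jumps *)

Definition source : eqType := ((bool * nat * nat) + (bool * nat * nat))%type.

Definition shift_copy (i : bool) (n : nat) (x : bool * nat * nat) :
    bool * nat * nat :=
  let: (i', n', k) := x in
  if (i' == i) && (n' == n) then (i', n', k.+1) else x.

Definition skip_gap i n (s : source) : source :=
  match s with inl x => inl (shift_copy i n x) | inr x => inr x end.

Definition skip_jump i n (s : source) : source :=
  match s with inl x => inl x | inr x => inr (shift_copy i n x) end.

(** Sources that are still unused when the first gap and the first jump of the copy 0
    of type [i] have been used. *)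
Definition skip_event i : source -> source := skip_gap i 0 \o skip_jump i 0.

(** Sources left when the copies 0 of both types are discarded. *)
Definition skip_copy (s : source) : source :=
  match s with
  | inl (i, n, k) => inl (i, n.+1, k)
  | inr (i, n, k) => inr (i, n.+1, k)
  end.

Section chain.
Context (R : realType).
Variables (a : bool -> R) (b : R).
Hypothesis a_gt0 : forall i, 0 < a i.
Implicit Types (v : source -> R) (lvl : bool -> \bar R) (y g z : R).

Definition gaps v i n k : R := v (inl (i, n, k)).
Definition jumps v i n k : R := v (inr (i, n, k)).

Definition paths v (i : bool) (n : nat) : R -> R :=
  xi_path (a i) (gaps v i n) (jumps v i n).

(** Whether the drift reaches the level attached to the present side of [b] before the
    next jump. *)
Definition hits lvl y g : bool := ((y - a (b < y)%R * g)%:E < lvl (b < y)%R)%E.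

Definition step_time lvl y g : R :=
  if hits lvl y g then (y - fine (lvl (b < y))) / a (b < y) else g.

Definition step_pos lvl y g z : R :=
  if hits lvl y g then fine (lvl (b < y)) else y - a (b < y) * g + z.

(** A step that ends on the other side of [b] ends the regime, and the current copies are
    given up.  Reaching [b] from above counts, since the process at [b] moves like
    [xi_1]. *)
Definition next_copy (i : bool) y v : source -> R :=
  if (b < y) == i then v else v \o skip_copy.

Section steps.
Variables (lvl : bool -> \bar R) (v : source -> R) (y : R).
Let i := b < y.
Definition time_of : R := step_time lvl y (gaps v i 0 0).
Definition pos_of : R := step_pos lvl y (gaps v i 0 0) (jumps v i 0 0).
Definition env_of : source -> R := next_copy i pos_of (v \o skip_event i).
End steps.

Definition good v : Prop :=
  (forall i n, proper (gaps v i n)) /\ (forall i n k, 0 < jumps v i n k).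

Lemma gaps_skip_event v i : gaps (v \o skip_event i) i 0 = gaps v i 0 \o succn.
Proof. by apply/funext => k; rewrite /gaps /= /skip_event /= eqxx. Qed.

Lemma jumps_skip_event v i :
  jumps (v \o skip_event i) i 0 = jumps v i 0 \o succn.
Proof. by apply/funext => k; rewrite /jumps /= /skip_event /= eqxx. Qed.

Lemma gaps_skip_event_other v i j n : ~~ ((j == i) && (n == 0%N)) ->
  gaps (v \o skip_event i) j n = gaps v j n.
Proof. by move=> h; apply/funext => k; rewrite /gaps /= /skip_event /= (negPf h). Qed.

Lemma jumps_skip_event_other v i j n : ~~ ((j == i) && (n == 0%N)) ->
  jumps (v \o skip_event i) j n = jumps v j n.
Proof. by move=> h; apply/funext => k; rewrite /jumps /= /skip_event /= (negPf h). Qed.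

Lemma good_skip_event v i : good v -> good (v \o skip_event i).
Proof.
move=> [pv jv]; split=> [j n|j n k].
  have [/andP[/eqP-> /eqP->]|h] := boolP ((j == i) && (n == 0%N)).
    by rewrite gaps_skip_event; exact: proper_tail.
  by rewrite gaps_skip_event_other.
have [/andP[/eqP-> /eqP->]|h] := boolP ((j == i) && (n == 0%N)).
  by rewrite jumps_skip_event; exact: jv.
by rewrite jumps_skip_event_other.
Qed.

Lemma good_next_copy v i z : good v -> good (next_copy i z v).
Proof.
move=> gv; rewrite /next_copy; case: ifP => // _.
have [pv jv] := gv; split=> [j n|j n k]; [exact: (pv j n.+1)|exact: (jv j n.+1)].
Qed.

Lemma good_env_of lvl v y : good v -> good (env_of lvl v y).
Proof. by move=> gv; apply: good_next_copy; exact: good_skip_event. Qed.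

(** Below [b] the drift meets no level that matters, hence [-oo]. *)
Definition free_level (i : bool) : \bar R := if i then b%:E else -oo%E.

Section renewal.
Variables (v : source -> R) (y : R).
Hypothesis gv : good v.
Let i := b < y.
Let g := gaps v i 0 0.
Let z := jumps v i 0 0.
Let d := time_of free_level v y.
Let y' := pos_of free_level v y.
Let v' := env_of free_level v y.
Let p := paths v.
Let p' := paths v'.

Let g_gt0 : 0 < g. Proof. by have [/(_ i 0%N)[h _] _] := gv; exact: h. Qed.
Let z_gt0 : 0 < z. Proof. by have [_ h] := gv; exact: h. Qed.
Let proper0 : proper (gaps v i 0). Proof. by have [h _] := gv; exact: h. Qed.

(** Decomposition of the path at the first step of the chain.  Either the regime ends
    there, or the first jump stays on the same side of [b] and the regime continues
    with the rest of the current copy. *)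
Lemma renewal_cases :
  (switching p b y 1 = (y', d%:E) /\ (forall j n, p j n.+1 = p' j n)) \/
  [/\ (b < y) = (b < y'),
      regime_duration b p y 0 = (d%:E + regime_duration b p' y' 0)%E,
      (regime_duration b p' y' 0 < +oo)%E ->
        regime_exit b p y 0 = regime_exit b p' y' 0,
      forall j n, p j n.+1 = p' j n.+1 &
      forall t, 0 <= t -> y + p (b < y) 0 (d + t) = y' + p' (b < y) 0 t].
Proof.
have switchE : (b < y') != i -> forall j n, p j n.+1 = p' j n.
  move=> h j n; rewrite /p' /v' /env_of /next_copy ifN//.
  by rewrite /p /paths -(@gaps_skip_event_other v i j n.+1) ?andbF//
    -(@jumps_skip_event_other v i j n.+1) ?andbF.
have stayE : (b < y') = i -> v' = v \o skip_event i.
  by move=> h; rewrite /v' /env_of /next_copy h eqxx.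
have stayE1 : (b < y') = i -> forall j n, p j n.+1 = p' j n.+1.
  move=> /stayE E j n; rewrite /p' E /paths.
  by rewrite gaps_skip_event_other ?andbF// jumps_skip_event_other ?andbF.
have stayE0 : (b < y') = i ->
    p' i 0 = xi_path (a i) (gaps v i 0 \o succn) (jumps v i 0 \o succn).
  by move=> /stayE E; rewrite /p' E /paths gaps_skip_event jumps_skip_event.
have nohit : hits free_level y g = false ->
    d = g /\ y' = y - a i * g + z.
  by move=> h; rewrite /d /y' /time_of /pos_of /step_time /step_pos -/i -/g h.
have [iT|iF] := boolP i.
  have lvlT : free_level i = b%:E by rewrite iT.
  have yb : 0 < y - b by rewrite subr_gt0.
  have [hit|/negbTE nhit] := boolP (hits free_level y g).
    left.
    have y'E : y' = b.
      by rewrite /y' /pos_of /step_pos -/i -/g hit iT.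
    have dE : d = (y - b) / a i.
      by rewrite /d /time_of /step_time -/i -/g hit iT.
    split; last by apply: switchE; rewrite y'E ltxx iT.
    rewrite switchingS y'E dE /epoch/= add0e /regime_exit /regime_duration.
    rewrite /position /= -/i iT; congr (_, _).
    have := @tau_minus_now R (a i) _ (jumps v i 0) (a_gt0 i) proper0 _ yb.
    rewrite /p /paths -iT; apply.
    move: hit; rewrite /hits -/i lvlT lte_fin -/g; lra.
  right; have [dE y'E] := nohit nhit.
  have gb : b <= y - a i * g.
    move: nhit; rewrite /hits -/i lvlT lte_fin.
    by move=> /negbT; rewrite -leNgt.
  have y'i : b < y' by rewrite y'E; have := z_gt0; lra.
  have y'i' : (b < y') = i by rewrite iT.
  have tE : tau_minus (p i 0) (y - b) = (d%:E + tau_minus (p' i 0) (y' - b))%E.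
    rewrite stayE0// dE /p /paths tau_minus_later//.
      by congr (_ + tau_minus _ _)%E; rewrite y'E /z /g; lra.
    by rewrite -/g; lra.
  split=> //.
  - by rewrite /regime_duration -/i iT y'i; move: tE; rewrite iT.
  - by rewrite /regime_exit -/i iT y'i.
  - by rewrite -/i; exact: stayE1.
  - move=> t t0; rewrite -/i stayE0// dE /p /paths xi_path_tail//.
    by rewrite y'E /z /g; lra.
have yb : 0 <= b - y by rewrite subr_ge0 leNgt.
have [dE y'E] : d = g /\ y' = y - a i * g + z.
  by apply: nohit; rewrite /hits -/i (negbTE iF) /= ltNge leNye.
have [y'i|] := ltP b y'.
  left; have [] := @tau_plus_now R (a i) _ (jumps v i 0) (a_gt0 i) proper0 (b - y) yb.
    by rewrite -/g -/z; lra.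
  move=> tE oE; split; last by apply: switchE; rewrite y'i (negbTE iF).
  rewrite switchingS /epoch /= add0e /regime_exit /regime_duration /position/=.
  rewrite -/i (negbTE iF) /p /paths -[in RHS]/g; congr (_, _).
    by move: oE; rewrite (negbTE iF) => ->; rewrite y'E /z /g (negbTE iF); lra.
  by move: tE; rewrite dE /g (negbTE iF).
rewrite leNgt => /negbTE y'i; right.
have y'i' : (b < y') = i by rewrite y'i (negbTE iF).
have [tE oE] := @tau_plus_later R (a i) _ (jumps v i 0) (a_gt0 i) proper0 (b - y) yb.
have eqb : b - y - (z - a i * g) = b - y' by rewrite y'E; lra.
rewrite -/g -/z eqb -stayE0// in tE oE.
split=> //.
- by rewrite -/i (negbTE iF).
- by rewrite /regime_duration -/i (negbTE iF) y'i dE; move: tE; rewrite (negbTE iF).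
- rewrite /regime_duration /regime_exit -/i (negbTE iF) y'i => fin.
  move: oE; rewrite (negbTE iF) => /(_ fin) oE.
  by congr (b + _); exact: oE.
- by rewrite -/i; exact: stayE1.
- move=> t t0; rewrite -/i stayE0// dE /p /paths xi_path_tail//.
  by rewrite y'E /z /g; lra.
Qed.

Lemma time_of_gt0 : 0 < d.
Proof.
rewrite /d /time_of /step_time -/i -/g; case: ifPn => // hit.
move: hit; rewrite /hits -/i; case: (boolP i) => [iT|iF].
  by rewrite divr_gt0// subr_gt0.
by rewrite ltNge leNye.
Qed.

Lemma time_of_le_gap : d <= g.
Proof.
rewrite /d /time_of /step_time -/i -/g; case: ifPn => //.
rewrite /hits -/i; case: (boolP i) => [iT|iF]; last by rewrite ltNge leNye.
by rewrite lte_fin ler_pdivrMr// mulrC => h; rewrite lerBlDr -lerBlDl ltW.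
Qed.

Lemma time_of_le_duration : (d%:E <= regime_duration b p y 0)%E.
Proof.
case: renewal_cases => [[E _]|[_ -> _ _ _]]; last first.
  by rewrite leeDl// regime_duration_ge0.
have := epochS b p y 0; rewrite {1}/epoch E {1}/epoch /= add0e => <-.
exact: lexx.
Qed.

Lemma oscillating_step_before t : 0 <= t -> t < d ->
  oscillating p b y t = y - a i * t.
Proof.
move=> t0 td; rewrite oscillating_before//; last first.
  by rewrite (lt_le_trans _ time_of_le_duration)// lte_fin.
by rewrite -/i /p /paths xi_path_first// (lt_le_trans td)// time_of_le_gap.
Qed.

Lemma oscillating_step_after t : nonexplosive b p' y' -> 0 <= t ->
  oscillating p b y (d + t) = oscillating p' b y' t.
Proof.
move=> ne t0; case: renewal_cases => [[E pp']|[side dur ex pp' pE]].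
  exact: oscillating_switch.
by apply: oscillating_stay => //; exact: ltW time_of_gt0.
Qed.

Lemma epoch_gt_step t : (exists n, ((t - d)%:E < epoch b p' y' n.+1)%E) ->
  exists n, (t%:E < epoch b p y n.+1)%E.
Proof.
move=> [n tn]; case: renewal_cases => [[E pp']|[side dur ex pp' pE]].
  by exists n.+1; exact: epoch_gt_switch E pp' _ _ _.
by exists n; exact: epoch_gt_stay tn.
Qed.

End renewal.

Fixpoint clock (m : nat) v y : R :=
  if m is m'.+1 then
    time_of free_level v y + clock m' (env_of free_level v y) (pos_of free_level v y)
  else 0.

Definition unbounded_clock v y := forall t, exists m, t < clock m v y.

Lemma unbounded_clock_step v y : good v -> unbounded_clock v y ->
  unbounded_clock (env_of free_level v y) (pos_of free_level v y).
Proof.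
move=> gv uc t; have [[|m] /=] := uc (t + time_of free_level v y).
  by exists 0%N => /=; have := time_of_gt0 y gv; lra.
by rewrite addrC ltrD2l; exists m.
Qed.

Lemma unbounded_clock_nonexplosive v y : good v -> unbounded_clock v y ->
  nonexplosive b (paths v) y.
Proof.
move=> gv uc t; have [m] := uc t; elim: m v y t gv {uc} => [|m IHm] v y t gv /= tm.
  by exists 0%N; rewrite (lt_le_trans _ (epoch_ge0 _ _ _ _)) ?lte_fin.
apply: epoch_gt_step => //; apply: IHm; first exact: good_env_of.
by rewrite ltrBlDl.
Qed.

Section discount.
Variable s : R.
Hypothesis s0 : 0 < s.

(** The integrand of [laplace]. *)
Definition discount (u : \bar R) : R := fine (expeR (- (s%:E * u))%E).

Lemma discount0 : discount 0%E = 1.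
Proof. by rewrite /discount mule0 oppe0 /= expR0. Qed.

Lemma discountE t : discount t%:E = expR (- (s * t)).
Proof. by []. Qed.

Lemma discount_ge0 u : 0 <= discount u.
Proof. by rewrite /discount fine_ge0// expeR_ge0. Qed.

Lemma discount_le1 u : (0 <= u)%E -> discount u <= 1.
Proof.
case: u => [t|_|//]; last by rewrite /discount gt0_muley ?lte_fin.
rewrite lee_fin => t0.
by rewrite discountE -expR0 ler_expR oppr_le0 mulr_ge0// ltW.
Qed.

Lemma discountD t u : (0 <= u)%E ->
  discount (t%:E + u)%E = expR (- (s * t)) * discount u.
Proof.
case: u => [u| |] // _; last by rewrite addey// /discount gt0_muley ?lte_fin//= mulr0.
by rewrite -EFinD !discountE mulrDr opprD expRD.
Qed.

(** Discounted value of [psi] when the chain is stopped on entering [dead], and after [m]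
    steps at the latest. *)
Fixpoint payoff lvl (dead : R -> bool) (psi : R -> R) (m : nat) v y : R :=
  if dead y then psi y else
  if m is m'.+1 then
    expR (- (s * time_of lvl v y)) *
    payoff lvl dead psi m' (env_of lvl v y) (pos_of lvl v y)
  else psi y.

(** The process can exceed [k] only at a jump, since it decreases between jumps and
    [b <= k]; so the passage time is the time the chain enters the set above [k].  If
    that takes more than [m] steps, the transform is still between 0 and the discount
    accumulated so far. *)
Lemma payoff_upper k m v y : good v -> unbounded_clock v y -> b <= k ->
  payoff free_level (fun y => k < y) (fun y => (k < y)%R%:R) m v y
    <= discount (upper_passage (paths v) b y k)
    <= payoff free_level (fun y => k < y) (fun=> 1) m v y.
Proof.
move=> gv uc bk; elim: m v y gv uc => [|m IHm] v y gv uc.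
  have := discount_ge0 (upper_passage (paths v) b y k).
  have := @discount_le1 (upper_passage (paths v) b y k) (first_time_ge0 _).
  rewrite /=; case: ifPn => [ky _ _|/negbTE yk d1 d0]; last by rewrite yk; apply/andP; split.
  have -> : upper_passage (paths v) b y k = 0%E.
    apply: first_time_at => // [|t t0]; last by rewrite ltNge t0.
    by rewrite oscillating_step_before ?time_of_gt0// mulr0 subr0.
  by rewrite discount0 ky lexx.
have ne := unbounded_clock_nonexplosive (good_env_of free_level y gv)
  (unbounded_clock_step gv uc).
rewrite /=; case: ifPn => [ky|yk].
  have -> : upper_passage (paths v) b y k = 0%E.
    apply: first_time_at => // [|t t0]; last by rewrite ltNge t0.
    by rewrite oscillating_step_before ?time_of_gt0// mulr0 subr0.
  by rewrite discount0 ky lexx.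
set d := time_of _ v y; set v' := env_of _ v y; set y' := pos_of _ v y.
have -> : upper_passage (paths v) b y k =
    (d%:E + upper_passage (paths v') b y' k)%E.
  apply: first_time_shift; first by rewrite ltW ?time_of_gt0.
    move=> t t0 td; rewrite oscillating_step_before// => h.
    by have := mulr_ge0 (ltW (a_gt0 (b < y))) t0; move: yk; rewrite -leNgt; lra.
  by move=> t t0; rewrite oscillating_step_after.
rewrite discountD ?first_time_ge0// !ler_pM2l ?expR_gt0//.
exact: IHm (good_env_of _ _ gv) (unbounded_clock_step gv uc).
Qed.

(** A passage below [r] takes place during a drift, so [r] is added as the level at which
    the chain stops below [b]. *)
Definition barrier_level r (i : bool) : \bar R := (if i then b else r)%:E.

(** Above [b >= r] the barrier changes nothing, and below [b] it only stops the chain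
    earlier, exactly at the passage; otherwise the steps with and without barrier
    coincide. *)
Lemma payoff_lower r m v y : good v -> unbounded_clock v y -> r <= b ->
  payoff (barrier_level r) (fun y => y <= r) (fun y => (y <= r)%R%:R) m v y
    <= discount (lower_passage (paths v) b y r)
    <= payoff (barrier_level r) (fun y => y <= r) (fun=> 1) m v y.
Proof.
move=> gv uc rb.
have dead0 v' y' : good v' -> y' <= r -> lower_passage (paths v') b y' r = 0%E.
  move=> gv' yr; apply: first_time_at => // [|t t0]; last by rewrite ltNge t0.
  by rewrite oscillating_step_before ?time_of_gt0// mulr0 subr0.
elim: m v y gv uc => [|m IHm] v y gv uc.
  have := discount_ge0 (lower_passage (paths v) b y r).
  have := @discount_le1 (lower_passage (paths v) b y r) (first_time_ge0 _).
  rewrite /=; case: ifPn => [yr _ _|/negbTE ry d1 d0]; last by rewrite ry; apply/andP; split.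
  by rewrite dead0// discount0 yr lexx.
have ne := unbounded_clock_nonexplosive (good_env_of free_level y gv)
  (unbounded_clock_step gv uc).
rewrite /=; case: ifPn => [yr|]; first by rewrite dead0// discount0 yr lexx.
rewrite -ltNge => ry.
(* below [b], the drift reaches [r] before the first jump or not *)
have [/andP[yb hr]|nhit] := boolP ((y <= b) && (y - a (b < y) * gaps v (b < y) 0 0 < r)).
  have iF : (b < y) = false by apply/negbTE; rewrite -leNgt.
  have hit : hits (barrier_level r) y (gaps v (b < y) 0 0).
    by move: hr; rewrite /hits /barrier_level lte_fin iF.
  have fhit : hits free_level y (gaps v (b < y) 0 0) = false.
    by rewrite /hits /free_level iF ltNge leNye.
  have y'E : pos_of (barrier_level r) v y = r by rewrite /pos_of /step_pos hit /= iF.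
  have dE : time_of (barrier_level r) v y = (y - r) / a (b < y).
    by rewrite /time_of /step_time hit /= iF.
  have dg : (y - r) / a (b < y) < gaps v (b < y) 0 0.
    by rewrite ltr_pdivrMr// mulrC; move: hr; lra.
  have fd : time_of free_level v y = gaps v (b < y) 0 0.
    by rewrite /time_of /step_time fhit.
  have d0 : 0 <= (y - r) / a (b < y) 
    by apply: divr_ge0; [rewrite subr_ge0; exact: ltW|exact: ltW].
  have -> : lower_passage (paths v) b y r = ((y - r) / a (b < y))%:E.
    apply: first_time_at => //.
      by rewrite oscillating_step_before ?fd// mulrC divfK ?gt_eqF//; lra.
    move=> t t0 td; rewrite oscillating_step_before// ?fd ?(lt_trans td)//.
    by move: td; rewrite ltr_pdivlMr// => td h; nra.
  have one n : payoff (barrier_level r) (fun y => y <= r) (fun=> 1) n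
      (env_of (barrier_level r) v y) r = 1 by case: n => [|n] /=; rewrite lexx.
  have one' n : payoff (barrier_level r) (fun y => y <= r) (fun y => (y <= r)%R%:R) n
      (env_of (barrier_level r) v y) r = 1 by case: n => [|n] /=; rewrite lexx.
  by rewrite y'E one one' dE discountE mulr1 lexx.
have hitsE : hits (barrier_level r) y (gaps v (b < y) 0 0) =
    hits free_level y (gaps v (b < y) 0 0).
  rewrite /hits /barrier_level /free_level; case: (boolP (b < y)) => // by0.
  rewrite [RHS]ltNge leNye/= lte_fin; apply/negbTE; apply: contraNN nhit => h.
  by rewrite (negbTE by0) h leNgt by0.
have dE : time_of (barrier_level r) v y = time_of free_level v y.
  rewrite /time_of /step_time hitsE; case: ifPn => //.
  by rewrite /hits /barrier_level /free_level; case: ifPn => // _; rewrite ltNge leNye.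
have y'E : pos_of (barrier_level r) v y = pos_of free_level v y.
  rewrite /pos_of /step_pos hitsE; case: ifPn => //.
  by rewrite /hits /barrier_level /free_level; case: ifPn => // _; rewrite ltNge leNye.
have v'E : env_of (barrier_level r) v y = env_of free_level v y.
  by rewrite /env_of y'E.
rewrite dE y'E v'E.
set d := time_of _ v y; set v' := env_of _ v y; set y' := pos_of _ v y.
have -> : lower_passage (paths v) b y r =
    (d%:E + lower_passage (paths v') b y' r)%E.
  apply: first_time_shift; first by rewrite ltW ?time_of_gt0.
    move=> t t0 td; rewrite oscillating_step_before// => h.
    have := a_gt0 (b < y); have := time_of_le_gap v y.
    move: td h; rewrite /d; set e := time_of _ _ _; set gg := gaps _ _ _ _.
    have [yb|yb] := leP y b.
      move: nhit; rewrite yb -leNgt -/gg => rg td h eg a0.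
      have : 0 < a (b < y) * (gg - t) by rewrite mulr_gt0// subr_gt0 (lt_le_trans td).
      by rewrite mulrBr; move: rg; rewrite ltNge yb /=; lra.
    move=> td h eg a0; have eb : a true * e <= y - b.
      move: eg; rewrite /e /time_of /step_time -/gg; case: ifPn => [hit _|].
        by rewrite yb/= mulrC divfK ?gt_eqF.
      by rewrite /hits yb lte_fin -leNgt; lra.
    have : 0 < a true * (e - t) by rewrite mulr_gt0// subr_gt0.
    by rewrite mulrBr; move: rb; lra.
  by move=> t t0; rewrite oscillating_step_after.
rewrite discountD ?first_time_ge0// !ler_pM2l ?expR_gt0//.
exact: IHm (good_env_of _ _ gv) (unbounded_clock_step gv uc).
Qed.
End discount.
End chain.

(** * Exponential waiting along a drift *)

Lemma expR_decay (R : realType) (c M e : R) : 0 < c -> 0 < e ->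
  exists2 X, 0 < X & forall x, X <= x -> expR (- (c * x)) * M <= e.
Proof.
move=> c0 e0; exists (`|M| / (e * c) + 1).
  by rewrite ltr_pwDr// divr_ge0// ltW// mulr_gt0.
move=> x Xx; rewrite expRN mulrC ler_pdivrMr ?expR_gt0//.
apply: (le_trans (ler_norm M)); apply: (@le_trans _ _ (e * (1 + c * x))).
  have : `|M| / (e * c) <= x by rewrite (le_trans _ Xx)// lerDl.
  by rewrite ler_pdivrMr ?mulr_gt0// => h; nra.
by rewrite ler_pM2l// expR_ge1Dx.
Qed.

Lemma is_derive_continuous (R : realType) (f f' : R -> R) :
  (forall x : R, is_derive x 1 f (f' x)) -> continuous f.
Proof.
move=> df x; apply: differentiable_continuous; apply/derivable1_diffP.
exact: ex_derive.
Qed.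

Section killed_exponential.
Context (R : realType).
Local Notation leb := (@lebesgue_measure R).
Variables (lam s : R).
Hypotheses (lam_gt0 : 0 < lam) (s_ge0 : 0 <= s).
Let c := lam + s.
Let c_gt0 : 0 < c. Proof. by rewrite ltr_pwDl. Qed.
Variables (F F' : R -> R).
Hypothesis dF : forall x : R, is_derive x 1 F (F' x).
Hypothesis cF' : continuous F'.

Let G x := expR (- (c * x)) * (c * F x - F' x).
Let A x := - (expR (- (c * x)) * F x).

Let dE (x : R) : is_derive x 1 (fun x => expR (- (c * x))) (- c * expR (- (c * x))).
Proof.
apply: is_derive_eq; rewrite /GRing.scale /=; ring.
Qed.

Let dA (x : R) : is_derive x 1 A (G x).
Proof.
apply: is_derive_eq; rewrite /G /GRing.scale /=; ring.
Qed.

Let cF : continuous F := is_derive_continuous dF.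

Let cE : continuous (fun x => expR (- (c * x))) := is_derive_continuous dE.

Let cG : continuous G.
Proof.
move=> x; apply: cvgM; first exact: cE.
apply: cvgB; last exact: cF'.
by apply: cvgM; [exact: cvg_cst|exact: cF].
Qed.

Let cA : continuous A := is_derive_continuous dA.

(** [- exp (- c x) F x] is a primitive of the integrand, by the choice of the killing
    rate [c = lam + s]. *)
Lemma integral_generator (T : R) : 0 < T ->
  (\int[leb]_(x in `[0%R, T]) (G x)%:E = (F 0 - expR (- (c * T)) * F T)%:E)%E.
Proof.
move=> T0; rewrite (@continuous_FTC2 R G A 0 T)//.
- by rewrite -EFinB /A mulr0 oppr0 expR0; congr EFin; ring.
- exact: continuous_subspaceT.
- split; first by move=> x _; exact: ex_derive.
  + exact/cvg_at_right_filter/cA.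
  + exact/cvg_at_left_filter/cA.
- by move=> x _; rewrite derive1E; have ? := dA x; exact: derive_val.
Qed.

Variable phi : R -> \bar R.
Hypotheses (mphi : measurable_fun setT phi) (phi_ge0 : forall x, (0 <= phi x)%E).
Let K x := ((lam * expR (- lam * x))%:E * ((expR (- (s * x)))%:E * phi x))%E.

Let K_ge0 x : (0 <= K x)%E.
Proof.
apply: mule_ge0; first by rewrite lee_fin mulr_ge0 ?expR_ge0// ltW.
by apply: mule_ge0 => //; rewrite lee_fin expR_ge0.
Qed.

Let mK : measurable_fun setT K.
Proof.
apply: emeasurable_funM.
  apply/measurable_EFinP; apply: measurable_funM => //.
  by apply: measurableT_comp => //; exact: measurable_funM.
apply: emeasurable_funM => //; apply/measurable_EFinP.
by apply: measurableT_comp => //; apply: measurableT_comp => //; exact: measurable_funM.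
Qed.

Let mG : measurable_fun setT (EFin \o G).
Proof. by apply/measurable_EFinP; exact: continuous_measurable_fun. Qed.

Let KE x : K x = ((expR (- (c * x)))%:E * (lam%:E * phi x))%E.
Proof.
rewrite /K muleA -EFinM muleA -EFinM; congr (_%:E * _)%E.
by rewrite -mulrA -expRD mulrC; congr (expR _ * _); rewrite /c; ring.
Qed.

(** The inequality between the integrands is integrated, and the right-hand side is
    the explicit integral of [integral_generator]. *)
Lemma killed_le (T : R) : 0 < T ->
  (forall x, 0 <= x <= T -> (lam%:E * phi x <= (c * F x - F' x)%:E)%E) ->
  (\int[leb]_(x in `[0%R, T]) K x <= (F 0 - expR (- (c * T)) * F T)%:E)%E.
Proof.
move=> T0 le; rewrite -integral_generator//; apply: ge0_le_integral => //.
- exact: measurable_funTS.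
- exact: measurable_funTS.
- move=> x /=; rewrite in_itv/= => xT; rewrite KE EFinM lee_wpmul2l ?lee_fin ?expR_ge0//.
  exact: le.
Qed.

Lemma killed_ge (T : R) : 0 < T ->
  (forall x, 0 <= x <= T -> ((c * F x - F' x)%:E <= lam%:E * phi x)%E) ->
  ((F 0 - expR (- (c * T)) * F T)%:E <= \int[leb]_(x in `[0%R, T]) K x)%E.
Proof.
move=> T0 ge; rewrite -integral_generator// integralE.
apply: (@le_trans _ _ (\int[leb]_(x in `[0%R, T]) ((EFin \o G) ^\+ x))%E).
  by rewrite geeDl// oppe_le0 integral_ge0.
apply: ge0_le_integral => //.
- exact/measurable_funTS/measurable_funepos.
- exact: measurable_funTS.
- move=> x /=; rewrite in_itv/= => xT; rewrite funeposE ge_max K_ge0 andbT.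
  by rewrite KE /= EFinM lee_wpmul2l ?lee_fin ?expR_ge0//; exact: ge.
Qed.

(** On the half-line the boundary term at infinity vanishes because [F] is bounded. *)
Lemma killed_ley M :
  (forall x, 0 <= x -> (lam%:E * phi x <= (c * F x - F' x)%:E)%E) ->
  (forall x, 0 <= x -> `|F x| <= M) ->
  (\int[leb]_(x in `[0%R, +oo[) K x <= (F 0)%:E)%E.
Proof.
move=> le FM.
have G0 x : 0 <= x -> 0 <= G x.
  move=> x0; rewrite mulr_ge0 ?expR_ge0// -lee_fin; apply: le_trans (le _ x0).
  by rewrite mule_ge0// lee_fin ltW.
have -> : (F 0)%:E = (\int[leb]_(x in `[0%R, +oo[) (G x)%:E)%E.
  rewrite (@ge0_continuous_FTC2y R G A 0 0)//.
  - by rewrite -EFinB /A mulr0 oppr0 expR0; congr EFin; ring.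
  - exact: continuous_subspaceT.
  - rewrite /A -oppr0; apply: cvgN; apply/cvgrPdist_le => e e0.
    have [X X0 Xe] := @expR_decay R c M e c_gt0 e0.
    near=> x; rewrite sub0r normrN normrM ger0_norm ?expR_ge0//.
    apply: (@le_trans _ _ (expR (- (c * x)) * M)).
      by rewrite ler_wpM2l ?expR_ge0// FM//; near: x; exact: nbhs_pinfty_ge.
    by apply: Xe; near: x; apply: nbhs_pinfty_ge; exact: num_real.
  - exact/cvg_at_right_filter/cA.
  - by move=> x _; rewrite derive1E; have ? := dA x; exact: derive_val.
apply: ge0_le_integral => //.
- exact: measurable_funTS.
- exact: measurable_funTS.
- move=> x /=; rewrite in_itv/= andbT => x0; rewrite KE EFinM lee_wpmul2l ?lee_fin ?expR_ge0//.
  exact: le.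
Unshelve. all: by end_near.
Qed.

Lemma killed_gey M :
  (forall x, 0 <= x -> ((c * F x - F' x)%:E <= lam%:E * phi x)%E) ->
  (forall x, 0 <= x -> `|F x| <= M) ->
  ((F 0)%:E <= \int[leb]_(x in `[0%R, +oo[) K x)%E.
Proof.
move=> ge FM.
apply/lee_addgt0Pr => e e0.
have [X X0 Xe] := @expR_decay R c M e c_gt0 e0.
have gX x : 0 <= x <= X -> ((c * F x - F' x)%:E <= lam%:E * phi x)%E.
  by move=> /andP[x0 _]; exact: ge.
have := killed_ge X0 gX; rewrite EFinB leeBlDr// => /le_trans; apply.
apply: leeD.
  by apply: ge0_subset_integral => //; [exact: measurable_funTS|exact: subset_itvl].
rewrite lee_fin; apply: le_trans (Xe X (lexx _)).
rewrite ler_wpM2l ?expR_ge0// (le_trans (ler_norm _))// FM//; exact: ltW.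
Qed.

Lemma exponential_tail (T : R) :
  (\int[leb]_(x in `]T, +oo[) (lam * expR (- lam * x))%:E = (expR (- (lam * T)))%:E)%E.
Proof.
have dB (x : R) : is_derive x 1 (fun x : R => - expR (- lam * x)) (lam * expR (- lam * x)).
  by apply: is_derive_eq; rewrite /GRing.scale /=; ring.
have cB : continuous (fun x : R => - expR (- lam * x)).
  exact: is_derive_continuous dB.
have cB' : continuous (fun x : R => lam * expR (- lam * x)).
  have -> : (fun x : R => lam * expR (- lam * x)) = (fun x => (- lam) * (- expR (- lam * x))).
    by apply/funext => x; rewrite mulrNN.
  by move=> x; apply: cvgM; [exact: cvg_cst|exact: cB].
rewrite integral_itv_obnd_cbnd; last first.
  apply/measurable_EFinP/measurable_funTS.
  exact: continuous_measurable_fun cB'.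
rewrite (@ge0_continuous_FTC2y R _ (fun x => - expR (- lam * x)) T 0)//.
- by rewrite -EFinB sub0r opprK mulNr.
- by move=> x _; rewrite mulr_ge0 ?expR_ge0// ltW.
- exact: continuous_subspaceT.
- rewrite -oppr0; apply: cvgN; apply/cvgrPdist_le => e e0.
  have [X X0 Xe] := @expR_decay R lam 1 e lam_gt0 e0.
  near=> x; rewrite sub0r normrN ger0_norm ?expR_ge0//.
  rewrite -[leLHS]mulr1 mulNr.
  by apply: Xe; near: x; apply: nbhs_pinfty_ge; exact: num_real.
- exact/cvg_at_right_filter/cB.
- by move=> x _; rewrite derive1E derive_val.
Unshelve. all: by end_near.
Qed.

End killed_exponential.

(** * The law of the chain *)

Lemma measurable_bool_index d (D : measurableType d) (R : realType)
    (B : D -> bool) (F : bool -> D -> R) :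
  measurable_fun setT B -> (forall i, measurable_fun setT (F i)) ->
  measurable_fun setT (fun x => F (B x) x).
Proof.
move=> mB mF.
rewrite (_ : (fun x => _) = fun x => if B x then F true x else F false x).
  exact: measurable_fun_ifT.
by apply/funext => x; case: (B x).
Qed.

Lemma measurable_indicator_of d (D : measurableType d) (R : realType) (B : D -> bool) :
  measurable_fun setT B -> measurable_fun setT (fun x => (B x)%:R : R).
Proof.
move=> mB; rewrite (_ : (fun x => _) = fun x => if B x then 1 else 0).
  exact: measurable_fun_ifT.
by apply/funext => x; case: (B x).
Qed.

Section chain_measurable.
Context (R : realType) (a : bool -> R) (b s : R).
Variables (lvl : bool -> \bar R).
Context d (D : measurableType d).
Implicit Types (V : D -> source -> R) (Y g z : D -> R).

Lemma measurable_side Y : measurable_fun setT Y ->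
  measurable_fun setT (fun x => b < Y x).
Proof. by move=> mY; exact: measurable_fun_ltr. Qed.

Lemma measurable_hits Y g : measurable_fun setT Y -> measurable_fun setT g ->
  measurable_fun setT (fun x => hits a b lvl (Y x) (g x)).
Proof.
move=> mY mg; rewrite /hits.
have h i : measurable_fun setT (fun x => ((Y x - a i * g x)%:E < lvl i)%E).
  apply: measurable_fun_lte => //; apply/measurable_EFinP.
  by apply: measurable_funB => //; exact: measurable_funM.
rewrite (_ : (fun x => _) = fun x => if b < Y x
    then ((Y x - a true * g x)%:E < lvl true)%E
    else ((Y x - a false * g x)%:E < lvl false)%E).
  by apply: measurable_fun_ifT => //; exact: measurable_side.
by apply/funext => x; case: (b < Y x).
Qed.

Lemma measurable_step_time Y g : measurable_fun setT Y -> measurable_fun setT g ->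
  measurable_fun setT (fun x => step_time a b lvl (Y x) (g x)).
Proof.
move=> mY mg; apply: measurable_fun_ifT => //; first exact: measurable_hits.
apply: (@measurable_bool_index _ _ _ (fun x => b < Y x)
  (fun i x => (Y x - fine (lvl i)) / a i)); first exact: measurable_side.
by move=> i; apply: measurable_funM => //; exact: measurable_funB.
Qed.

Lemma measurable_step_pos Y g z : measurable_fun setT Y ->
  measurable_fun setT g -> measurable_fun setT z ->
  measurable_fun setT (fun x => step_pos a b lvl (Y x) (g x) (z x)).
Proof.
move=> mY mg mz; apply: measurable_fun_ifT => //; first exact: measurable_hits.
  apply: (@measurable_bool_index _ _ _ (fun x => b < Y x)
    (fun i x => fine (lvl i))) => //; exact: measurable_side.
apply: measurable_funD => //.
apply: (@measurable_bool_index _ _ _ (fun x => b < Y x)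
    (fun i x => Y x - a i * g x)); first exact: measurable_side.
by move=> i; apply: measurable_funB => //; exact: measurable_funM.
Qed.

Lemma measurable_next_copy V Y (i : D -> bool) j :
  (forall j, measurable_fun setT (fun x => V x j)) ->
  measurable_fun setT Y -> measurable_fun setT i ->
  measurable_fun setT (fun x => next_copy b (i x) (Y x) (V x) j).
Proof.
move=> mV mY mi.
rewrite (_ : (fun x => _) = fun x =>
    if i x then (if b < Y x then V x j else V x (skip_copy j))
    else (if b < Y x then V x (skip_copy j) else V x j)).
  by apply: measurable_fun_ifT => //; apply: measurable_fun_ifT => //;
    exact: measurable_side.
by apply/funext => x; rewrite /next_copy; case: (b < Y x); case: (i x).
Qed.

Lemma measurable_payoff (dead : R -> bool) (psi : R -> R) m V Y :
  measurable_fun setT dead -> measurable_fun setT psi ->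
  (forall j, measurable_fun setT (fun x => V x j)) -> measurable_fun setT Y ->
  measurable_fun setT (fun x => payoff a b s lvl dead psi m (V x) (Y x)).
Proof.
move=> mdead mpsi; elim: m V Y => [|m IHm] V Y mV mY /=.
  by apply: measurable_fun_ifT => //; exact: measurableT_comp.
apply: measurable_fun_ifT; [exact: measurableT_comp|exact: measurableT_comp|].
have mgap : measurable_fun setT (fun x => gaps (V x) (b < Y x) 0 0).
  apply: (@measurable_bool_index _ _ _ (fun x => b < Y x)
    (fun i x => gaps (V x) i 0 0)); [exact: measurable_side|by move=> i; exact: mV].
have mjump : measurable_fun setT (fun x => jumps (V x) (b < Y x) 0 0).
  apply: (@measurable_bool_index _ _ _ (fun x => b < Y x)
    (fun i x => jumps (V x) i 0 0)); [exact: measurable_side|by move=> i; exact: mV].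
have mpos : measurable_fun setT (fun x => pos_of a b lvl (V x) (Y x)).
  exact: measurable_step_pos.
apply: measurable_funM.
  apply: measurableT_comp => //; apply: measurableT_comp => //.
  by apply: measurable_funM => //; exact: measurable_step_time.
apply: IHm => // j; apply: (measurable_next_copy j
    (V := fun x => V x \o skip_event (b < Y x))) => //.
  move=> j'; apply: (@measurable_bool_index _ _ _ (fun x => b < Y x)
    (fun i x => V x (skip_event i j'))); [exact: measurable_side|by move=> i; exact: mV].
exact: measurable_side.
Qed.

End chain_measurable.

Section chain_law.
Context (R : realType) (a : bool -> R) (b s : R).
Variables (G nu : bool -> probability (measurableTypeR R) R).

Definition source_law (j : source) : probability (measurableTypeR R) R :=
  match j with inl (i, _, _) => G i | inr (i, _, _) => nu i end.

Variable mu : probability (env source R) R.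
Hypothesis prodP : product_law source_law mu.

Lemma shift_copy_inj i n : injective (shift_copy i n).
Proof.
move=> [[i1 n1] k1] [[i2 n2] k2] /=.
case: ifPn => [/andP[/eqP-> /eqP->]|h1]; case: ifPn => [/andP[/eqP-> /eqP->]|h2].
- by case=> ->.
- by case=> e1 e2; move: h2; rewrite -e1 -e2 !eqxx.
- by case=> e1 e2; move: h1; rewrite e1 e2 !eqxx.
- by case=> -> -> ->.
Qed.

Lemma shift_copy_head i n x : shift_copy i n x <> (i, n, 0%N).
Proof.
case: x => -[i' n'] k /=; case: ifPn => // h [e1 e2 _].
by move: h; rewrite e1 e2 !eqxx.
Qed.

Lemma skip_gap_inj i n : injective (skip_gap i n).
Proof. by move=> [x|x] [y|y] //= [] // /shift_copy_inj ->. Qed.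

Lemma skip_jump_inj i n : injective (skip_jump i n).
Proof. by move=> [x|x] [y|y] //= [] // /shift_copy_inj ->. Qed.

Lemma skip_copy_inj : injective skip_copy.
Proof. by move=> [[[i n] k]|[[i n] k]] [[[i' n'] k']|[[i' n'] k']] //= [-> -> ->]. Qed.

Lemma source_law_skip_gap i n j : source_law (skip_gap i n j) = source_law j.
Proof. by case: j => [[[i' n'] k]|[[i' n'] k]] //=; case: ifP. Qed.

Lemma source_law_skip_jump i n j : source_law (skip_jump i n j) = source_law j.
Proof. by case: j => [[[i' n'] k]|[[i' n'] k]] //=; case: ifP. Qed.

Lemma source_law_skip_copy j : source_law (skip_copy j) = source_law j.
Proof. by case: j => [[[i' n'] k]|[[i' n'] k]]. Qed.

Let T := env source R.

Lemma integral_first_gap i n (H : R * T -> \bar R) :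
  measurable_fun setT H -> (forall x, 0 <= H x)%E ->
  (\int[mu]_v H (gaps v i n 0%N, (v \o skip_gap i n : T)) =
   \int[G i]_g \int[mu]_v H (g, v))%E.
Proof.
move=> mH H0; apply: (product_law_fubini prodP (i0 := inl (i, n, 0%N))) => //.
- exact: skip_gap_inj.
- by move=> [x|x] //= [] /shift_copy_head.
- exact: source_law_skip_gap.
Qed.

Lemma integral_first_jump i n (H : R * T -> \bar R) :
  measurable_fun setT H -> (forall x, 0 <= H x)%E ->
  (\int[mu]_v H (jumps v i n 0%N, (v \o skip_jump i n : T)) =
   \int[nu i]_z \int[mu]_v H (z, v))%E.
Proof.
move=> mH H0; apply: (product_law_fubini prodP (i0 := inr (i, n, 0%N))) => //.
- exact: skip_jump_inj.
- by move=> [x|x] //= [] /shift_copy_head.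
- exact: source_law_skip_jump.
Qed.

Lemma integral_skip_copy (H : T -> \bar R) :
  measurable_fun setT H -> (forall x, 0 <= H x)%E ->
  (\int[mu]_v H (v \o skip_copy : T) = \int[mu]_v H v)%E.
Proof.
move=> mH H0; apply: (product_law_integral_reindex prodP
  (i0 := inl (true, 0%N, 0%N))) => //.
- exact: skip_copy_inj.
- by move=> [[[i n] k]|[[i n] k]].
- exact: source_law_skip_copy.
Qed.

Section step.
Variables (lvl : bool -> \bar R) (dead : R -> bool) (psi : R -> R).
Hypotheses (mdead : measurable_fun setT dead) (mpsi : measurable_fun setT psi).
Hypothesis psi_ge0 : forall y, 0 <= psi y.

Lemma payoff_ge0 m v y : 0 <= payoff a b s lvl dead psi m v y.
Proof.
by elim: m v y => [|m IHm] v y /=; case: ifP => // _; rewrite mulr_ge0 ?expR_ge0.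
Qed.

Lemma measurable_payoff_env m y :
  measurable_fun setT (fun v : T => payoff a b s lvl dead psi m v y).
Proof. by apply: measurable_payoff => // j; exact: measurable_coord. Qed.

Definition mean_payoff m y : \bar R :=
  (\int[mu]_v (payoff a b s lvl dead psi m v y)%:E)%E.

Lemma measurable_mean_payoff m : measurable_fun setT (mean_payoff m).
Proof.
apply: (@measurable_fun_fubini_tonelli_F _ _ (measurableTypeR R) T R mu
  (fun x => (payoff a b s lvl dead psi m x.2 x.1)%:E)).
  apply/measurable_EFinP; apply: measurable_payoff => //.
  by move=> j; apply: (measurableT_comp (measurable_coord j)).
by move=> x; rewrite lee_fin payoff_ge0.
Qed.

Lemma mean_payoff_stopped m y : (m == 0)%N || dead y -> mean_payoff m y = (psi y)%:E.
Proof.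
move=> stop; rewrite /mean_payoff -(integral_probability_cst mu); apply: eq_integral => v _.
by case: m stop => [_|m /= ->] //=; rewrite if_same.
Qed.

(** Markov property of the chain.  The first gap and then the first jump are integrated
    out by [product_law_fubini]; the sources that are left have the law of the whole
    family, whether or not copies are given up. *)
Lemma mean_payoffS m y : ~~ dead y ->
  mean_payoff m.+1 y = (\int[G (b < y)%R]_g \int[nu (b < y)%R]_z
    ((expR (- (s * step_time a b lvl y g)))%:E *
     mean_payoff m (step_pos a b lvl y g z)))%E.
Proof.
move=> ay; set i := b < y.
(* the first gap is singled out in [H1], then the first jump in [H2] *)
pose H1 (x : R * T) : \bar R := (expR (- (s * step_time a b lvl y x.1)) *
  let y' := step_pos a b lvl y x.1 (jumps x.2 i 0 0) in
  payoff a b s lvl dead psi m (next_copy b i y' (x.2 \o skip_jump i 0)) y')%:E.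
pose H2 g (x : R * T) : \bar R := (expR (- (s * step_time a b lvl y g)) *
  let y' := step_pos a b lvl y g x.1 in
  payoff a b s lvl dead psi m (next_copy b i y' x.2) y')%:E.
have mcoord d (D : measurableType d) (f : D -> T) j : measurable_fun setT f ->
    measurable_fun setT (fun x => f x j).
  by move=> mf; exact: (measurableT_comp (measurable_coord j)).
have mH1 : measurable_fun setT H1.
  apply/measurable_EFinP; apply: measurable_funM.
    apply: measurableT_comp => //; apply: measurableT_comp => //.
    by apply: measurable_funM => //; exact: measurable_step_time.
  have mpos : measurable_fun setT
      (fun x : R * T => step_pos a b lvl y x.1 (jumps x.2 i 0 0)).
    by apply: measurable_step_pos => //; exact: mcoord.
  apply: measurable_payoff => // j; apply: measurable_next_copy => //.
  by move=> j'; exact: mcoord.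
have mH2 g : measurable_fun setT (H2 g).
  apply/measurable_EFinP; apply: measurable_funM => //.
  have mpos : measurable_fun setT (fun x : R * T => step_pos a b lvl y g x.1).
    exact: measurable_step_pos.
  apply: measurable_payoff => // j; apply: measurable_next_copy => //.
  by move=> j'; exact: mcoord.
rewrite /mean_payoff.
transitivity (\int[mu]_v H1 (gaps v i 0%N 0%N, (v \o skip_gap i 0%N : T)))%E.
  by apply: eq_integral => v _; rewrite /= (negbTE ay).
rewrite integral_first_gap//; last first.
  by move=> x; rewrite lee_fin mulr_ge0 ?expR_ge0 ?payoff_ge0.
apply: eq_integral => g _.
transitivity (\int[mu]_v H2 g (jumps v i 0%N 0%N, (v \o skip_jump i 0%N : T)))%E.
  by apply: eq_integral.
rewrite integral_first_jump//; last first.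
  by move=> x; rewrite lee_fin mulr_ge0 ?expR_ge0 ?payoff_ge0.
apply: eq_integral => z _; rewrite /H2 /=.
set y' := step_pos _ _ _ _ _ _.
under eq_integral do rewrite EFinM.
have mp := measurable_payoff_env m y'.
have p0 v : (0 <= (payoff a b s lvl dead psi m v y')%:E)%E.
  by rewrite lee_fin payoff_ge0.
rewrite ge0_integralZl//; last first.
  apply/measurable_EFinP; apply: measurable_payoff => // j.
  by apply: measurable_next_copy => // j'; exact: measurable_coord.
congr (_ * _)%E; rewrite /next_copy; case E : ((b < y') == i) => //.
apply: (@integral_skip_copy (fun v => (payoff a b s lvl dead psi m v y')%:E)) => //.
exact/measurable_EFinP.
Qed.

Definition one_step (h : R -> R) (y : R) : \bar R :=
  (\int[G (b < y)%R]_g \int[nu (b < y)%R]_z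
    (expR (- (s * step_time a b lvl y g)) * h (step_pos a b lvl y g z))%:E)%E.

Lemma measurable_step_integrand (h : R -> \bar R) y : measurable_fun setT h ->
  measurable_fun setT (fun x : measurableTypeR R * measurableTypeR R =>
    ((expR (- (s * step_time a b lvl y x.1)))%:E * h (step_pos a b lvl y x.1 x.2))%E).
Proof.
move=> mh; apply: emeasurable_funM.
  apply/measurable_EFinP.
  apply: measurableT_comp => //; apply: measurableT_comp => //.
  by apply: measurable_funM => //; exact: measurable_step_time.
apply: measurableT_comp => //.
by apply: measurable_step_pos.
Qed.

Lemma measurable_step_section (h : R -> \bar R) y g : measurable_fun setT h ->
  measurable_fun setT (fun z : measurableTypeR R =>
    ((expR (- (s * step_time a b lvl y g)))%:E * h (step_pos a b lvl y g z))%E).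
Proof.
move=> mh; apply: emeasurable_funM; first exact: measurable_cst.
apply: measurableT_comp => //.
exact: (@measurable_step_pos R a b lvl _ _ (fun=> y) (fun=> g) id).
Qed.

Lemma le_step_integral (h1 h2 : R -> \bar R) y i :
  measurable_fun setT h1 -> measurable_fun setT h2 ->
  (forall z, 0 <= h1 z)%E -> (forall z, h1 z <= h2 z)%E ->
  (\int[G i]_g \int[nu i]_z
     ((expR (- (s * step_time a b lvl y g)))%:E * h1 (step_pos a b lvl y g z)) <=
   \int[G i]_g \int[nu i]_z
     ((expR (- (s * step_time a b lvl y g)))%:E * h2 (step_pos a b lvl y g z)))%E.
Proof.
move=> mh1 mh2 h10 h12.
have h20 z : (0 <= h2 z)%E := le_trans (h10 z) (h12 z).
have pos h g z : (forall z, 0 <= h z)%E ->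
  (0 <= (expR (- (s * step_time a b lvl y g)))%:E * h (step_pos a b lvl y g z))%E.
  by move=> h0; rewrite mule_ge0// lee_fin expR_ge0.
have m1 := measurable_step_integrand y mh1.
have m2 := measurable_step_integrand y mh2.
apply: ge0_le_integral => //.
- by move=> g _; apply: integral_ge0 => z _; exact: pos.
- by apply: (measurable_fun_fubini_tonelli_F _ m1) => x; exact: pos.
- by apply: (measurable_fun_fubini_tonelli_F _ m2) => x; exact: pos.
move=> g _; apply: ge0_le_integral => //.
- by move=> z _; exact: pos.
- exact: measurable_step_section.
- exact: measurable_step_section.
- by move=> z _; rewrite lee_wpmul2l// lee_fin expR_ge0.
Qed.

(** Induction on [m] through [mean_payoffS]: [h m] dominates the value with [m] steps to go
    as soon as each [h m.+1] dominates one step followed by [h m]. *)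
Lemma mean_payoff_le (h : nat -> R -> R) :
  (forall m, measurable_fun setT (h m)) ->
  (forall y, psi y <= h 0 y) -> (forall m y, dead y -> psi y <= h m y) ->
  (forall m y, ~~ dead y -> (one_step (h m) y <= (h m.+1 y)%:E)%E) ->
  forall m y, (mean_payoff m y <= (h m y)%:E)%E.
Proof.
move=> mh h0 hdead hstep.
elim=> [|m IHm] y; first by rewrite mean_payoff_stopped// lee_fin.
have [dy|ay] := boolP (dead y); first by rewrite mean_payoff_stopped ?dy ?orbT// lee_fin hdead.
rewrite mean_payoffS//; apply: le_trans (hstep m y ay).
apply: (@le_step_integral (mean_payoff m) (EFin \o h m) y) => //.
- exact: measurable_mean_payoff.
- exact/measurable_EFinP.
- by move=> z; apply: integral_ge0 => v _; rewrite lee_fin payoff_ge0.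
Qed.

Lemma mean_payoff_ge (h : nat -> R -> R) :
  (forall m, measurable_fun setT (h m)) -> (forall m y, 0 <= h m y) ->
  (forall y, h 0 y <= psi y) -> (forall m y, dead y -> h m y <= psi y) ->
  (forall m y, ~~ dead y -> ((h m.+1 y)%:E <= one_step (h m) y)%E) ->
  forall m y, ((h m y)%:E <= mean_payoff m y)%E.
Proof.
move=> mh hge0 h0 hdead hstep.
elim=> [|m IHm] y; first by rewrite mean_payoff_stopped// lee_fin.
have [dy|ay] := boolP (dead y); first by rewrite mean_payoff_stopped ?dy ?orbT// lee_fin hdead.
rewrite mean_payoffS//; apply: (le_trans (hstep m y ay)).
apply: (@le_step_integral (EFin \o h m) (mean_payoff m) y) => //.
- exact/measurable_EFinP.
- exact: measurable_mean_payoff.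
- by move=> z; rewrite lee_fin.
Qed.

End step.
End chain_law.

(** * One step of the chain and the generator *)

Section generator.
Context (R : realType) (a lam : bool -> R) (b s : R).
Hypotheses (a_gt0 : forall i, 0 < a i) (lam_gt0 : forall i, 0 < lam i).
Hypothesis s_ge0 : 0 <= s.
Variables (G nu : bool -> probability (measurableTypeR R) R).
Hypothesis GE : forall i (A : set R), measurable A ->
  G i A = exponential_prob (lam i) A.
Local Notation leb := (@lebesgue_measure R).
Variable lvl : bool -> \bar R.

(** The nonlocal part of the generator. *)
Definition jump_mean (h : R -> R) i z : \bar R := (\int[nu i]_x (h (z + x))%:E)%E.

Variable h : R -> R.
Hypotheses (mh : measurable_fun setT h) (h_ge0 : forall y, 0 <= h y).

Lemma jump_mean_ge0 i z : (0 <= jump_mean h i z)%E.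
Proof. by apply: integral_ge0 => x _; rewrite lee_fin. Qed.

Lemma measurable_jump_mean i : measurable_fun setT (jump_mean h i).
Proof.
apply: (@measurable_fun_fubini_tonelli_F _ _ (measurableTypeR R) (measurableTypeR R)
  R (nu i) (fun x => (h (x.1 + x.2))%:E)).
  by apply/measurable_EFinP; apply: measurableT_comp => //; exact: measurable_funD.
by move=> x; rewrite lee_fin.
Qed.

Section from_y.
Variable y : R.
Let i := b < y.

Let K x := ((lam i * expR (- lam i * x))%:E *
  ((expR (- (s * x)))%:E * jump_mean h i (y - a i * x)))%E.

Let mphi : measurable_fun setT (fun x : R => jump_mean h i (y - a i * x)).
Proof.
apply: measurableT_comp; first exact: measurable_jump_mean.
by apply: measurable_funB => //; exact: measurable_funM.
Qed.

Let K0 g := (\int[nu i]_z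
    (expR (- (s * step_time a b lvl y g)) * h (step_pos a b lvl y g z))%:E)%E.

Let K0_hit g : hits a b lvl y g ->
  K0 g = (expR (- (s * ((y - fine (lvl i)) / a i))) * h (fine (lvl i)))%:E.
Proof.
move=> hg; rewrite /K0 /step_time /step_pos hg -/i; exact: integral_probability_cst.
Qed.

Let K0_nohit g : hits a b lvl y g = false ->
  K0 g = ((expR (- (s * g)))%:E * jump_mean h i (y - a i * g))%E.
Proof.
move=> hg; rewrite /K0 /step_time /step_pos hg -/i.
under eq_integral do rewrite EFinM.
rewrite ge0_integralZl// ?lee_fin ?expR_ge0//.
- apply/measurable_EFinP; apply: measurableT_comp => //; exact: measurable_funD.
- by move=> x _; rewrite lee_fin.
Qed.

Let mK0 : measurable_fun setT K0.
Proof.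
have mE : measurable_fun setT (EFin \o h) by exact/measurable_EFinP.
apply: (measurable_fun_fubini_tonelli_F _ (@measurable_step_integrand R a b s lvl _ y mE)).
by move=> x; rewrite mule_ge0// lee_fin ?expR_ge0.
Qed.

Let K0_ge0 g : (0 <= K0 g)%E.
Proof. by apply: integral_ge0 => x _; rewrite lee_fin mulr_ge0 ?expR_ge0. Qed.

Let one_stepE : one_step a b s G nu lvl h y =
  (\int[leb]_(x in `[0%R, +oo[) ((lam i * expR (- lam i * x))%:E * K0 x))%E.
Proof.
by rewrite /one_step (@ge0_integral_exponential R (G i) (lam i))//; exact: GE.
Qed.

Let mexp : measurable_fun setT (fun x : R => (lam i * expR (- lam i * x))%:E).
Proof.
apply/measurable_EFinP; apply: measurable_funM => //.
by apply: measurableT_comp => //; exact: measurable_funM.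
Qed.

Let exp_ge0 x : (0 <= (lam i * expR (- lam i * x))%:E)%E.
Proof. by rewrite lee_fin mulr_ge0 ?expR_ge0// ltW. Qed.

(** With an exponential gap of rate [lam i], either the jump comes first, while the drift
    is still above [L], or [L] is reached at time [(y - L) / a i] without a jump, which
    has probability [exp (- lam i (y - L) / a i)]. *)
Lemma one_step_split L : lvl i = L%:E -> L < y ->
  one_step a b s G nu lvl h y =
  (\int[leb]_(x in `[0%R, ((y - L) / a i)%R]) K x +
   (expR (- ((lam i + s) * ((y - L) / a i))) * h L)%:E)%E.
Proof.
move=> lvlL Ly; set t := (y - L) / a i.
have t0 : 0 < t by rewrite divr_gt0// subr_gt0.
have hitE g : hits a b lvl y g = (t < g).
  by rewrite /hits -/i lvlL lte_fin /t ltr_pdivrMr// mulrC; apply/idP/idP; lra.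
rewrite one_stepE.
have -> : `[0%R, +oo[%classic = `[0, t] `|` `]t, +oo[ :> set R.
  apply/seteqP; split=> x /=; rewrite !in_itv/= ?andbT.
    by move=> x0; rewrite x0/=; case: (leP x t) => _; [left|right].
  by move=> [/andP[]//|tx]; rewrite ltW// (lt_trans t0).
rewrite ge0_integral_setU//=; last 3 first.
- by apply: measurable_funTS; exact: emeasurable_funM.
- by move=> x _; rewrite mule_ge0.
- apply/disj_setPS => x [] /=; rewrite !in_itv/= andbT => /andP[_ xt] tx.
  by move: (lt_le_trans tx xt); rewrite ltxx.
congr (_ + _)%E.
  apply: eq_integral => x; rewrite inE/= in_itv/= => /andP[_ xt].
  by rewrite /K K0_nohit// hitE ltNge xt.
transitivity (\int[leb]_(x in `]t, +oo[)
    ((expR (- (s * t)) * h L)%:E * (lam i * expR (- lam i * x))%:E))%E.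
  apply: eq_integral => x; rewrite inE/= in_itv/= andbT => tx.
  by rewrite muleC K0_hit ?hitE// lvlL.
rewrite ge0_integralZl//=; last 2 first.
- exact: measurable_funTS.
- by rewrite lee_fin mulr_ge0 ?expR_ge0.
rewrite exponential_tail// -EFinM mulrAC -expRD; congr ((expR _ * _)%:E); ring.
Qed.

Lemma one_step_free : lvl i = -oo%E ->
  one_step a b s G nu lvl h y = (\int[leb]_(x in `[0%R, +oo[) K x)%E.
Proof.
move=> lvlE; rewrite one_stepE; apply: eq_integral => x _.
by rewrite /K K0_nohit// /hits -/i lvlE ltNge leNye.
Qed.

Section test_function.
Variables (f f' : R -> R).
Hypotheses (df : forall x : R, is_derive x 1 f (f' x)) (cf' : continuous f').

Let F x := f (y - a i * x).
Let F' x := - (a i * f' (y - a i * x)).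

Let dF (x : R) : is_derive x 1 F (F' x).
Proof.
have d1 : is_derive x 1 (fun x : R => y - a i * x) (- a i).
  by apply: is_derive_eq; rewrite /GRing.scale /=; ring.
have := @is_derive1_comp R f (fun x : R => y - a i * x) x _ _ (df _) d1.
by rewrite mulrC /F' mulNr.
Qed.

Let cF' : continuous F'.
Proof.
move=> x; apply: cvgN; apply: cvgM; first exact: cvg_cst.
apply: (@continuous_comp _ _ _ (fun x : R => y - a i * x) f'); last exact: cf'.
by apply: cvgB; [exact: cvg_cst|apply: cvgM; [exact: cvg_cst|exact: cvg_id]].
Qed.

Let gE x : (lam i + s) * F x - F' x =
  (lam i + s) * f (y - a i * x) + a i * f' (y - a i * x).
Proof. by rewrite /F' opprK. Qed.

Let F0 : F 0 = f y. Proof. by rewrite /F mulr0 subr0. Qed.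

Let FT L : F ((y - L) / a i) = f L.
Proof. by rewrite /F mulrC divfK ?gt_eqF// subKr. Qed.

Let range L x : 0 <= x <= (y - L) / a i -> L <= y - a i * x <= y.
Proof.
move=> /andP[x0]; rewrite ler_pdivlMr// => xL.
have := mulr_ge0 (ltW (a_gt0 i)) x0; move: xL; rewrite mulrC; lra.
Qed.

Let range_free x : 0 <= x -> y - a i * x <= y.
Proof. by move=> x0; have := mulr_ge0 (ltW (a_gt0 i)) x0; lra. Qed.

Let phi_ge0 x : (0 <= jump_mean h i (y - a i * x))%E := jump_mean_ge0 _ _.

(** Along the line followed before the jump, [x |-> f (y - a i x)] is a test function for
    [killed_le], whose boundary term is exactly the contribution of the level [L]. *)
Lemma one_step_le L : lvl i = L%:E -> L < y -> h L <= f L ->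
  (forall z, L <= z <= y ->
    ((lam i)%:E * jump_mean h i z <= ((lam i + s) * f z + a i * f' z)%:E)%E) ->
  (one_step a b s G nu lvl h y <= (f y)%:E)%E.
Proof.
move=> lvlL Ly hL gen; rewrite (one_step_split lvlL Ly).
have t0 : 0 < (y - L) / a i by rewrite divr_gt0// subr_gt0.
have gen' x : 0 <= x <= (y - L) / a i ->
    ((lam i)%:E * jump_mean h i (y - a i * x) <= ((lam i + s) * F x - F' x)%:E)%E.
  by move=> /range xr; rewrite gE; exact: gen.
have := killed_le (lam_gt0 i) dF cF' mphi phi_ge0 t0 gen'.
rewrite FT F0 => Kle; apply: (le_trans (leeD Kle (lexx _))).
rewrite -EFinD lee_fin -lerBrDr lerD2l lerN2.
by rewrite ler_wpM2l// expR_ge0.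
Qed.

Lemma one_step_ge L : lvl i = L%:E -> L < y -> f L <= h L ->
  (forall z, L <= z <= y ->
    (((lam i + s) * f z + a i * f' z)%:E <= (lam i)%:E * jump_mean h i z)%E) ->
  ((f y)%:E <= one_step a b s G nu lvl h y)%E.
Proof.
move=> lvlL Ly hL gen; rewrite (one_step_split lvlL Ly).
have t0 : 0 < (y - L) / a i by rewrite divr_gt0// subr_gt0.
have gen' x : 0 <= x <= (y - L) / a i ->
    (((lam i + s) * F x - F' x)%:E <= (lam i)%:E * jump_mean h i (y - a i * x))%E.
  by move=> /range xr; rewrite gE; exact: gen.
have := killed_ge (lam_gt0 i) dF cF' mphi phi_ge0 t0 gen'.
rewrite FT F0 => Kle; apply: (le_trans _ (leeD Kle (lexx _))).
rewrite -EFinD lee_fin -lerBlDr lerD2l lerN2.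
by rewrite ler_wpM2l// expR_ge0.
Qed.

Lemma one_step_le_free M : lvl i = -oo%E -> (forall z, z <= y -> `|f z| <= M) ->
  (forall z, z <= y ->
    ((lam i)%:E * jump_mean h i z <= ((lam i + s) * f z + a i * f' z)%:E)%E) ->
  (one_step a b s G nu lvl h y <= (f y)%:E)%E.
Proof.
move=> lvlE fM gen; rewrite one_step_free// -F0.
apply: (killed_ley (lam_gt0 i) s_ge0 dF cF' mphi phi_ge0 (M := M)) => x x0.
  by rewrite gE; apply: gen; exact: range_free.
by apply: fM; exact: range_free.
Qed.

Lemma one_step_ge_free M : lvl i = -oo%E -> (forall z, z <= y -> `|f z| <= M) ->
  (forall z, z <= y ->
    (((lam i + s) * f z + a i * f' z)%:E <= (lam i)%:E * jump_mean h i z)%E) ->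
  ((f y)%:E <= one_step a b s G nu lvl h y)%E.
Proof.
move=> lvlE fM gen; rewrite one_step_free// -F0.
apply: (killed_gey (lam_gt0 i) s_ge0 dF cF' mphi phi_ge0 (M := M)) => x x0.
  by rewrite gE; apply: gen; exact: range_free.
by apply: fM; exact: range_free.
Qed.

End test_function.
End from_y.
End generator.

(** * Geometric decay of survival *)

Lemma geometric_vanish (R : realType) (q C e : R) : 0 <= q -> q < 1 -> 0 < e ->
  exists m, C * q ^+ m < e.
Proof.
move=> q0 q1 e0.
have : (fun m => C * q ^+ m) @ \oo --> C * 0.
  by apply: cvgM; [exact: cvg_cst|apply: cvg_expr; rewrite ger0_norm].
rewrite mulr0 => /cvgrPdist_lt /(_ e e0)[N _ NP]; exists N.
have := NP N (leqnn N); rewrite /= sub0r normrN; apply: le_lt_trans.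
exact: ler_norm.
Qed.

Section vanishing.
Context d (T : measurableType d) (R : realType) (mu : {measure set T -> \bar R}).

(** Where all [Z m] stay above [1 / (N + 1)], so do their means on that set, whose measure is
    therefore bounded by a null sequence; then take the union over [N]. *)
Lemma ae_vanishing (Z : nat -> T -> R) (C q : R) :
  (forall m, measurable_fun setT (Z m)) -> (forall m v, 0 <= Z m v) ->
  0 <= q -> q < 1 ->
  (forall m, (\int[mu]_v (Z m v)%:E <= (C * q ^+ m)%:E)%E) ->
  {ae mu, forall v, forall e, 0 < e -> exists m, Z m v < e}.
Proof.
move=> mZ Z0 q0 q1 ZC.
pose A N := [set v | forall m, N.+1%:R^-1 <= Z m v].
have mA N : measurable (A N).
  rewrite (_ : A N = \bigcap_m [set v | N.+1%:R^-1 <= Z m v]).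
    apply: bigcapT_measurable => m.
    have := mZ m measurableT `[N.+1%:R^-1, +oo[%classic (measurable_itv _).
    rewrite setTI; congr measurable; apply/seteqP.
    by split=> v /=; rewrite in_itv/= andbT.
  by apply/seteqP; split=> v /= h m; [move=> _|]; exact: h.
have bound N m : (N.+1%:R^-1%:E * mu (A N) <= (C * q ^+ m)%:E)%E.
  apply: le_trans (ZC m).
  have -> : mu (A N) = (\int[mu]_x (\1_(A N) x)%:E)%E.
    by rewrite integral_indic// setIT.
  have mI : measurable_fun setT (fun x => (\1_(A N) x : R)%:E).
    by apply/measurable_EFinP; exact: measurable_indic.
  rewrite -ge0_integralZl//.
  apply: ge0_le_integral => //.
  - exact: emeasurable_funM.
  - exact/measurable_EFinP.
  move=> v _; rewrite indicE; case: (boolP (v \in A N)) => [|_].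
    by rewrite inE => /(_ m); rewrite mule1 lee_fin.
  by rewrite mule0 lee_fin.
have A0 N : mu (A N) = 0%E.
  apply/eqP; rewrite eq_le measure_ge0 andbT.
  apply/lee_addgt0Pr => e e0; rewrite add0e.
  have eN : 0 < e / N.+1%:R by rewrite divr_gt0.
  have [m Cm] := geometric_vanish C q0 q1 eN.
  have N0 : (0 < N.+1%:R^-1 :> R) by rewrite invr_gt0.
  rewrite -(@lee_pmul2l _ N.+1%:R^-1%:E)// ?lte_fin//.
  apply: (le_trans (bound N m)).
  by rewrite -EFinM lee_fin [leRHS]mulrC; exact: ltW.
have : mu.-negligible (\bigcup_N A N).
  by apply: negligible_bigcup => N; exists (A N); split.
apply: negligibleS.
move=> v /= /existsNP[e /not_implyP[e0 nm]].
have [N Ne] : exists N, N.+1%:R^-1 < e.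
  by have [N] := ltr_add_invr e0; rewrite add0r => Ne; exists N.
exists N => // m; apply: (le_trans (ltW Ne)); rewrite leNgt; apply/negP => h.
by apply: nm; exists m.
Qed.

End vanishing.

Section survival.
Context (R : realType) (a lam : bool -> R) (b s : R).
Hypotheses (a_gt0 : forall i, 0 < a i) (lam_gt0 : forall i, 0 < lam i).
Hypothesis s_gt0 : 0 < s.
Variables (G nu : bool -> probability (measurableTypeR R) R).
Hypothesis GE : forall i (A : set R), measurable A ->
  G i A = exponential_prob (lam i) A.
Variable mu : probability (env source R) R.
Hypothesis prodP : product_law (source_law G nu) mu.

Lemma jump_mean_le_cst (h : R -> R) i z c : measurable_fun setT h ->
  (forall y, 0 <= h y) -> (forall y, h y <= c) -> (jump_mean nu h i z <= c%:E)%E.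
Proof.
move=> mh h0 hc; rewrite -(integral_probability_cst (nu i) c).
apply: ge0_le_integral => //.
- by move=> x _; rewrite lee_fin.
- by apply/measurable_EFinP; apply: measurableT_comp => //; exact: measurable_funD.
- by move=> x _; rewrite lee_fin.
Qed.

Let c : R := 1 + s / (2 * lam false).
Let q : R := Num.max c^-1 (Num.max (lam true / (lam true + s))
  (c * lam false / (lam false + s))).

Let c_gt1 : 1 < c. Proof. by rewrite ltrDl divr_gt0// mulr_gt0. Qed.
Let c_gt0 : 0 < c. Proof. exact: lt_trans c_gt1. Qed.
Let q_lt1 : q < 1.
Proof.
have l0 := lam_gt0 false; have l1 := lam_gt0 true.
rewrite !gt_max invf_lt1// c_gt1 /= ltr_pdivrMr ?addr_gt0// mul1r ltrDl s_gt0/=.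
rewrite ltr_pdivrMr ?addr_gt0// mul1r.
have -> : c * lam false = lam false + s / 2 by rewrite /c; field; rewrite gt_eqF.
by have := s_gt0; lra.
Qed.
Let q_gt0 : 0 < q. Proof. by rewrite !lt_max invr_gt0 c_gt0. Qed.

Variables (lvl : bool -> \bar R) (dead : R -> bool).
Hypothesis mdead : measurable_fun setT dead.
Hypothesis lvl_true : lvl true = b%:E.
Hypothesis lvl_false : lvl false = -oo%E \/
  exists r, lvl false = r%:E /\ dead =1 (fun y => y <= r).

(** Weight with [m] steps to go.  The factor [c > 1] above [b] is there because a step from
    above that reaches [b] may take arbitrarily little time and hence yield no
    discount; it then yields a factor [1 / c].  A step from below waits for a jump and
    gains [lam / (lam + s)], which still outweighs [c] if a jump leads above [b]. *)
Let h m y : R := q ^+ m * (if dead y then 0 else if b < y then c else 1).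

Let mh m : measurable_fun setT (h m).
Proof.
apply: measurable_funM => //; apply: measurable_fun_ifT => //.
by apply: measurable_fun_ifT => //; exact: measurable_side.
Qed.

Let h_ge0 m y : 0 <= h m y.
Proof.
apply: mulr_ge0; first by rewrite exprn_ge0// ltW.
by case: ifP => // _; case: ifP => // _; exact: ltW.
Qed.

Let h_le m y : h m y <= q ^+ m * c.
Proof.
apply: ler_wpM2l; first by rewrite exprn_ge0// ltW.
case: ifP => _; first exact: ltW.
by case: ifP => // _; exact: ltW.
Qed.

Let mean_le m i z : (jump_mean nu (h m) i z <= (q ^+ m * c)%:E)%E.
Proof. exact: jump_mean_le_cst. Qed.

Let gen_cst m i (k : R) z : lam i * c <= (lam i + s) * q * k ->
  ((lam i)%:E * jump_mean nu (h m) i z <=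
   ((lam i + s) * (q ^+ m.+1 * k) + a i * 0)%:E)%E.
Proof.
move=> le; apply: (@le_trans _ _ ((lam i)%:E * (q ^+ m * c)%:E)%E).
  by rewrite lee_wpmul2l ?lee_fin// ltW.
rewrite -EFinM lee_fin mulr0 addr0 exprS.
have -> : lam i * (q ^+ m * c) = q ^+ m * (lam i * c) by ring.
have -> : (lam i + s) * (q * q ^+ m * k) = q ^+ m * ((lam i + s) * q * k) by ring.
by apply: ler_wpM2l => //; rewrite exprn_ge0// ltW.
Qed.

Let survival_rate m y :
  (mean_payoff a b s mu lvl dead (fun y => (~~ dead y)%:R) m y <= (c * q ^+ m)%:E)%E.
Proof.
have qc : c^-1 <= q by rewrite le_max lexx.
have q1 : lam true / (lam true + s) <= q by rewrite !le_max lexx orbT.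
have q0 : c * lam false / (lam false + s) <= q by rewrite !le_max lexx !orbT.
apply: (@le_trans _ _ (h m y)%:E); last by rewrite lee_fin mulrC.
apply: (mean_payoff_le prodP) => //.
- by apply: measurable_indicator_of; exact: measurable_neg.
- move=> z; rewrite /h expr0 mul1r; case: ifP => //= _; case: ifP => // _.
  exact: ltW.
- by move=> n z dz; rewrite dz.
move=> n z az; rewrite /h (negbTE az).
have dcst (x k : R) : is_derive x 1 (fun=> k) 0.
  exact: (@is_derive_cst R R R k x 1).
have ccst : continuous (fun _ : R => 0 : R) by move=> x; exact: cvg_cst.
case: ifPn => bz.
  apply: (one_step_le a_gt0 lam_gt0 GE (mh n) (h_ge0 n)
    (y := z) (fun x => dcst x (q ^+ n.+1 * c)) ccst (L := b)) => //.
  - by rewrite bz lvl_true.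
  - rewrite /h ltxx exprSr -mulrA; apply: ler_wpM2l; first by rewrite exprn_ge0// ltW.
    have cq : 1 <= q * c by rewrite -ler_pdivrMr// mul1r.
    by case: ifP => // _; apply: le_trans cq.
  - move=> x _; rewrite bz; apply: gen_cst.
    by rewrite ler_wpM2r ?(ltW c_gt0)// mulrC -ler_pdivrMr ?addr_gt0.
case: lvl_false => [lF|[r [lF deadE]]].
  apply: (one_step_le_free a_gt0 lam_gt0 (ltW s_gt0) GE (mh n) (h_ge0 n)
    (y := z) (fun x => dcst x (q ^+ n.+1 * 1)) ccst (M := `|q ^+ n.+1 * 1|)) => //.
  - by rewrite (negbTE bz) lF.
  - move=> x _; rewrite (negbTE bz); apply: gen_cst.
    by rewrite mulr1 mulrC (mulrC _ q) -ler_pdivrMr ?addr_gt0.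
apply: (one_step_le a_gt0 lam_gt0 GE (mh n) (h_ge0 n)
    (y := z) (fun x => dcst x (q ^+ n.+1 * 1)) ccst (L := r)) => //.
- by rewrite (negbTE bz) lF.
- by move: az; rewrite deadE -ltNge.
- by rewrite /h deadE lexx mulr0 mulr1 exprn_ge0// ltW.
- move=> x _; rewrite (negbTE bz); apply: gen_cst.
  by rewrite mulr1 mulrC (mulrC _ q) -ler_pdivrMr ?addr_gt0.
Qed.

(** The weights [h] above are supersolutions for the indicator of survival, each step
    gaining a fixed factor [q < 1]. *)
Lemma survival_decay : exists C r : R, [/\ 0 <= r, r < 1 & forall m y,
  (mean_payoff a b s mu lvl dead (fun y => (~~ dead y)%:R) m y <= (C * r ^+ m)%:E)%E].
Proof. by exists c, q; split=> //; exact: ltW. Qed.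

End survival.

(** * Almost sure regularity *)

Lemma ae_forall_count d (T : measurableType d) (R : realType)
    (mu : {measure set T -> \bar R}) (I : countType) (P : I -> T -> Prop) :
  (forall i, {ae mu, forall x, P i x}) -> {ae mu, forall x, forall i, P i x}.
Proof.
move=> h; pose F n := if @choice.unpickle I n is Some i then ~` [set x | P i x] else set0.
have : mu.-negligible (\bigcup_n F n).
  apply: negligible_bigcup => n; rewrite /F; case: (@choice.unpickle I n) => [i|].
    exact: h.
  exact: negligible_set0.
apply: negligibleS => x /= /existsNP[i nP].
by exists (choice.pickle i) => //; rewrite /F choice.pickleK.
Qed.

Section almost_surely_good.
Context (R : realType) (a lam : bool -> R) (b : R).
Hypotheses (a_gt0 : forall i, 0 < a i) (lam_gt0 : forall i, 0 < lam i).
Variables (G nu : bool -> probability (measurableTypeR R) R).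
Hypothesis GE : forall i (A : set R), measurable A ->
  G i A = exponential_prob (lam i) A.
Hypothesis nu_gt0 : forall i, nu i `]0%R, +oo[%classic = 1%E.
Variable mu : probability (env source R) R.
Hypothesis prodP : product_law (source_law G nu) mu.

Lemma ae_coord j (A : set R) : measurable A -> source_law G nu j A = 1%E ->
  {ae mu, forall v, A (v j)}.
Proof.
move=> mA A1.
have mjA : @measurable _ (env source R) [set v : env source R | A (v j)].
  by have := @measurable_coord source R j measurableT _ mA; rewrite setTI.
have E : mu [set v : env source R | A (v j)] = 1%E.
  have := @prodP [:: j] (fun=> A) isT (fun=> mA).
  rewrite big_seq1 A1 => <-; congr (mu _); apply/seteqP; split=> v /=.
    by move=> Av i; rewrite /= inE => /eqP ->.
  by move=> /(_ j); rewrite /= inE eqxx; exact.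
exists (~` [set v : env source R | A (v j)]); split=> //.
  exact: measurableC.
by rewrite probability_setC// E subee.
Qed.

Lemma exponential_gt0 i : G i `]0%R, +oo[%classic = 1%E.
Proof.
rewrite GE// /exponential_prob.
transitivity (\int[lebesgue_measure]_(x in `]0%R, +oo[)
    (lam i * expR (- lam i * x))%:E)%E.
  apply: eq_integral => x; rewrite inE/= in_itv/= andbT => x0.
  by rewrite exponential_pdfE// ltW.
by rewrite exponential_tail// mulr0 oppr0 expR0.
Qed.

Lemma integral_exponential_gap i :
  (\int[G i]_g (expR (- g))%:E <= (lam i / (lam i + 1))%:E)%E.
Proof.
have l1 : 0 < lam i + 1 by rewrite addr_gt0.
have mexp : measurable_fun setT (fun g : R => (expR (- g))%:E).
  by apply/measurable_EFinP; exact: measurableT_comp.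
have exp0 (g : R) : (0 <= (expR (- g))%:E)%E by rewrite lee_fin expR_ge0.
rewrite (@ge0_integral_exponential R (G i) (lam i) (lam_gt0 i) (@GE i) _ mexp exp0).
have dcst (x k : R) : is_derive x 1 (fun=> k) 0.
  exact: (@is_derive_cst R R R k x 1).
have ccst : continuous (fun _ : R => 0 : R) by move=> x; exact: cvg_cst.
have := @killed_ley R (lam i) 1 (lam_gt0 i) ler01 (fun=> lam i / (lam i + 1))
  (fun=> 0) (fun x => dcst x _) ccst (fun=> 1%E) (measurable_cst _) (fun=> lee01)
  `|lam i / (lam i + 1)|.
under eq_integral do rewrite mule1 mul1r.
apply=> [x _|x _]; last exact: lexx.
by rewrite mule1 lee_fin subr0 mulrC divfK// gt_eqF.
Qed.

Let Z i n m (v : env source R) : R := expR (- partial (gaps v i n) m).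

Let mZ i n m : measurable_fun setT (Z i n m).
Proof.
apply: measurableT_comp => //; apply: measurableT_comp => //.
by apply: measurable_sum => k; exact: measurable_coord.
Qed.

Let meanZ i n m : (\int[mu]_v (Z i n m v)%:E <= ((lam i / (lam i + 1)) ^+ m)%:E)%E.
Proof.
elim: m => [|m IHm].
  under eq_integral => v _ do rewrite /Z /partial big_ord0 oppr0 expR0.
  by rewrite integral_probability_cst expr0.
pose H (x : R * env source R) : \bar R := (expR (- x.1) * Z i n m x.2)%:E.
have -> : (\int[mu]_v (Z i n m.+1 v)%:E =
    \int[mu]_v H (gaps v i n 0%N, (v \o skip_gap i n : env source R)))%E.
  apply: eq_integral => v _; rewrite /H /Z partialS opprD expRD.
  by rewrite (_ : gaps (v \o skip_gap i n) i n = gaps v i n \o succn)//;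
    apply/funext => k; rewrite /gaps /= !eqxx.
have mH : measurable_fun setT H.
  apply/measurable_EFinP; apply: measurable_funM.
    by apply: measurableT_comp => //; exact: measurableT_comp.
  exact: measurableT_comp.
rewrite (integral_first_gap prodP)//; last first.
  by move=> x; rewrite lee_fin mulr_ge0 ?expR_ge0.
set r := lam i / (lam i + 1).
have r0 : 0 <= r by rewrite divr_ge0// ltW// addr_gt0.
have mexp : measurable_fun setT (fun g : measurableTypeR R => (expR (- g))%:E).
  by apply/measurable_EFinP; exact: measurableT_comp.
apply: (@le_trans _ _ (\int[G i]_g ((r ^+ m)%:E * (expR (- g))%:E))%E).
  apply: ge0_le_integral => //.
  - by move=> g _; apply: integral_ge0 => v _; rewrite lee_fin mulr_ge0 ?expR_ge0.
  - by apply: (measurable_fun_fubini_tonelli_F H mH) => x; rewrite lee_fin mulr_ge0 ?expR_ge0.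
  - exact: emeasurable_funM.
  move=> g _; rewrite /H /=; under eq_integral do rewrite EFinM.
  have mZ' : measurable_fun setT (fun v => (Z i n m v)%:E) by exact/measurable_EFinP.
  rewrite ge0_integralZl// ?lee_fin ?expR_ge0//.
    by rewrite muleC lee_wpmul2r ?lee_fin ?expR_ge0.
  by move=> v _; rewrite lee_fin expR_ge0.
rewrite ge0_integralZl// ?lee_fin ?exprn_ge0//.
rewrite exprSr EFinM lee_wpmul2l ?lee_fin ?exprn_ge0//.
exact: integral_exponential_gap.
Qed.

(** The mean of [exp (- (g_0 + ... + g_(m-1)))] is at most [(lam / (lam + 1))^m], by
    independence of the gaps. *)
Lemma ae_copies_diverge i n : {ae mu, forall v, forall t,
  exists m, t < partial (gaps v i n) m}.
Proof.
have r0 : 0 <= lam i / (lam i + 1) by rewrite divr_ge0// ltW// addr_gt0.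
have r1 : lam i / (lam i + 1) < 1.
  by rewrite ltr_pdivrMr ?addr_gt0// mul1r ltrDl.
have mZC m : (\int[mu]_v (Z i n m v)%:E <= (1 * (lam i / (lam i + 1)) ^+ m)%:E)%E.
  by rewrite mul1r.
have := ae_vanishing (mZ i n) (fun m v => expR_ge0 _) r0 r1 mZC.
apply: filterS => v h t; have [m] := h (expR (- t)) (expR_gt0 _).
by rewrite /Z ltr_expR ltrN2 => tm; exists m.
Qed.

Lemma ae_good : {ae mu, forall v : env source R, good v}.
Proof.
have h1 : {ae mu, forall v : env source R, forall x : bool * nat * nat, v (inl x) \in `]0, +oo[}.
  apply: ae_forall_count => -[[i n] k].
  exact: (@ae_coord (inl (i, n, k)) _ (measurable_itv _) (exponential_gt0 i)).
have h2 : {ae mu, forall v : env source R, forall x : bool * nat * nat, v (inr x) \in `]0, +oo[}.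
  apply: ae_forall_count => -[[i n] k].
  exact: (@ae_coord (inr (i, n, k)) _ (measurable_itv _) (nu_gt0 i)).
have h3 : {ae mu, forall v : env source R, forall x : bool * nat, forall t,
    exists m, t < partial (gaps v x.1 x.2) m}.
  apply: ae_forall_count => -[i n]; exact: ae_copies_diverge.
apply: (filterS _ (filterI h1 (filterI h2 h3))) => v [v1 [v2 v3]]; split=> [i n|i n k].
  split; last exact: (v3 (i, n)).
  by move=> k; have := v1 (i, n, k); rewrite in_itv/= andbT.
by have := v2 (i, n, k); rewrite in_itv/= andbT.
Qed.

Lemma payoff_clock m v y :
  payoff a b 1 (free_level b) xpred0 (fun=> 1) m v y = expR (- clock a b m v y).
Proof.
elim: m v y => [|m IHm] v y /=; first by rewrite oppr0 expR0.
by rewrite IHm -expRD mul1r opprD.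
Qed.

(** With nothing dead and discount rate 1 the payoff is [exp (- clock)], and everything
    survives, so [survival_decay] bounds its mean geometrically. *)
Lemma ae_unbounded_clock y : {ae mu, forall v, unbounded_clock a b v y}.
Proof.
have m0 : measurable_fun setT (xpred0 : R -> bool) by exact: measurable_cst.
have [C [r [r0 r1 h]]] := survival_decay a_gt0 lam_gt0 ltr01 GE prodP m0
  (erefl : free_level b true = b%:E) (or_introl erefl).
have mp m : measurable_fun setT
    (fun v : env source R => payoff a b 1 (free_level b) xpred0 (fun=> 1) m v y).
  apply: measurable_payoff => // j; exact: measurable_coord.
have p0 m v : 0 <= payoff a b 1 (free_level b) xpred0 (fun=> 1) m v y.
  by rewrite payoff_clock expR_ge0.
have := ae_vanishing mp p0 r0 r1 (h^~ y).
apply: filterS => v hv t; have [m] := hv (expR (- t)) (expR_gt0 _).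
by rewrite payoff_clock ltr_expR ltrN2 => tm; exists m.
Qed.

End almost_surely_good.

(** * Moments of the jump law *)

Section claims.
Context (R : realType) (i : bool).
Local Notation T := (env source R).

(** Sum of the jumps up to time [t], of which at most [m] are counted.  The recursion
    follows the first jump, and absolute values make it monotone in [m] on every
    family and not just on the good ones. *)
Fixpoint claims (m : nat) (v : source -> R) (t : R) : R :=
  if m is m'.+1 then
    if t < gaps v i 0 0 then 0
    else `|jumps v i 0 0| + claims m' (v \o skip_event i) (t - gaps v i 0 0)
  else 0.

Definition total_claims (v : source -> R) (t : R) : R :=
  \sum_(k < poisson_path (gaps v i 0) t) jumps v i 0 k.

Lemma claims_ge0 m v t : 0 <= claims m v t.
Proof. by elim: m v t => //= m IHm v t; case: ifP => // _; rewrite addr_ge0. Qed.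

Lemma claims_nd v t : nondecreasing_seq (fun m => claims m v t).
Proof.
apply/nondecreasing_seqP => m; elim: m v t => [|m IHm] v t /=.
  by case: ifP => // _; rewrite addr0.
by case: ifP => // _; rewrite lerD2l; exact: IHm.
Qed.

Lemma claims_total m v t : good v -> 0 <= t ->
  (poisson_path (gaps v i 0) t <= m)%N -> claims m v t = total_claims v t.
Proof.
elim: m v t => [|m IHm] v t gv t0.
  by rewrite leqn0 /total_claims => /eqP ->; rewrite big_ord0.
have [pv jv] := gv; rewrite /total_claims /=.
case: ifPn => [tg _|]; first by rewrite poisson_path_first// big_ord0.
rewrite -leNgt => gt Nm; have u0 : 0 <= t - gaps v i 0 0 by rewrite subr_ge0.
have PE : poisson_path (gaps v i 0) t =
    (poisson_path (gaps v i 0 \o succn) (t - gaps v i 0 0)).+1.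
  by rewrite -poisson_path_tail// subrKC.
move: Nm; rewrite PE ltnS => Nm; rewrite big_ord_recl gtr0_norm; last exact: jv.
congr (_ + _); rewrite IHm ?gaps_skip_event//; last exact: good_skip_event.
by rewrite /total_claims gaps_skip_event jumps_skip_event.
Qed.

Context d (D : measurableType d).
Lemma measurable_claims m (V : D -> source -> R) (t : D -> R) :
  (forall j, measurable_fun setT (fun x => V x j)) -> measurable_fun setT t ->
  measurable_fun setT (fun x => claims m (V x) (t x)).
Proof.
elim: m V t => [|m IHm] V t mV mt /=; first exact: measurable_cst.
apply: measurable_fun_ifT => //.
- by apply: measurable_fun_ltr => //; exact: mV.
- apply: measurable_funD; first by apply: measurableT_comp => //; exact: mV.
  apply: IHm => [j|]; first exact: mV.
  by apply: measurable_funB => //; exact: mV.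
Qed.
End claims.

Section claims_mean.
Context (R : realType) (lam : bool -> R).
Hypothesis lam_gt0 : forall i, 0 < lam i.
Variables (G nu : bool -> probability (measurableTypeR R) R).
Hypothesis GE : forall i (A : set R), measurable A ->
  G i A = exponential_prob (lam i) A.
Variable mu : probability (env source R) R.
Hypothesis prodP : product_law (source_law G nu) mu.
Variable i : bool.
Local Notation T := (env source R).
Local Notation leb := (@lebesgue_measure R).
Local Notation claims := (@claims R i).

Definition jump_moment n : \bar R := (\int[nu i]_x (`|x| ^+ n)%:E)%E.
Definition claims_moment n m t : \bar R := (\int[mu]_v (claims m v t ^+ n)%:E)%E.

Let mcl m t : measurable_fun setT (fun v : T => claims m v t).
Proof. by apply: measurable_claims => // j; exact: measurable_coord. Qed.

Lemma measurable_claims_moment n m : measurable_fun setT (claims_moment n m).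
Proof.
apply: (@measurable_fun_fubini_tonelli_F _ _ (measurableTypeR R) T R mu
  (fun x => (claims m x.2 x.1 ^+ n)%:E)).
  apply/measurable_EFinP; apply: measurable_funX; apply: measurable_claims => //.
  by move=> j; apply: (measurableT_comp (measurable_coord j)).
by move=> x; rewrite lee_fin exprn_ge0 ?claims_ge0.
Qed.

Lemma claims_moment_ge0 n m t : (0 <= claims_moment n m t)%E.
Proof. by apply: integral_ge0 => v _; rewrite lee_fin exprn_ge0 ?claims_ge0. Qed.

Lemma jump_moment_ge0 n : (0 <= jump_moment n)%E.
Proof. by apply: integral_ge0 => v _; rewrite lee_fin exprn_ge0. Qed.

(** Renewal at the first claim, by independence of the first gap, the first jump and the rest. *)
Lemma claims_momentS n m t : (0 < n)%N -> claims_moment n m.+1 t =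
  (\int[G i]_g if (t < g)%R then 0 else
     \int[nu i]_z \int[mu]_v ((`|z| + claims m v (t - g)) ^+ n)%:E)%E.
Proof.
move=> n0.
pose H1 (x : R * T) : \bar R := ((if t < x.1 then 0 else
  `|jumps x.2 i 0 0| + claims m (x.2 \o skip_jump i 0) (t - x.1)) ^+ n)%:E.
pose H2 g (x : R * T) : \bar R := ((`|x.1| + claims m x.2 (t - g)) ^+ n)%:E.
have mcoord d (D : measurableType d) (f : D -> T) j : measurable_fun setT f ->
    measurable_fun setT (fun x => f x j).
  by move=> mf; exact: (measurableT_comp (measurable_coord j)).
have mH1 : measurable_fun setT H1.
  apply/measurable_EFinP; apply: measurable_funX; apply: measurable_fun_ifT => //.
    exact: measurable_fun_ltr.
  apply: measurable_funD; first by apply: measurableT_comp => //; exact: mcoord.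
  apply: measurable_claims => [j|]; first exact: mcoord.
  exact: measurable_funB.
have mH2 g : measurable_fun setT (H2 g).
  apply/measurable_EFinP; apply: measurable_funX; apply: measurable_funD => //.
    exact: measurableT_comp.
  by apply: measurable_claims => // j; exact: mcoord.
have -> : claims_moment n m.+1 t =
    (\int[mu]_v H1 (gaps v i 0%N 0%N, (v \o skip_gap i 0%N : T)))%E.
  by apply: eq_integral.
rewrite (integral_first_gap prodP)//; last first.
  move=> x; rewrite lee_fin exprn_ge0//; case: ifP => // _.
  by rewrite addr_ge0 ?claims_ge0.
apply: eq_integral => g _; rewrite /H1 /=; case: ifP => tg.
  by rewrite expr0n gtn_eqF//= integral_probability_cst.
have -> : (\int[mu]_v ((`|jumps v i 0 0| + claims m (v \o skip_jump i 0) (t - g)) ^+ n)%:E =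
    \int[mu]_v H2 g (jumps v i 0%N 0%N, (v \o skip_jump i 0%N : T)))%E.
  by apply: eq_integral.
rewrite (integral_first_jump prodP)//.
by move=> x; rewrite lee_fin exprn_ge0// addr_ge0 ?claims_ge0.
Qed.

Let mcl1 m t : measurable_fun setT (fun v : T => (claims m v t)%:E).
Proof. exact/measurable_EFinP. Qed.

Let mcl2 m t : measurable_fun setT (fun v : T => (claims m v t ^+ 2)%:E).
Proof. by apply/measurable_EFinP; exact: measurable_funX. Qed.

Let mabs n : measurable_fun setT (fun x : measurableTypeR R => (`|x| ^+ n)%:E).
Proof. by apply/measurable_EFinP; apply: measurable_funX; exact: normr_measurable. Qed.

Lemma claims_meanS m t : claims_moment 1 m.+1 t =
  (\int[G i]_g if (t < g)%R then 0 else
     jump_moment 1 + claims_moment 1 m (t - g))%E.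
Proof.
rewrite claims_momentS//; apply: eq_integral => g _; case: ifP => // _.
transitivity (\int[nu i]_z ((`|z| ^+ 1)%:E + claims_moment 1 m (t - g)))%E.
  apply: eq_integral => z _; under eq_integral do rewrite expr1 EFinD.
  rewrite ge0_integralD//.
  - by rewrite integral_probability_cst.
  - by move=> v _; rewrite lee_fin claims_ge0.
rewrite ge0_integralD//.
- by congr (_ + _)%E; rewrite integral_cst// [X in (_ * X)%E]probability_setT mule1.
- by move=> z _; exact: claims_moment_ge0.
Qed.

Lemma claims_squareS m t : claims_moment 2 m.+1 t =
  (\int[G i]_g if (t < g)%R then 0 else
     (jump_moment 2 + (2%:E * jump_moment 1) * claims_moment 1 m (t - g)) +
     claims_moment 2 m (t - g))%E.
Proof.
rewrite claims_momentS//; apply: eq_integral => g _; case: ifP => // _.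
set A1 := claims_moment 1 m (t - g); set A2 := claims_moment 2 m (t - g).
have A10 : (0 <= A1)%E by exact: claims_moment_ge0.
have A20 : (0 <= A2)%E by exact: claims_moment_ge0.
transitivity (\int[nu i]_z (((`|z| ^+ 2)%:E + (2 * `|z| ^+ 1)%:E * A1) + A2))%E.
  apply: eq_integral => z _.
  transitivity (\int[mu]_v (((`|z| ^+ 2)%:E + (2 * `|z|)%:E * (claims m v (t - g))%:E)
      + (claims m v (t - g) ^+ 2)%:E))%E.
    by apply: eq_integral => v _; rewrite -EFinM -!EFinD; congr EFin; ring.
  have n0 : (0 <= (2 * `|z|)%:E)%E by rewrite lee_fin mulr_ge0.
  have n1 v : (0 <= (claims m v (t - g))%:E)%E by rewrite lee_fin claims_ge0.
  have n2 v : (0 <= (claims m v (t - g) ^+ 2)%:E)%E by rewrite lee_fin exprn_ge0 ?claims_ge0.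
  have n3 : (0 <= (`|z| ^+ 2)%:E)%E by rewrite lee_fin exprn_ge0.
  have n4 v : (0 <= (2 * `|z|)%:E * (claims m v (t - g))%:E)%E by rewrite mule_ge0.
  have n5 v : (0 <= (`|z| ^+ 2)%:E + (2 * `|z|)%:E * (claims m v (t - g))%:E)%E.
    by rewrite adde_ge0.
  have k1 : measurable_fun setT (fun v : T => ((2 * `|z|)%:E * (claims m v (t - g))%:E)%E).
    exact: emeasurable_funM.
  have k2 : measurable_fun setT (fun v : T =>
      ((`|z| ^+ 2)%:E + (2 * `|z|)%:E * (claims m v (t - g))%:E)%E).
    exact: emeasurable_funD.
  rewrite (ge0_integralD mu measurableT (fun v _ => n5 v) k2 (fun v _ => n2 v) (mcl2 _ _)).
  rewrite (ge0_integralD mu measurableT (fun _ _ => n3) (measurable_cst _)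
    (fun v _ => n4 v) k1).
  rewrite integral_probability_cst.
  rewrite (ge0_integralZl mu measurableT (mcl1 _ _) (fun v _ => n1 v) n0).
  by rewrite expr1.
have n1 (z : R) : (0 <= (`|z| ^+ 1)%:E)%E by rewrite lee_fin exprn_ge0.
have n2 (z : R) : (0 <= (`|z| ^+ 2)%:E)%E by rewrite lee_fin exprn_ge0.
have n3 (z : R) : (0 <= (2 * `|z| ^+ 1)%:E)%E by rewrite lee_fin mulr_ge0 ?exprn_ge0.
have n4 (z : R) : (0 <= (2 * `|z| ^+ 1)%:E * A1)%E by rewrite mule_ge0.
have n5 (z : R) : (0 <= (`|z| ^+ 2)%:E + (2 * `|z| ^+ 1)%:E * A1)%E by rewrite adde_ge0.
have k0 : measurable_fun setT (fun z : measurableTypeR R => (2 * `|z| ^+ 1)%:E).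
  by apply/measurable_EFinP; apply: measurable_funM => //; apply/measurable_EFinP; exact: (mabs 1).
have k1 : measurable_fun setT (fun z : measurableTypeR R => ((2 * `|z| ^+ 1)%:E * A1)%E).
  exact: emeasurable_funM.
have k2 : measurable_fun setT (fun z : measurableTypeR R =>
    ((`|z| ^+ 2)%:E + (2 * `|z| ^+ 1)%:E * A1)%E).
  by apply: emeasurable_funD => //; exact: mabs.
rewrite (ge0_integralD (nu i) measurableT (fun v _ => n5 v) k2 (fun v _ => A20) (measurable_cst _)).
rewrite (ge0_integralD (nu i) measurableT (fun v _ => n2 v) (mabs 2) (fun v _ => n4 v) k1).
rewrite (ge0_integralZr (nu i) measurableT k0 (fun v _ => n3 v) A10).
congr (_ + _ * _ + _)%E; last first.
  by rewrite integral_cst// [X in (_ * X)%E]probability_setT mule1.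
under eq_integral do rewrite EFinM.
by rewrite (ge0_integralZl (nu i) measurableT (mabs 1) (fun v _ => n1 v)).
Qed.

End claims_mean.

Section first_claim.
Context (R : realType) (lam : R).
Hypothesis lam_gt0 : 0 < lam.
Variable G : probability (measurableTypeR R) R.
Hypothesis GE : forall (A : set R), measurable A -> G A = exponential_prob lam A.
Local Notation leb := (@lebesgue_measure R).
Variable phi : R -> \bar R.
Hypotheses (mphi : measurable_fun setT phi) (phi_ge0 : forall x, (0 <= phi x)%E).

(** The renewal operator of the claims, which form a compound Poisson process. *)
Definition first_claim (t : R) : \bar R :=
  (\int[G]_g if (t < g)%R then 0 else phi (t - g))%E.

Let mphit t : measurable_fun setT (fun x : R => phi (t - x)).
Proof. by apply: measurableT_comp => //; exact: measurable_funB. Qed.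

Lemma first_claimE t : 0 <= t -> first_claim t =
  (\int[leb]_(x in `[0%R, t]) ((lam * expR (- lam * x))%:E *
     ((expR (- (0 * x)))%:E * phi (t - x))))%E.
Proof.
move=> t0; rewrite /first_claim (@ge0_integral_exponential R G lam lam_gt0 GE); last 2 first.
- apply: measurable_fun_ifT => //; exact: measurable_fun_ltr.
- by move=> x; case: ifP.
rewrite integral_mkcond [RHS]integral_mkcond; apply: eq_integral => x _.
rewrite !patchE !mem_setE !in_itv/= andbT; case: (leP 0 x) => //= x0.
by case: (leP x t) => xt; rewrite ?mule0// mul0r oppr0 expR0 mul1e.
Qed.

Variables (f f' : R -> R).
Hypotheses (df : forall x : R, is_derive x 1 f (f' x)) (cf' : continuous f').

Let dF t (x : R) : is_derive x 1 (fun x => f (t - x)) (- f' (t - x)).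
Proof.
have d1 : is_derive x 1 (fun x : R => t - x) (- 1).
  by apply: is_derive_eq; ring.
have := @is_derive1_comp R f (fun x : R => t - x) x _ _ (df _) d1.
by rewrite mulrN1.
Qed.

Let cF' t : continuous (fun x => - f' (t - x)).
Proof.
move=> x; apply: cvgN.
apply: (@continuous_comp _ _ _ (fun x : R => t - x) f'); last exact: cf'.
by apply: cvgB; [exact: cvg_cst|exact: cvg_id].
Qed.

(** The function [f] reversed in time is a test function for [killed_le] without
    discounting. *)
Lemma first_claim_le t : 0 <= t ->
  (forall u, 0 <= u <= t -> (lam%:E * phi u <= (lam * f u + f' u)%:E)%E) ->
  (first_claim t <= (f t - expR (- (lam * t)) * f 0)%:E)%E.
Proof.
move=> t0 le; rewrite first_claimE//; have [->|tn0] := eqVneq t 0.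
  by rewrite set_itv1 integral_set1 mulr0 oppr0 expR0 mul1r subrr.
have tp : 0 < t by rewrite lt_neqAle eq_sym tn0.
have := @killed_le R lam 0 lam_gt0 _ _ (dF t) (cF' (t:=t)) _ (mphit t) (fun x => phi_ge0 _) t tp.
rewrite addr0 subr0 subrr; apply=> x /andP[x0 xt].
by rewrite opprK; apply: le; lra.
Qed.

Lemma first_claim_ge t : 0 <= t ->
  (forall u, 0 <= u <= t -> ((lam * f u + f' u)%:E <= lam%:E * phi u)%E) ->
  ((f t - expR (- (lam * t)) * f 0)%:E <= first_claim t)%E.
Proof.
move=> t0 le; rewrite first_claimE//; have [->|tn0] := eqVneq t 0.
  by rewrite set_itv1 integral_set1 mulr0 oppr0 expR0 mul1r subrr.
have tp : 0 < t by rewrite lt_neqAle eq_sym tn0.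
have := @killed_ge R lam 0 lam_gt0 _ _ (dF t) (cF' (t:=t)) _ (mphit t) (fun x => phi_ge0 _) t tp.
rewrite addr0 subr0 subrr; apply=> x /andP[x0 xt].
by rewrite opprK; apply: le; lra.
Qed.
End first_claim.

Section claims_bounds.
Context (R : realType) (lam : bool -> R).
Hypothesis lam_gt0 : forall i, 0 < lam i.
Variables (G nu : bool -> probability (measurableTypeR R) R).
Hypothesis GE : forall i (A : set R), measurable A ->
  G i A = exponential_prob (lam i) A.
Variable mu : probability (env source R) R.
Hypothesis prodP : product_law (source_law G nu) mu.
Variable i : bool.
Variables (m1 m2 : R).
Hypotheses (m1_ge0 : 0 <= m1) (m2_ge0 : 0 <= m2).
Hypotheses (m1E : jump_moment nu i 1 = m1%:E) (m2E : jump_moment nu i 2 = m2%:E).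
Local Notation cm := (claims_moment mu i).
Local Notation l := (lam i).

(** Candidate moments: [lam m1 t], and [lam m2 t + (lam m1 t)^2] for the square, the latter
    because the number of claims is Poisson.  The constant [k] accounts for the error
    of truncation. *)
Let f1 (k u : R) : R := l * m1 * u + k.
Let f1' (u : R) : R := l * m1.
Let f2 (k u : R) : R := l * m2 * u + (l * m1 * u) ^+ 2 + k.
Let f2' (u : R) : R := l * m2 + 2 * (l * m1) ^+ 2 * u.

Let df1 k (u : R) : is_derive u 1 (f1 k) (f1' u).
Proof. by apply: is_derive_eq; rewrite /GRing.scale/= /f1'; ring. Qed.
Let df2 k (u : R) : is_derive u 1 (f2 k) (f2' u).
Proof. by apply: is_derive_eq; rewrite /GRing.scale/= /f2'; ring. Qed.
Let cf1' : continuous f1'.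
Proof. by move=> u; exact: cvg_cst. Qed.
Let cf2' : continuous f2'.
Proof.
move=> u; apply: cvgD; first exact: cvg_cst.
by apply: cvgM; [exact: cvg_cst|exact: cvg_id].
Qed.

Let l0 : 0 < l := lam_gt0 i.

Let mmean m : measurable_fun setT (fun u => (m1%:E + cm 1 m u)%E).
Proof. by apply: emeasurable_funD => //; exact: measurable_claims_moment. Qed.

Let msquare m : measurable_fun setT
  (fun u => (m2%:E + (2 * m1)%:E * cm 1 m u + cm 2 m u)%E).
Proof.
apply: emeasurable_funD; last exact: measurable_claims_moment.
apply: emeasurable_funD => //; apply: emeasurable_funM => //.
exact: measurable_claims_moment.
Qed.

Let mean_ge0 m u : (0 <= m1%:E + cm 1 m u)%E.
Proof. by rewrite adde_ge0 ?lee_fin// claims_moment_ge0. Qed.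

Let square_ge0 m u : (0 <= m2%:E + (2 * m1)%:E * cm 1 m u + cm 2 m u)%E.
Proof.
apply: adde_ge0; last exact: claims_moment_ge0.
apply: adde_ge0; first by rewrite lee_fin.
by apply: mule_ge0; [rewrite lee_fin mulr_ge0|exact: claims_moment_ge0].
Qed.

Let meanS m t : cm 1 m.+1 t = first_claim (G i) (fun u => m1%:E + cm 1 m u)%E t.
Proof. by rewrite (claims_meanS prodP) m1E. Qed.

Let squareS m t : cm 2 m.+1 t = first_claim (G i)
  (fun u => m2%:E + (2 * m1)%:E * cm 1 m u + cm 2 m u)%E t.
Proof. by rewrite (claims_squareS prodP) m1E m2E. Qed.

Let moment0 n t : (0 < n)%N -> cm n 0 t = 0%E.
Proof.
move=> n0; rewrite /claims_moment; under eq_integral do rewrite /= expr0n gtn_eqF//.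
exact: integral_probability_cst.
Qed.

Let lmul (y z : \bar R) : (y <= z)%E -> (l%:E * y <= l%:E * z)%E.
Proof. by move=> yz; rewrite lee_wpmul2l// lee_fin ltW. Qed.

Lemma claims_mean_le m t : 0 <= t -> (cm 1 m t <= (l * m1 * t)%:E)%E.
Proof.
elim: m t => [|m IHm] t t0.
  by rewrite moment0// lee_fin !mulr_ge0// ltW.
rewrite meanS; apply: (le_trans (first_claim_le l0 (@GE i) (mmean m) (mean_ge0 m)
  (df1 0) cf1' t0 _)); last first.
  by rewrite lee_fin /f1 mulr0 !addr0 mulr0 subr0.
move=> u /andP[u0 _]; apply: (le_trans (lmul (leeD2l _ (IHm u u0)))).
by rewrite -EFinD -EFinM lee_fin /f1 /f1'; lra.
Qed.

Lemma claims_square_le m t : 0 <= t -> (cm 2 m t <= (f2 0 t)%:E)%E.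
Proof.
have lm1 : 0 <= l * m1 by rewrite mulr_ge0// ltW.
elim: m t => [|m IHm] t t0.
  by rewrite moment0// lee_fin /f2 addr0 addr_ge0 ?exprn_ge0// !mulr_ge0// ltW.
rewrite squareS; apply: (le_trans (first_claim_le l0 (@GE i) (msquare m) (square_ge0 m)
  (df2 0) cf2' t0 _)); last first.
  by rewrite lee_fin /f2 !mulr0 expr0n/= !addr0 mulr0 subr0.
move=> u /andP[u0 _].
apply: (@le_trans _ _ (l%:E * (m2%:E + (2 * m1)%:E * (l * m1 * u)%:E + (f2 0 u)%:E))%E).
  apply: lmul => //; apply: leeD; last exact: IHm.
  by rewrite leeD2l// lee_wpmul2l ?claims_mean_le// lee_fin mulr_ge0.
by rewrite -?EFinM -?EFinD -?EFinM lee_fin /f2 /f2'; lra.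
Qed.

(** The probability of a claim before time 1. *)
Let q0 : R := 1 - expR (- l).
Let q0_ge0 : 0 <= q0. Proof. by rewrite subr_ge0 -expR0 ler_expR oppr_le0 ltW. Qed.
Let q0_lt1 : q0 < 1. Proof. by rewrite ltrBlDr ltrDl expR_gt0. Qed.
(** Any rate in [(q0, 1)] serves: the error for the square contains that for the mean, and
    so decays at a slightly slower rate than [q0]. *)
Let q : R := (1 + q0) / 2.
Let q_gt : q0 < q. Proof. by rewrite /q; have := q0_lt1; lra. Qed.
Let C1 : R := l * m1.
Let C1_ge0 : 0 <= C1. Proof. by rewrite mulr_ge0// ltW. Qed.

Let decay t : 0 <= t <= 1 -> 1 - expR (- (l * t)) <= q0.
Proof.
move=> /andP[t0 t1]; rewrite lerD2l lerN2 ler_expR lerN2.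
by rewrite ger_pMr.
Qed.

Let qX m : 0 <= q ^+ m. Proof. by rewrite exprn_ge0// (le_trans q0_ge0)// ltW. Qed.

(** Each further claim that is counted multiplies the error by at most the
    probability [1 - exp (- lam t)] that it occurs. *)
Lemma claims_mean_ge m t : 0 <= t <= 1 ->
  ((l * m1 * t - C1 * q ^+ m)%:E <= cm 1 m t)%E.
Proof.
elim: m t => [|m IHm] t /andP[t0 t1].
  rewrite moment0// lee_fin expr0 mulr1 subr_le0 /C1.
  by apply: ler_piMr.
rewrite meanS; apply: le_trans (first_claim_ge l0 (@GE i) (mmean m) (mean_ge0 m)
  (df1 (- (C1 * q ^+ m))) cf1' t0 _); last first.
  move=> u /andP[u0 ut]; have u1 : 0 <= u <= 1 by rewrite u0 (le_trans ut).
  apply: le_trans (lmul (leeD2l _ (IHm u u1))).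
  by rewrite -EFinD -EFinM lee_fin /f1 /f1'; lra.
rewrite lee_fin /f1 mulr0 add0r exprS.
have := decay (t := t); rewrite t0 t1 => /(_ isT) dt.
have Cq : 0 <= C1 * q ^+ m by rewrite mulr_ge0.
have : C1 * q ^+ m * (1 - expR (- (l * t))) <= C1 * q ^+ m * q.
  by rewrite ler_wpM2l// (le_trans dt)// ltW.
lra.
Qed.

Let C2 : R := l * m2 + (l * m1) ^+ 2 + 2 * q0 * m1 * C1 / (q - q0).

Lemma claims_square_ge m t : 0 <= t <= 1 ->
  ((f2 0 t - C2 * q ^+ m)%:E <= cm 2 m t)%E.
Proof.
have dq : 0 < q - q0 by rewrite subr_gt0.
have e0 : 0 <= 2 * q0 * m1 * C1 / (q - q0).
  apply: divr_ge0; last exact: ltW.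
  exact: mulr_ge0 (mulr_ge0 (mulr_ge0 (ler0n _ 2) q0_ge0) m1_ge0) C1_ge0.
have lm2 : 0 <= l * m2 by rewrite mulr_ge0// ltW.
have lm1 : 0 <= l * m1 by rewrite mulr_ge0// ltW.
have C2_ge0 : 0 <= C2 by rewrite !addr_ge0// exprn_ge0.
have C2q : q0 * (2 * m1 * C1 + C2) <= C2 * q.
  have : 2 * q0 * m1 * C1 <= C2 * (q - q0).
    rewrite -ler_pdivrMr// /C2 lerDr addr_ge0// exprn_ge0//.
  lra.
elim: m t => [|m IHm] t /andP[t0 t1].
  rewrite moment0// lee_fin expr0 mulr1 subr_le0 /C2 /f2 addr0.
  apply: (@le_trans _ _ (l * m2 + (l * m1) ^+ 2)); last by rewrite lerDl.
  apply: lerD; first exact: ler_piMr.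
  by rewrite lerXn2r ?nnegrE//; [exact: mulr_ge0|exact: ler_piMr].
pose E := (2 * m1 * C1 + C2) * q ^+ m.
have E0 : 0 <= E.
  apply: mulr_ge0 => //; apply: addr_ge0 => //.
  exact: mulr_ge0 (mulr_ge0 (ler0n _ 2) m1_ge0) C1_ge0.
rewrite squareS; apply: le_trans (first_claim_ge l0 (@GE i) (msquare m) (square_ge0 m)
  (df2 (- E)) cf2' t0 _); last first.
  move=> u /andP[u0 ut]; have u1 : 0 <= u <= 1 by rewrite u0 (le_trans ut).
  apply: (@le_trans _ _ (l%:E * (m2%:E + (2 * m1)%:E * (l * m1 * u - C1 * q ^+ m)%:E
     + (f2 0 u - C2 * q ^+ m)%:E))%E); last first.
    apply: lmul => //; apply: leeD; last exact: IHm.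
    by rewrite leeD2l// lee_wpmul2l ?claims_mean_ge// lee_fin mulr_ge0.
  by rewrite -?EFinM -?EFinD -?EFinM lee_fin /f2 /f2' /E; lra.
rewrite lee_fin /f2 !mulr0 expr0n/= !add0r addr0 (exprS q m).
have := decay (t := t); rewrite t0 t1 => /(_ isT) dt.
have : E * (1 - expR (- (l * t))) <= E * q0 by rewrite ler_wpM2l.
have : E * q0 <= C2 * q * q ^+ m by rewrite /E mulrAC (mulrC _ q0) ler_wpM2r.
lra.
Qed.

Lemma claims_moments_bounds : exists C r : R, [/\ 0 <= r, r < 1 &
  forall m, ((l * m1 - C * r ^+ m)%:E <= cm 1 m 1 <= (l * m1)%:E)%E /\
   ((l * m2 + (l * m1) ^+ 2 - C * r ^+ m)%:E <= cm 2 m 1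
      <= (l * m2 + (l * m1) ^+ 2)%:E)%E].
Proof.
exists (Num.max C1 C2), q; split.
- by rewrite (le_trans q0_ge0)// ltW.
- by rewrite /q; have := q0_lt1; lra.
have o : 0 <= (1 : R) <= 1 by rewrite ler01 lexx.
move=> m; split; apply/andP; split.
- apply: le_trans (claims_mean_ge m o).
  by rewrite lee_fin mulr1 lerD2l lerN2 ler_wpM2r// le_max lexx.
- by rewrite (le_trans (claims_mean_le m ler01))// mulr1.
- apply: le_trans (claims_square_ge m o).
  by rewrite lee_fin /f2 addr0 !mulr1 lerD2l lerN2 ler_wpM2r// le_max lexx orbT.
- by rewrite (le_trans (claims_square_le m ler01))// /f2 addr0 !mulr1.
Qed.

End claims_bounds.

Section eventually_constant.
Context d (T : measurableType d) (R : realType) (P : probability T R).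
Variables (Z : nat -> T -> R) (X : T -> R).
Hypotheses (mZ : forall m, measurable_fun setT (Z m)) (Z0 : forall m w, 0 <= Z m w).
Hypothesis ndZ : forall w, nondecreasing_seq (fun m => Z m w).
Hypothesis ZX : {ae P, forall w, exists M, forall m, (M <= m)%N -> Z m w = X w}.

Let Y w : \bar R := limn (fun m => (Z m w)%:E).

Let ndZE w : {homo (fun m => (Z m w)%:E) : i j / (i <= j)%N >-> (i <= j)%E}.
Proof. by move=> i j ij; rewrite lee_fin; exact: ndZ. Qed.

Let mZE m : measurable_fun setT (fun w => (Z m w)%:E).
Proof. exact/measurable_EFinP. Qed.

Let cvgY w : (fun m => (Z m w)%:E) @ \oo --> Y w.
Proof. exact: ereal_nondecreasing_is_cvgn. Qed.

Let Z_le_Y m w : ((Z m w)%:E <= Y w)%E.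
Proof.
apply: lime_ge; first exact: ereal_nondecreasing_is_cvgn.
by exists m => // n /= mn; exact: ndZE.
Qed.

Let Y_ge0 w : (0 <= Y w)%E.
Proof. by apply: le_trans (Z_le_Y 0 w); rewrite lee_fin. Qed.

Let YX : {ae P, forall w, Y w = (X w)%:E}.
Proof.
apply: filterS ZX => w [M MX]; apply/cvg_lim => //.
apply: cvg_near_cst; exists M => // m /= Mm; by rewrite MX.
Qed.

Lemma ae_limit_exists : exists W : T -> R, [/\ measurable_fun setT W,
  (forall w, 0 <= W w), {ae P, forall w, W w = X w} &
  forall m, {ae P, forall w, Z m w <= W w}].
Proof.
have mY : measurable_fun setT Y 
  by apply: (emeasurable_fun_cvg (fun m w => (Z m w)%:E)) => // w _; exact: cvgY.
exists (fun w => fine (Y w)); split.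
- by apply: measurableT_comp.
- by move=> w; exact: fine_ge0.
- by apply: filterS YX => w ->.
- move=> m; apply: filterS YX => w E; rewrite -lee_fin E /= -E.
  exact: Z_le_Y.
Qed.

(** Monotone convergence identifies the integral of the limit, which is almost surely
    [X]. *)
Lemma integral_eventually (L C r : R) : 0 <= r -> r < 1 ->
  (forall m, (L - C * r ^+ m)%:E <= \int[P]_w (Z m w)%:E <= L%:E)%E ->
  (\int[P]_w (X w)%:E = L%:E)%E.
Proof.
move=> r0 r1 hb.
have <- : (\int[P]_w Y w = \int[P]_w (X w)%:E)%E by exact: ae_eq_integral_nomeas.
have ZY m : (\int[P]_w (Z m w)%:E <= \int[P]_w Y w)%E.
  by apply: ge0_ae_le_integral_nomeas => [w|w|]; [rewrite lee_fin|exact: Y_ge0|exact: aeW].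
apply/eqP; rewrite eq_le; apply/andP; split.
  rewrite monotone_convergence//; last by move=> m w _; rewrite lee_fin.
  apply: lime_le.
    apply: ereal_nondecreasing_is_cvgn => i j ij; apply: ge0_le_integral => //.
    - by move=> w _; rewrite lee_fin.
    - by move=> w _; exact: ndZE.
  by apply: nearW => m; case/andP: (hb m).
apply/lee_addgt0Pr => e e0.
have [m me] := geometric_vanish C r0 r1 e0.
have /andP[hm _] := hb m.
apply: (@le_trans _ _ ((L - C * r ^+ m)%:E + e%:E)%E).
  by rewrite -EFinD lee_fin; lra.
by rewrite leeD2r// (le_trans hm).
Qed.
End eventually_constant.

Section shifted_moments.
Context d (T : measurableType d) (R : realType) (P : probability T R).
Variables (W : T -> R) (a : R).
Hypotheses (mW : measurable_fun setT W) (W0 : forall w, 0 <= W w) (a0 : 0 < a).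

(** The negative part of [W - a] is at most [a], so the integral of the difference splits
    although [W] is not yet known to be integrable. *)
Lemma mean_of_centered : (\int[P]_w (W w - a)%:E = 0)%E ->
  (\int[P]_w (W w)%:E = a%:E)%E.
Proof.
set f := (fun w => (W w - a)%:E).
have mf : measurable_fun setT f by apply/measurable_EFinP; exact: measurable_funB.
have mp := measurable_funepos mf; have mn := measurable_funeneg mf.
have mWE : measurable_fun setT (fun w => (W w)%:E) by exact/measurable_EFinP.
have W0E w : (0 <= (W w)%:E)%E by rewrite lee_fin.
rewrite integralE; set u := integral _ _ _; set v := integral _ _ _.
have va : (v <= a%:E)%E.
  rewrite -(integral_probability_cst P a); apply: ge0_le_integral => //.
  move=> w _; rewrite funenegE ge_max !lee_fin; have := W0 w; have := a0.
  by move=> *; apply/andP; split; lra.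
have v0 : (0 <= v)%E by exact: integral_ge0.
have vfin : v \is a fin_num by rewrite ge0_fin_numE// (le_lt_trans va) ?ltry.
have H : (u + a%:E = \int[P]_w (W w)%:E + v)%E.
  rewrite -(integral_probability_cst P a) -!ge0_integralD//; last first.
    by move=> w _; rewrite lee_fin ltW.
  apply: eq_integral => w _; rewrite funeposE funenegE /f -EFinN -!EFin_max -!EFinD.
  by congr EFin; rewrite /Num.max; case: ltrP => h1; case: ltrP => h2; lra.
move: H vfin; clearbody u v; clear va v0.
case: v => // v; case: integral => [w| |]; case: u => [u| |]//= => -[H] _ -[uv].
by congr EFin; lra.
Qed.

Lemma square_of_centered (sigma2 : R) : (\int[P]_w (W w)%:E = a%:E)%E ->
  (\int[P]_w ((W w - a) ^+ 2)%:E = sigma2%:E)%E ->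
  (\int[P]_w (W w ^+ 2)%:E = (sigma2 + a ^+ 2)%:E)%E.
Proof.
move=> m1 m2.
have mWE : measurable_fun setT (fun w => (W w)%:E) by exact/measurable_EFinP.
have W0E w : (0 <= (W w)%:E)%E by rewrite lee_fin.
have E : (\int[P]_w (W w ^+ 2)%:E + (a ^+ 2)%:E = sigma2%:E + (2 * a)%:E * a%:E)%E.
  rewrite -m2 -m1 -(integral_probability_cst P (a ^+ 2)).
  rewrite -ge0_integralZl//; last by rewrite lee_fin mulr_ge0// ltW.
  rewrite -!ge0_integralD//.
  - by apply: eq_integral => w _; rewrite -!EFinM -!EFinD; congr EFin; ring.
  - by move=> w _; rewrite lee_fin sqr_ge0.
  - by apply/measurable_EFinP; apply: measurable_funX; exact: measurable_funB.
  - by move=> w _; rewrite mule_ge0// lee_fin mulr_ge0// ltW.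
  - exact: emeasurable_funM.
  - by move=> w _; rewrite lee_fin sqr_ge0.
  - by apply/measurable_EFinP; exact: measurable_funX.
  - by move=> w _; rewrite lee_fin sqr_ge0.
move: E; case: integral => [r| |]//=; rewrite -?EFinM -?EFinD => -[E].
by congr EFin; lra.
Qed.
End shifted_moments.

Section identification.
Context (R : realType) (a lam sigma : bool -> R).
Hypotheses (a_gt0 : forall i, 0 < a i) (lam_gt0 : forall i, 0 < lam i).
Variables (G nu : bool -> probability (measurableTypeR R) R).
Hypothesis GE : forall i (A : set R), measurable A ->
  G i A = exponential_prob (lam i) A.
Variable mu : probability (env source R) R.
Hypothesis prodP : product_law (source_law G nu) mu.
Context d (T : measurableType d) (P : probability T R).
Variable V : T -> env source R.
Hypotheses (mV : measurable_fun setT V)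
  (muE : forall A, measurable A -> mu A = P (V @^-1` A)).
Hypothesis goodV : {ae P, forall w, good (V w)}.
Variable i : bool.
Hypothesis mean0 : (\int[P]_w (paths a (V w) i 0 1)%:E = 0)%E.
Hypothesis square : (\int[P]_w (paths a (V w) i 0 1 ^+ 2)%:E = (sigma i ^+ 2)%:E)%E.

Let Z n m w : R := claims i m (V w) 1 ^+ n.
Let X n w : R := total_claims i (V w) 1 ^+ n.

Let mZ n m : measurable_fun setT (Z n m).
Proof.
apply: measurable_funX; apply: measurable_claims => // j.
exact: (measurableT_comp (measurable_coord j)).
Qed.

Let Z0 n m w : 0 <= Z n m w. Proof. by rewrite exprn_ge0 ?claims_ge0. Qed.

Let ndZ n w : nondecreasing_seq (fun m => Z n m w).
Proof.
by move=> j k jk; rewrite /Z lerXn2r ?nnegrE ?claims_ge0//; exact: claims_nd.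
Qed.

Let ZX n : {ae P, forall w, exists M, forall m, (M <= m)%N -> Z n m w = X n w}.
Proof.
apply: filterS goodV => w gw; exists (poisson_path (gaps (V w) i 0) 1) => m Mm.
by rewrite /Z claims_total.
Qed.

Let meanZ n m : (\int[P]_w (Z n m w)%:E = claims_moment mu i n m 1)%E.
Proof.
rewrite /claims_moment (ge0_integral_image mV muE)// => [|v].
  apply/measurable_EFinP; apply: measurable_funX; apply: measurable_claims => // j.
  exact: measurable_coord.
by rewrite lee_fin exprn_ge0 ?claims_ge0.
Qed.

(** The claims up to time 1 are [xi 1 + a], so their first two moments are known, and they
    equal [lam m1] and [lam m2 + (lam m1)^2].  Finiteness of [m2] comes first: were it
    infinite, even the first claim alone would have a second moment larger than any
    bound. *)
Lemma jump_moments_of_path :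
  jump_moment nu i 1 = (a i / lam i)%:E /\
  jump_moment nu i 2 = (sigma i ^+ 2 / lam i)%:E.
Proof.
have l0 := lam_gt0 i.
have [W [mW W0 WX ZW]] := ae_limit_exists (mZ 1) (Z0 1) (ndZ 1) (ZX 1).
have pathE : {ae P, forall w, paths a (V w) i 0 1 = W w - a i}.
  by apply: filterS WX => w ->; rewrite /X expr1 /paths /xi_path mulr1.
have WM : (\int[P]_w (W w)%:E = (a i)%:E)%E.
  apply: mean_of_centered => //; rewrite -mean0; apply: ae_eq_integral_nomeas.
  by apply: filterS pathE => w ->.
have WS : (\int[P]_w (W w ^+ 2)%:E = (sigma i ^+ 2 + a i ^+ 2)%:E)%E.
  apply: (square_of_centered mW W0 (a_gt0 i)) => //; rewrite -square.
  by apply: ae_eq_integral_nomeas; apply: filterS pathE => w ->.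
have X1 : (\int[P]_w (X 1 w)%:E = (a i)%:E)%E.
  by rewrite -WM; apply: ae_eq_integral_nomeas; apply: filterS WX => w ->.
have X2 : (\int[P]_w (X 2 w)%:E = (sigma i ^+ 2 + a i ^+ 2)%:E)%E.
  rewrite -WS; apply: ae_eq_integral_nomeas; apply: filterS WX => w ->.
  by rewrite /X expr1.
have e1 : expR (- lam i) < 1 by rewrite -expR0 ltr_expR oppr_lt0.
have j2fin : (jump_moment nu i 2 < +oo)%E.
  have h : (claims_moment mu i 2 1 1 <= (sigma i ^+ 2 + a i ^+ 2)%:E)%E.
    rewrite -meanZ -WS; apply: ge0_ae_le_integral_nomeas.
    - by move=> w; rewrite lee_fin.
    - by move=> w; rewrite lee_fin exprn_ge0.
    apply: filterS (ZW 1) => w; rewrite /Z expr1 => h.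
    by rewrite lee_fin lerXn2r ?nnegrE ?claims_ge0.
  rewrite ltey; apply/eqP => joo; move: h; rewrite leNgt => /negP; apply.
  (* a claim before time 1 has probability [1 - exp (- lam i)], and [K] times it exceeds [B] *)
  set B := sigma i ^+ 2 + a i ^+ 2; set K := (B + 1) / (1 - expR (- lam i)).
  have K0 : 0 <= K.
    rewrite divr_ge0 ?subr_ge0 ?(ltW e1)//.
    by rewrite addr_ge0// addr_ge0// sqr_ge0.
  have dcst (x : R) : is_derive x 1 (fun=> K) 0 by exact: (@is_derive_cst R R R K x 1).
  have ccst : continuous (fun _ : R => 0 : R) by move=> x; exact: cvg_cst.
  have BK : (B%:E < first_claim (G i) (fun=> K%:E) 1)%E.
    have K0E (x : R) : (0 <= K%:E)%E by rewrite lee_fin.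
    have := first_claim_ge l0 (@GE i) (measurable_cst K%:E) K0E dcst ccst ler01.
    rewrite mulr1 => h; apply: (lt_le_trans _ (h _)).
      rewrite lte_fin -[X in _ < X - _]mul1r -mulrBl mulrC divfK ?gt_eqF ?subr_gt0//.
      by rewrite ltrDl.
    by move=> u _; rewrite addr0 EFinM.
  apply: (lt_le_trans BK); rewrite (claims_squareS prodP) joo /first_claim.
  have mlt : measurable_fun setT (fun g : measurableTypeR R => (1 < g)%R).
    exact: measurable_fun_ltr.
  have mB : measurable_fun setT (fun g : R => 1 - g) by exact: measurable_funB.
  have p2 t : (0 <= 2%:E * jump_moment nu i 1 * claims_moment mu i 1 0 t)%E.
    by rewrite !mule_ge0// ?claims_moment_ge0 ?jump_moment_ge0.
  apply: ge0_le_integral => //.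
  - by move=> g _; case: ifP => // _; rewrite lee_fin.
  - exact: measurable_fun_ifT.
  - apply: measurable_fun_ifT => //; apply: emeasurable_funD.
      apply: emeasurable_funD => //; apply: emeasurable_funM => //.
      exact: (measurableT_comp (measurable_claims_moment mu i 1 0) mB).
    exact: (measurableT_comp (measurable_claims_moment mu i 2 0) mB).
  move=> g _; case: ifP => // _.
  rewrite addye ?addye ?leey// gt_eqF// (lt_le_trans ltNy0)// ?claims_moment_ge0//.
have j1fin : (jump_moment nu i 1 < +oo)%E.
  apply: (@le_lt_trans _ _ (1 + jump_moment nu i 2)%E); last by rewrite lte_add_pinfty ?ltry.
  have ma n : measurable_fun setT (fun x : measurableTypeR R => (`|x| ^+ n)%:E).
    by apply/measurable_EFinP; apply: measurable_funX; exact: normr_measurable.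
  have pa n (x : R) : (0 <= (`|x| ^+ n)%:E)%E by rewrite lee_fin exprn_ge0.
  rewrite -(integral_probability_cst (nu i) 1) -ge0_integralD//.
  apply: ge0_le_integral => //.
    by apply: emeasurable_funD.
  move=> x _; rewrite -EFinD lee_fin expr1; have := normr_ge0 x.
  by set y := `|x|; nra.
have [m1 m1E] : exists m1, jump_moment nu i 1 = m1%:E.
  by exists (fine (jump_moment nu i 1)); rewrite fineK// ge0_fin_numE// jump_moment_ge0.
have [m2 m2E] : exists m2, jump_moment nu i 2 = m2%:E.
  by exists (fine (jump_moment nu i 2)); rewrite fineK// ge0_fin_numE// jump_moment_ge0.
have m10 : 0 <= m1 by rewrite -lee_fin -m1E jump_moment_ge0.
have m20 : 0 <= m2 by rewrite -lee_fin -m2E jump_moment_ge0.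
have [C [r [r0 r1 hb]]] := claims_moments_bounds lam_gt0 GE prodP m10 m20 m1E m2E.
have b1 m : ((lam i * m1 - C * r ^+ m)%:E <= \int[P]_w (Z 1 m w)%:E <= (lam i * m1)%:E)%E.
  by rewrite meanZ; case: (hb m).
have b2 m : ((lam i * m2 + (lam i * m1) ^+ 2 - C * r ^+ m)%:E <= \int[P]_w (Z 2 m w)%:E
    <= (lam i * m2 + (lam i * m1) ^+ 2)%:E)%E.
  by rewrite meanZ; case: (hb m).
have := integral_eventually (mZ 1) (Z0 1) (ndZ 1) (ZX 1) r0 r1 b1.
have := integral_eventually (mZ 2) (Z0 2) (ndZ 2) (ZX 2) r0 r1 b2.
rewrite X1 X2 => -[E2] [E1]; rewrite m1E m2E; split; congr EFin.
  by rewrite E1 mulrC mulKf// gt_eqF.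
have -> : sigma i ^+ 2 = lam i * m2 by move: E2; rewrite -E1; lra.
by rewrite mulrC mulKf// gt_eqF.
Qed.
End identification.

(** * The limit profile *)

Section taylor.
Context (R : realType) (F F' : R -> R).
Hypothesis dF : forall x : R, is_derive x 1 F (F' x).

Lemma mean_value u w : u < w ->
  exists2 c, u < c < w & F w - F u = F' c * (w - u).
Proof.
move=> uw; have := @MVT R F F' u w uw (fun x _ => dF x).
case; first by apply: continuous_subspaceT; exact: is_derive_continuous dF.
by move=> c; rewrite in_itv/= => cuw E; exists c.
Qed.

Lemma increment_le u w K : u <= w -> (forall x, u < x < w -> F' x <= K) ->
  F w - F u <= K * (w - u).
Proof.
rewrite le_eqVlt => /predU1P[->|uw] FK; first by rewrite !subrr mulr0.
have [c cuw ->] := mean_value uw.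
by rewrite ler_wpM2r ?subr_ge0 ?(ltW uw)//; exact: FK.
Qed.

Lemma increment_ge u w K : u <= w -> (forall x, u < x < w -> K <= F' x) ->
  K * (w - u) <= F w - F u.
Proof.
rewrite le_eqVlt => /predU1P[->|uw] FK; first by rewrite !subrr mulr0.
have [c cuw ->] := mean_value uw.
by rewrite ler_wpM2r ?subr_ge0 ?(ltW uw)//; exact: FK.
Qed.
End taylor.

Section taylor2.
Context (R : realType) (F F' : R -> R).
Hypothesis dF : forall x : R, is_derive x 1 F (F' x).

Let D u K (x : R) := F x - (F' u * (x - u) + K / 2 * (x - u) ^+ 2).
Let dD u K (x : R) : is_derive x 1 (D u K) (F' x - F' u - K * (x - u)).
Proof. by apply: is_derive_eq; rewrite /GRing.scale/=; field. Qed.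

(** [F'] may be only Lipschitz: the remainder [F x - F' u (x - u) - K / 2 (x - u)^2] is
    nonincreasing. *)
Lemma taylor_le u h K : 0 <= h ->
  (forall x, u <= x <= u + h -> F' x - F' u <= K * (x - u)) ->
  F (u + h) <= F u + F' u * h + K / 2 * h ^+ 2.
Proof.
move=> h0 inc; have uh : u <= u + h by rewrite lerDl.
have := increment_le (dD u K) uh (K := 0).
rewrite mul0r /D (addrC u h) addrK subrr expr0n/= !mulr0 addr0 subr0.
have -> : h + u = u + h by rewrite addrC.
move=> H; suff : F (u + h) - (F' u * h + K / 2 * h ^+ 2) - F u <= 0 by lra.
by apply: H => x /andP[ux xu]; have := inc x; rewrite (ltW ux) (ltW xu) => /(_ isT); lra.
Qed.

Lemma taylor_ge u h K : 0 <= h ->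
  (forall x, u <= x <= u + h -> K * (x - u) <= F' x - F' u) ->
  F u + F' u * h + K / 2 * h ^+ 2 <= F (u + h).
Proof.
move=> h0 inc; have uh : u <= u + h by rewrite lerDl.
have := increment_ge (dD u K) uh (K := 0).
rewrite mul0r /D (addrC u h) addrK subrr expr0n/= !mulr0 addr0 subr0.
have -> : h + u = u + h by rewrite addrC.
move=> H; suff : 0 <= F (u + h) - (F' u * h + K / 2 * h ^+ 2) - F u by lra.
by apply: H => x /andP[ux xu]; have := inc x; rewrite (ltW ux) (ltW xu) => /(_ isT); lra.
Qed.
End taylor2.

Section glue.
Context (R : realType).
Implicit Types f g : R -> R.

Definition glue f g u : R := if u <= 0 then f u else g u.

Lemma glueE f g u : f 0 = g 0 ->
  glue f g u = f (Num.min u 0) + g (Num.max u 0) - g 0.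
Proof. by move=> fg; rewrite /glue; case: (leP u 0) => _; rewrite ?addrK// fg addrC addKr. Qed.

Lemma glue_le f g u : u <= 0 -> glue f g u = f u.
Proof. by rewrite /glue => ->. Qed.

Lemma glue_ge f g u : f 0 = g 0 -> 0 <= u -> glue f g u = g u.
Proof.
by move=> fg u0; rewrite /glue; case: leP => // u0'; have -> : u = 0 by lra.
Qed.

Lemma glue_continuous f g : f 0 = g 0 -> continuous f -> continuous g ->
  continuous (glue f g).
Proof.
move=> fg cf cg.
have -> : glue f g = fun u => f (Num.min u 0) + g (Num.max u 0) - g 0.
  by apply/funext => u; exact: glueE.
move=> u; apply: cvgB; last exact: cvg_cst.
apply: cvgD.
  apply: (@continuous_comp _ _ _ (fun u : R => Num.min u 0) f); last exact: cf.
  by apply: (@continuous_min R R id (fun=> 0)); [exact: cvg_id|exact: cvg_cst].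
apply: (@continuous_comp _ _ _ (fun u : R => Num.max u 0) g); last exact: cg.
by apply: (@continuous_max R R id (fun=> 0)); [exact: cvg_id|exact: cvg_cst].
Qed.

Lemma glue_is_derive0 f g (d : R) : f 0 = g 0 ->
  is_derive (0 : R) 1 f d -> is_derive (0 : R) 1 g d ->
  is_derive (0 : R) 1 (glue f g) d.
Proof.
move=> fg df dg.
have quot k : is_derive (0 : R) 1 k d ->
    h^-1 *: ((k \o shift (0 : R)) (h *: (1 : R)) - k 0) @[h --> 0^'] --> d.
  by move=> [dk <-]; exact: dk.
have cg : h^-1 *: ((glue f g \o shift (0 : R)) (h *: (1 : R)) - glue f g 0)
    @[h --> 0^'] --> d.
  apply/cvgrPdist_lt => e e0.
  move/cvgrPdist_lt : (quot f df) => /(_ e e0) Hf.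
  move/cvgrPdist_lt : (quot g dg) => /(_ e e0) Hg.
  near=> h.
  rewrite /= /glue lexx; case: ifP => _.
    by near: h; exact: Hf.
  by rewrite fg; near: h; exact: Hg.
apply: DeriveDef; first by apply/cvg_ex; exists d.
exact/cvg_lim.
Unshelve. all: by end_near.
Qed.

Lemma glue_is_derive f g f' g' : f 0 = g 0 -> f' 0 = g' 0 ->
  (forall u : R, is_derive u 1 f (f' u)) -> (forall u : R, is_derive u 1 g (g' u)) ->
  forall u : R, is_derive u 1 (glue f g) (glue f' g' u).
Proof.
move=> fg fg' df dg u; have [u0|u0|->] := ltgtP u 0.
- rewrite glue_le ?ltW//; apply: (near_eq_is_derive (f := f)).
  by near=> x; rewrite /glue ltW//; near: x; exact: lt_nbhsl.
- rewrite glue_ge ?ltW//; apply: (near_eq_is_derive (f := g)).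
  by near=> x; rewrite /glue ifN// -ltNge; near: x; exact: lt_nbhsr.
- have dg0 := dg 0; rewrite -fg' in dg0.
  by rewrite glue_le//; exact: glue_is_derive0.
Unshelve. all: by end_near.
Qed.

Section increments.
Variables (f g f' g' : R -> R).
Hypotheses (fg : f 0 = g 0).
Hypotheses (df : forall u : R, is_derive u 1 f (f' u))
  (dg : forall u : R, is_derive u 1 g (g' u)).

(** Mean value on each side of 0, added up.  This is for [profile'], which has a corner
    at 0. *)
Lemma glue_increment_le u w K : u <= w ->
  (forall x, u < x < w -> (x < 0 -> f' x <= K) /\ (0 < x -> g' x <= K)) ->
  glue f g w - glue f g u <= K * (w - u).
Proof.
move=> uw b; have [w0|w0] := leP w 0.
  rewrite !glue_le//; last exact: le_trans w0.
  by apply: (increment_le df) => // x xuw; apply: (b x xuw).1; move/andP: xuw => [_]; lra.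
have [u0|u0] := leP 0 u.
  rewrite !glue_ge//; last exact: ltW.
  by apply: (increment_le dg) => // x xuw; apply: (b x xuw).2; move/andP: xuw => [+ _]; lra.
have h1 : f 0 - f u <= K * (0 - u).
  apply: (increment_le df); first exact: ltW.
  by move=> x /andP[ux x0]; apply: (b x _).1 => //; apply/andP; split; lra.
have h2 : g w - g 0 <= K * (w - 0).
  apply: (increment_le dg); first exact: ltW.
  by move=> x /andP[x0 xw]; apply: (b x _).2 => //; apply/andP; split; lra.
rewrite (glue_ge fg (ltW w0)) (glue_le f g (ltW u0)).
by move: fg h1 h2; lra.
Qed.

Lemma glue_increment_ge u w K : u <= w ->
  (forall x, u < x < w -> (x < 0 -> K <= f' x) /\ (0 < x -> K <= g' x)) ->
  K * (w - u) <= glue f g w - glue f g u.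
Proof.
move=> uw b; have [w0|w0] := leP w 0.
  rewrite !glue_le//; last exact: le_trans w0.
  by apply: (increment_ge df) => // x xuw; apply: (b x xuw).1; move/andP: xuw => [_]; lra.
have [u0|u0] := leP 0 u.
  rewrite !glue_ge//; last exact: ltW.
  by apply: (increment_ge dg) => // x xuw; apply: (b x xuw).2; move/andP: xuw => [+ _]; lra.
have h1 : K * (0 - u) <= f 0 - f u.
  apply: (increment_ge df); first exact: ltW.
  by move=> x /andP[ux x0]; apply: (b x _).1 => //; apply/andP; split; lra.
have h2 : K * (w - 0) <= g w - g 0.
  apply: (increment_ge dg); first exact: ltW.
  by move=> x /andP[x0 xw]; apply: (b x _).2 => //; apply/andP; split; lra.
rewrite (glue_ge fg (ltW w0)) (glue_le f g (ltW u0)).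
by move: fg h1 h2; lra.
Qed.

End increments.
End glue.

Section two_speed_profile.
Context (R : realType) (s sl sr : R).
Hypotheses (s_gt0 : 0 < s) (sl_gt0 : 0 < sl) (sr_gt0 : 0 < sr).
Let c : R := Num.sqrt (2 * s).
Let c_gt0 : 0 < c. Proof. by rewrite sqrtr_gt0 mulr_gt0. Qed.
Let c2 : c ^+ 2 = 2 * s. Proof. by rewrite sqr_sqrtr// mulr_ge0// ltW. Qed.

Let L u := sl * expR (u * (c / sl)).
Let L1 u := c * expR (u * (c / sl)).
Let Q u := sl * cosh (u * (c / sr)) + sr * sinh (u * (c / sr)).
Let Q1 u := c * (sl / sr * sinh (u * (c / sr)) + cosh (u * (c / sr))).

(** Up to a factor, the solution of [sigma^2 / 2 f'' = s f] that vanishes at [-oo], with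
    [sigma = sl] on the left of 0 and [sigma = sr] on its right, continuously
    differentiable at 0. *)
Definition profile : R -> R := glue L Q.
Definition profile' : R -> R := glue L1 Q1.

Let dL (u : R) : is_derive u 1 L (L1 u).
Proof.
by apply: is_derive_eq; rewrite /GRing.scale/= /L1; field; rewrite gt_eqF.
Qed.

Let dQ (u : R) : is_derive u 1 Q (Q1 u).
Proof.
rewrite /Q /cosh /sinh.
by apply: is_derive_eq; rewrite /GRing.scale/= /Q1 /cosh /sinh; field; rewrite gt_eqF.
Qed.

Let dL1 (u : R) : is_derive u 1 L1 (2 * s / sl ^+ 2 * L u).
Proof.
apply: is_derive_eq; rewrite /GRing.scale/= /L -c2; field; by rewrite gt_eqF.
Qed.

Let dQ1 (u : R) : is_derive u 1 Q1 (2 * s / sr ^+ 2 * Q u).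
Proof.
rewrite /Q1 /cosh /sinh.
by apply: is_derive_eq; rewrite /GRing.scale/= /Q /cosh /sinh -c2; field; rewrite gt_eqF.
Qed.

Let cosh0 : cosh (0 : R) = 1. Proof. by rewrite /cosh oppr0 expR0; lra. Qed.
Let sinh0 : sinh (0 : R) = 0. Proof. by rewrite /sinh oppr0 subrr mul0r. Qed.

Let LQ0 : L 0 = Q 0.
Proof. by rewrite /L /Q !mul0r cosh0 sinh0 expR0 mulr0 addr0. Qed.
Let LQ10 : L1 0 = Q1 0.
Proof. by rewrite /L1 /Q1 !mul0r cosh0 sinh0 expR0 mulr0 add0r. Qed.

Lemma profile_derive (u : R) : is_derive u 1 profile (profile' u).
Proof. exact: glue_is_derive. Qed.

Lemma profile'_continuous : continuous profile'.
Proof.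
apply: glue_continuous => //; [exact: is_derive_continuous dL1|exact: is_derive_continuous dQ1].
Qed.

Lemma profile_le0 u : u <= 0 -> profile u = L u.
Proof. exact: glue_le. Qed.

Lemma profile_ge0 u : 0 <= u -> profile u = Q u.
Proof. exact: glue_ge. Qed.

Let sinh_ge0 (u : R) : 0 <= u -> 0 <= sinh u.
Proof. by move=> u0; rewrite /sinh divr_ge0// subr_ge0 ler_expR; lra. Qed.

Let cosh_gt0 (u : R) : 0 < cosh u.
Proof. by rewrite /cosh divr_gt0// addr_gt0// expR_gt0. Qed.

Let Q_gt0 (u : R) : 0 <= u -> 0 < Q u.
Proof.
move=> u0; have uc : 0 <= u * (c / sr) by rewrite mulr_ge0// divr_ge0// ltW.
have p1 : 0 < sl * cosh (u * (c / sr)) by rewrite mulr_gt0 ?cosh_gt0.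
have p2 : 0 <= sr * sinh (u * (c / sr)) by rewrite mulr_ge0 ?sinh_ge0// ltW.
by rewrite /Q; lra.
Qed.

Let L_gt0 (u : R) : 0 < L u. Proof. by rewrite mulr_gt0 ?expR_gt0. Qed.

Lemma profile_gt0 u : 0 < profile u.
Proof.
have [u0|u0] := leP u 0; first by rewrite profile_le0.
by rewrite profile_ge0 ?Q_gt0// ltW.
Qed.

Let curv (m k : R) : 0 <= k -> 0 <= 2 * s / m ^+ 2 * k.
Proof. by move=> k0; rewrite mulr_ge0// divr_ge0 ?sqr_ge0// mulr_ge0// ltW. Qed.

Lemma profile'_nd u w : u <= w -> profile' u <= profile' w.
Proof.
move=> uw; rewrite -subr_ge0.
have := @glue_increment_ge R L1 Q1 _ _ LQ10 dL1 dQ1 u w 0 uw; rewrite mul0r; apply.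
move=> x _; split=> x0; first by rewrite curv// ltW.
by rewrite curv// ltW// Q_gt0// ltW.
Qed.

Lemma profile'_ge0 u : 0 <= profile' u.
Proof.
have [u0|u0] := leP u 0.
  by rewrite /profile' glue_le// mulr_ge0 ?expR_ge0// ltW.
apply: le_trans (profile'_nd (ltW u0)).
by rewrite /profile' glue_le// mulr_ge0 ?expR_ge0// ltW.
Qed.

Lemma profile_nd u w : u <= w -> profile u <= profile w.
Proof.
move=> uw; rewrite -subr_ge0.
have := increment_ge profile_derive uw (K := 0); rewrite mul0r; apply.
by move=> x _; exact: profile'_ge0.
Qed.

Lemma profile_lipschitz u w : u <= w -> profile w <= profile u + profile' w * (w - u).
Proof.
move=> uw; rewrite -lerBlDl; apply: (increment_le profile_derive uw) => x /andP[_ xw].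
by apply: profile'_nd; exact: ltW.
Qed.

Let curv_le (m m' k k' : R) : 0 < m -> m <= m' -> 0 <= k -> k <= k' ->
  2 * s / m' ^+ 2 * k <= 2 * s / m ^+ 2 * k'.
Proof.
move=> m0 mm k0 kk; have m'0 : 0 < m' by exact: lt_le_trans mm.
apply: ler_pM => //.
  by rewrite divr_ge0 ?sqr_ge0// mulr_ge0// ltW.
rewrite ler_wpM2l//; first by rewrite mulr_ge0// ltW.
by rewrite lef_pV2 ?posrE ?exprn_gt0// lerXn2r// nnegrE ltW.
Qed.

(** On each side [profile'' = 2 s / sigma^2 * profile], and [profile] is nondecreasing; [m]
    has to be at most the speed on each side that the interval meets. *)
Lemma profile'_increment_le u w m : u <= w -> 0 < m ->
  (forall x, u < x < w -> (x < 0 -> m <= sl) /\ (0 < x -> m <= sr)) ->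
  profile' w - profile' u <= 2 * s / m ^+ 2 * profile w * (w - u).
Proof.
move=> uw m0 h; apply: (glue_increment_le LQ10 dL1 dQ1 uw) => x xuw.
have [hl hr] := h x xuw; move/andP: xuw => [ux xw]; split=> x0.
  apply: curv_le => //; [exact: hl|exact: ltW|].
  by rewrite -profile_le0 ?(ltW x0)// profile_nd// ltW.
apply: curv_le => //; [exact: hr|by rewrite ltW// Q_gt0// ltW|].
by rewrite -profile_ge0 ?(ltW x0)// profile_nd// ltW.
Qed.

Lemma profile'_increment_ge u w m : u <= w -> 0 < m ->
  (forall x, u < x < w -> (x < 0 -> sl <= m) /\ (0 < x -> sr <= m)) ->
  2 * s / m ^+ 2 * profile u * (w - u) <= profile' w - profile' u.
Proof.
move=> uw m0 h; apply: (glue_increment_ge LQ10 dL1 dQ1 uw) => x xuw.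
have [hl hr] := h x xuw; move/andP: xuw => [ux xw]; split=> x0.
  apply: curv_le => //; [exact: hl|exact: ltW (profile_gt0 u)|].
  by rewrite -profile_le0 ?(ltW x0)// profile_nd// ltW.
apply: curv_le => //; [exact: hr|exact: ltW (profile_gt0 u)|].
by rewrite -profile_ge0 ?(ltW x0)// profile_nd// ltW.
Qed.

End two_speed_profile.

(** * The generator on large scales *)

Section jump_law.
Context (R : realType) (nu : probability (measurableTypeR R) R) (m1 m2 : R).
Hypothesis nu_gt0 : nu `]0%R, +oo[%classic = 1%E.
Hypotheses (mean1 : (\int[nu]_x (`|x| ^+ 1)%:E = m1%:E)%E)
  (mean2 : (\int[nu]_x (`|x| ^+ 2)%:E = m2%:E)%E).

Let J : set R := `]0%R, +oo[%classic.
Let mJ : measurable J. Proof. exact: measurable_itv. Qed.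

Let J_full : {ae nu, forall x : measurableTypeR R, J x}.
Proof.
exists (~` J); split => //; first exact: measurableC.
by rewrite [LHS]probability_setC// nu_gt0 subee.
Qed.

Let tail (N x : R) : R := if N < `|x| then `|x| ^+ 2 else 0.

Let mpow n : measurable_fun setT (fun x : R => `|x| ^+ n).
Proof. by apply: measurable_funX; exact: normr_measurable. Qed.

Let mtail N : measurable_fun setT (tail N).
Proof.
apply: measurable_fun_ifT => //.
exact: measurable_fun_ltr.
Qed.

Let integrable_pow n m : (\int[nu]_x (`|x| ^+ n)%:E = m%:E)%E ->
  nu.-integrable setT (EFin \o (fun x : R => `|x| ^+ n)).
Proof.
move=> mE; apply/integrableP; split; first by apply/measurable_EFinP; exact: mpow.
under eq_integral => x _ do rewrite /= ger0_norm ?exprn_ge0//.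
by rewrite mE ltry.
Qed.

Let tail_bound N x : 0 <= tail N x <= `|x| ^+ 2.
Proof. by rewrite /tail; case: ifP => _; rewrite ?lexx exprn_ge0. Qed.

Let int_tail N : nu.-integrable setT (EFin \o tail N).
Proof.
apply: (le_integrable measurableT _ _ (integrable_pow mean2)).
  by apply/measurable_EFinP; exact: mtail.
move=> x _; have /andP[t0 tx] := tail_bound N x.
by rewrite /= lee_fin ger0_norm// ger0_norm ?exprn_ge0.
Qed.

Let tail_mean N : R := (\int[nu]_x (tail N x))%R.

(** Dominated convergence, the second moment being finite. *)
Lemma square_tail_vanishes e : 0 < e ->
  exists2 N0, 0 < N0 & forall N, N0 <= N -> tail_mean N <= e.
Proof.
move=> e0.
have := @dominated_cvg _ (measurableTypeR R) R nu setT measurableT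
  (fun n x => (tail n%:R x)%:E) (fun=> 0%E) (fun x => (`|x| ^+ 2)%:E).
rewrite integral0 => lim.
have {lim} : (\int[nu]_x (tail n%:R x)%:E)%E @[n --> \oo] --> (0%E : \bar R).
  apply: lim => //.
  - by move=> n; apply/measurable_EFinP; exact: mtail.
  - move=> x _; apply: cvg_near_cst.
    near=> n; rewrite /tail ifF//; apply/negbTE; rewrite -leNgt.
    by near: n; exact: nbhs_infty_ger.
  - exact: (integrable_pow mean2).
  - move=> n x _; have /andP[t0 tx] := tail_bound n%:R x.
    by rewrite /= lee_fin ger0_norm.
move=> /fine_cvgP[_] /cvgrPdist_le /(_ e e0)[n _ nP].
exists n.+1%:R => // N nN.
apply: (@le_trans _ _ (tail_mean n%:R)).
  apply: le_Rintegral => // x _.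
  rewrite /tail; case: ltP => [Nx|_]; last by case/andP: (tail_bound n%:R x).
  rewrite ifT//; apply: le_lt_trans Nx; apply: le_trans nN.
  by rewrite ler_nat.
have := nP n (leqnn n); rewrite /= sub0r normrN; apply: le_trans.
exact: ler_norm.
Unshelve. all: by end_near. Qed.

Section quadratic_bounds.
Variables (h : R -> R) (M A D Q C N : R).
Hypotheses (mh : measurable_fun setT h) (h0 : forall x, 0 <= h x)
  (hM : forall x, h x <= M).

Let quadratic c x := A + D * `|x| ^+ 1 + Q * `|x| ^+ 2 + c * tail N x.

Let int_scaled (c : R) (t : R -> R) : nu.-integrable setT (EFin \o t) ->
  nu.-integrable setT (EFin \o (fun x => c * t x)).
Proof.
move=> it; have := integrableZl measurableT c it.
by apply: eq_integrable => // x _; rewrite /= EFinM.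
Qed.

Let int_add (t u : R -> R) : nu.-integrable setT (EFin \o t) ->
  nu.-integrable setT (EFin \o u) ->
  nu.-integrable setT (EFin \o (fun x => t x + u x)).
Proof.
move=> it iu; have := integrableD measurableT it iu.
by apply: eq_integrable => // x _; rewrite /= EFinD.
Qed.

Let int_cst (c : R) : nu.-integrable setT (EFin \o (fun=> c)).
Proof. exact: finite_measure_integrable_cst. Qed.

Let int_quadratic c : nu.-integrable setT (EFin \o quadratic c).
Proof.
apply: int_add; last by apply: int_scaled; exact: int_tail.
apply: int_add; last by apply: int_scaled; exact: integrable_pow mean2.
apply: int_add; first exact: int_cst.
by apply: int_scaled; exact: integrable_pow mean1.
Qed.

Let mean_quadratic c :
  \int[nu]_x (quadratic c x) = A + D * m1 + Q * m2 + c * tail_mean N.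
Proof.
have i1 := integrable_pow mean1; have i2 := integrable_pow mean2.
have it := int_tail N.
have s1 := int_scaled D i1; have s2 := int_scaled Q i2; have st := int_scaled c it.
have p1 := int_add (int_cst A) s1; have p2 := int_add p1 s2.
rewrite (RintegralD measurableT p2 st) (RintegralD measurableT p1 s2).
rewrite (RintegralD measurableT (int_cst A) s1) !RintegralZl//.
rewrite Rintegral_cst// [X in fine X]probability_setT mulr1.
by rewrite /Rintegral mean1 mean2.
Qed.

Let int_h : nu.-integrable setT (EFin \o (fun x => h `|x|)).
Proof.
apply: (le_integrable measurableT _ _ (int_cst M)).
  apply/measurable_EFinP; apply: (measurableT_comp mh); exact: normr_measurable.
have M0 : 0 <= M by exact: le_trans (hM 0).
by move=> x _; rewrite /= lee_fin (ger0_norm M0) (ger0_norm (h0 _)).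
Qed.

(** Jumps are almost surely positive, so a jump may be replaced by its absolute value;
    bounds on [h] are then needed on the half-line only. *)
Let mean_h : (\int[nu]_x (h x)%:E)%E = (\int[nu]_x h `|x|)%:E.
Proof.
rewrite /Rintegral fineK; last exact: integrable_fin_num.
apply: ae_eq_integral_nomeas.
have F := ae_filter_ringOfSetsType nu.
apply: filterS J_full => x.
by rewrite /J /= in_itv/= andbT => x0; rewrite gtr0_norm.
Qed.

Lemma mean_le_quadratic e : 0 <= C -> tail_mean N <= e ->
  (forall x, 0 <= x -> h x <= A + D * x + Q * x ^+ 2 + C * (if N < x then x ^+ 2 else 0)) ->
  (\int[nu]_x (h x)%:E <= (A + D * m1 + Q * m2 + C * e)%:E)%E.
Proof.
move=> C0 te hq; rewrite mean_h lee_fin.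
apply: (@le_trans _ _ (\int[nu]_x (quadratic C x))).
  apply: le_Rintegral => // x _; rewrite /quadratic expr1 /tail; exact: hq.
by rewrite mean_quadratic lerD2l ler_wpM2l.
Qed.

Lemma mean_ge_quadratic e : 0 <= C -> tail_mean N <= e ->
  (forall x, 0 <= x -> A + D * x + Q * x ^+ 2 - C * (if N < x then x ^+ 2 else 0) <= h x) ->
  ((A + D * m1 + Q * m2 - C * e)%:E <= \int[nu]_x (h x)%:E)%E.
Proof.
move=> C0 te hq; rewrite mean_h lee_fin.
apply: (@le_trans _ _ (\int[nu]_x (quadratic (- C) x))).
  by rewrite mean_quadratic lerD2l mulNr lerN2 ler_wpM2l.
apply: le_Rintegral => // x _; rewrite /quadratic expr1 /tail mulNr; exact: hq.
Qed.

End quadratic_bounds.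
End jump_law.

Section scaled_generator.
Context (R : realType) (nu : probability (measurableTypeR R) R) (lam a sg s : R).
Hypotheses (lam_gt0 : 0 < lam) (sg_gt0 : 0 < sg) (s_gt0 : 0 < s).
Hypothesis nu_gt0 : nu `]0%R, +oo[%classic = 1%E.
Hypotheses (mean1 : (\int[nu]_x (`|x| ^+ 1)%:E = (a / lam)%:E)%E)
  (mean2 : (\int[nu]_x (`|x| ^+ 2)%:E = (sg ^+ 2 / lam)%:E)%E).
Variables (M G eps delta : R).
Hypotheses (M_ge0 : 0 <= M) (G_ge0 : 0 <= G) (eps_gt0 : 0 < eps)
  (delta_gt0 : 0 < delta).

Let kappa := s / sg ^+ 2.
Let kappa_gt0 : 0 < kappa. Proof. by rewrite divr_gt0// exprn_gt0. Qed.

Let big := 2 * M / eps ^+ 2 + G / eps + kappa * (M + delta).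

Let big_gt0 : 0 < big.
Proof.
have p1 : 0 <= 2 * M / eps ^+ 2 by rewrite divr_ge0 ?sqr_ge0// mulr_ge0.
have p2 : 0 <= G / eps by rewrite divr_ge0// ltW.
have p3 : 0 < kappa * (M + delta) by rewrite mulr_gt0// ltr_wpDl.
by rewrite /big; lra.
Qed.

(** Beyond [eps] the expansion is useless, but every quantity in it is bounded by a
    multiple of [h^2]. *)
Let crude f d q h : `|f| <= M -> `|d| <= G -> `|q| <= kappa * (M + delta) ->
  eps < h -> M + `|f + d * h + q * h ^+ 2| <= big * h ^+ 2.
Proof.
move=> fM dG qk eh; have h0 : 0 < h by exact: lt_trans eh.
have u1 : 1 <= h / eps by rewrite ler_pdivlMr// mul1r ltW.
have t1 : 2 * M <= 2 * M / eps ^+ 2 * h ^+ 2.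
  rewrite -mulrA (mulrC _ (h ^+ 2)) -expr_div_n ler_peMr ?mulr_ge0//.
  by rewrite -[1](expr1n _ 2) lerXn2r// nnegrE// ltW// (lt_le_trans _ u1).
have t2 : `|d * h| <= G / eps * h ^+ 2.
  rewrite normrM (gtr0_norm h0) expr2 mulrA; apply: ler_pM => //; first exact: ltW.
  rewrite -mulrA (mulrC _ h); apply: le_trans dG _; by rewrite ler_peMr.
have t3 : `|q * h ^+ 2| <= kappa * (M + delta) * h ^+ 2.
  by rewrite normrM (ger0_norm (sqr_ge0 h)) ler_wpM2r ?sqr_ge0.
have := ler_normD (f + d * h) (q * h ^+ 2); have := ler_normD f (d * h).
by rewrite /big; lra.
Qed.

Let vanish : exists2 B0, 0 < B0 & forall B, B0 <= B -> exists e,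
  [/\ \int[nu]_x (if eps * B < `|x| then `|x| ^+ 2 else 0) <= e &
      lam * (big * e) <= s * delta].
Proof.
have e0 : 0 < s * delta / (lam * big) by rewrite divr_gt0 ?mulr_gt0.
have [N0 N00 NP] := square_tail_vanishes mean2 e0.
exists (N0 / eps) => [|B NB]; first by rewrite divr_gt0.
exists (s * delta / (lam * big)); split.
  by apply: NP; rewrite -ler_pdivrMl// mulrC.
by rewrite mulrA mulrCA divff ?mulr1// gt_eqF// mulr_gt0.
Qed.

(** Integrate the second-order bound in [h = X / B].  The moments of [X] turn [f' z h] into
    the drift term and [s / sg^2 f z h^2] into [s / B^2 f z]; jumps larger than [eps B]
    contribute [o (1 / B^2)] by [square_tail_vanishes], and the slack [delta] absorbs
    them. *)
Lemma scaled_generator : exists2 B0, 0 < B0 & forall B, B0 <= B ->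
  forall (psi : R -> R) z f d, measurable_fun setT psi ->
  (forall x, 0 <= psi x <= M) -> `|f| <= M -> `|d| <= G ->
  ((forall h, 0 <= h <= eps ->
     psi (z + h) <= f + d * h + kappa * (f - delta) * h ^+ 2) ->
   (lam%:E * \int[nu]_x (psi (z + x / B))%:E <=
     ((lam + s / B ^+ 2) * f + a * (d / B))%:E)%E) /\
  ((forall h, 0 <= h <= eps ->
     f + d * h + kappa * (f + delta) * h ^+ 2 <= psi (z + h)) ->
   (((lam + s / B ^+ 2) * f + a * (d / B))%:E <=
      lam%:E * \int[nu]_x (psi (z + x / B))%:E)%E).
Proof.
have [B0 B00 BP] := vanish; exists B0 => // B B0B psi z f d mpsi psiM fM dG.
have Bp : 0 < B by exact: lt_le_trans B0B.
have Bn : B != 0 by rewrite gt_eqF.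
have [e [te le]] := BP B B0B.
have mh : measurable_fun setT (fun x : R => psi (z + x / B)).
  by apply: measurableT_comp => //; apply: measurable_funD => //; exact: measurable_funM.
have h0 x : 0 <= psi (z + x / B) by case/andP: (psiM (z + x / B)).
have hM x : psi (z + x / B) <= M by case/andP: (psiM (z + x / B)).
have cB : 0 <= big / B ^+ 2 by rewrite divr_ge0 ?sqr_ge0// ltW.
have side x : 0 <= x -> x / B <= eps \/ eps * B < x /\ eps < x / B.
  move=> x0; have [xe|xe] := leP (x / B) eps; [by left|right; split=> //].
  by rewrite -ltr_pdivlMr.
have qk e1 : `|e1| <= delta -> `|kappa * (f + e1)| <= kappa * (M + delta).
  move=> e1d; rewrite normrM (gtr0_norm kappa_gt0) ler_pM2l//.
  by apply: le_trans (ler_normD _ _) _; exact: lerD.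
have dd : `|delta| <= delta by rewrite gtr0_norm.
have finish : lam * (big / B ^+ 2 * e) <= s / B ^+ 2 * delta.
  have -> : lam * (big / B ^+ 2 * e) = lam * (big * e) / B ^+ 2 by field.
  have -> : s / B ^+ 2 * delta = s * delta / B ^+ 2 by field.
  by rewrite ler_pM2r// invr_gt0 exprn_gt0.
have expand q x : q / B ^+ 2 * x ^+ 2 = q * (x / B) ^+ 2 by field.
have expd x : d / B * x = d * (x / B) by field.
have moments q c : lam * (f + d / B * (a / lam) + kappa * q / B ^+ 2 * (sg ^+ 2 / lam) + c)
    = lam * f + a * (d / B) + s / B ^+ 2 * q + lam * c.
  by rewrite /kappa; field; rewrite Bn !gt_eqF.
split=> hq.
  apply: (@le_trans _ _ (lam%:E * (f + d / B * (a / lam) +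
      kappa * (f - delta) / B ^+ 2 * (sg ^+ 2 / lam) + big / B ^+ 2 * e)%:E)%E).
    rewrite lee_pmul2l//.
    apply: (mean_le_quadratic nu_gt0 mean1 mean2 mh h0 hM cB te) => x x0.
    have xB0 : 0 <= x / B by rewrite divr_ge0// ltW.
    rewrite expand expd; case: (side _ x0) => [xe|[-> xe]].
      apply: le_trans (hq _ _) _; first by rewrite xB0.
      by rewrite lerDl mulr_ge0//; case: ifP => // _; rewrite sqr_ge0.
    have := crude fM dG (qk (- delta) _) xe; rewrite normrN => /(_ dd).
    rewrite expand => c; have := hM x.
    by have := ler_norm (- (f + d * (x / B) + kappa * (f - delta) * (x / B) ^+ 2));
      rewrite normrN; lra.
  by rewrite -EFinM lee_fin moments; lra.
apply: (@le_trans _ _ (lam%:E * (f + d / B * (a / lam) +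
    kappa * (f + delta) / B ^+ 2 * (sg ^+ 2 / lam) - big / B ^+ 2 * e)%:E)%E).
  by rewrite -EFinM lee_fin moments; lra.
rewrite lee_pmul2l//.
apply: (mean_ge_quadratic nu_gt0 mean1 mean2 mh h0 hM cB te) => x x0.
have xB0 : 0 <= x / B by rewrite divr_ge0// ltW.
rewrite expand expd; case: (side _ x0) => [xe|[-> xe]].
  apply: le_trans (hq (x / B) _); last by rewrite xB0.
  by rewrite lerBlDr lerDl mulr_ge0//; case: ifP => // _; rewrite sqr_ge0.
have := crude fM dG (qk delta dd) xe; rewrite expand => c; have := h0 x.
have := ler_norm (f + d * (x / B) + kappa * (f + delta) * (x / B) ^+ 2).
by move: M_ge0 c; lra.
Qed.

End scaled_generator.

(** * Comparison with super- and subsolutions *)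

Section payoff_linear.
Context (R : realType) (a : bool -> R) (b s : R) (lvl : bool -> \bar R) (dead : R -> bool).
Local Notation pay := (payoff a b s lvl dead).

Lemma payoff_scale c psi m v y : pay (fun z => c * psi z) m v y = c * pay psi m v y.
Proof.
elim: m v y => [|m IHm] v y //=; case: ifP => // _.
by rewrite IHm mulrCA.
Qed.

Lemma payoff_add psi1 psi2 m v y :
  pay (fun z => psi1 z + psi2 z) m v y = pay psi1 m v y + pay psi2 m v y.
Proof.
elim: m v y => [|m IHm] v y //=; case: ifP => // _.
by rewrite IHm mulrDr.
Qed.

Lemma payoff_homo psi1 psi2 m v y : (forall z, psi1 z <= psi2 z) ->
  pay psi1 m v y <= pay psi2 m v y.
Proof.
move=> h; elim: m v y => [|m IHm] v y //=; case: ifP => // _.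
by rewrite ler_wpM2l ?expR_ge0.
Qed.

End payoff_linear.

Section comparison.
Context (R : realType) (a lam : bool -> R) (b s : R).
Hypotheses (a_gt0 : forall i, 0 < a i) (lam_gt0 : forall i, 0 < lam i).
Hypothesis s_gt0 : 0 < s.
Variables (G nu : bool -> probability (measurableTypeR R) R).
Hypothesis GE : forall i (A : set R), measurable A ->
  G i A = exponential_prob (lam i) A.
Variable mu : probability (env source R) R.
Hypothesis prodP : product_law (source_law G nu) mu.
Variables (lvl : bool -> \bar R) (dead : R -> bool).
Hypothesis mdead : measurable_fun setT dead.
Hypothesis lvl_true : lvl true = b%:E.
Hypothesis lvl_false : lvl false = -oo%E \/
  exists r, lvl false = r%:E /\ dead =1 (fun y => y <= r).

Local Notation mean := (mean_payoff a b s mu lvl dead).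

Let mpay psi m y : measurable_fun setT psi ->
  measurable_fun setT (fun v : env source R => payoff a b s lvl dead psi m v y).
Proof. by move=> mpsi; apply: measurable_payoff => // j; exact: measurable_coord. Qed.

Let mdeadR : measurable_fun setT (fun y => (dead y)%:R : R).
Proof. exact: measurable_indicator_of. Qed.

Let maliveR : measurable_fun setT (fun y => (~~ dead y)%:R : R).
Proof. by apply: measurable_indicator_of; exact: measurable_neg. Qed.

Let weigh (c1 c2 : R) z : R := c1 * (dead z)%:R + c2 * (~~ dead z)%:R.

Lemma mean_split (c M : R) m y : 0 <= c -> 0 <= M ->
  (mean (weigh c M) m y =
   c%:E * mean (fun z => (dead z)%:R) m y + M%:E * mean (fun z => (~~ dead z)%:R) m y)%E.
Proof.
move=> c0 M0; rewrite /mean_payoff.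
have k1 : measurable_fun setT (fun v : env source R =>
    (payoff a b s lvl dead (fun z => (dead z)%:R) m v y)%:E).
  by apply/measurable_EFinP; exact: mpay.
have k2 : measurable_fun setT (fun v : env source R =>
    (payoff a b s lvl dead (fun z => (~~ dead z)%:R) m v y)%:E).
  by apply/measurable_EFinP; exact: mpay.
have n1 (v : env source R) : (0 <= (payoff a b s lvl dead (fun z => (dead z)%:R) m v y)%:E)%E.
  by rewrite lee_fin payoff_ge0.
have n2 (v : env source R) : (0 <= (payoff a b s lvl dead (fun z => (~~ dead z)%:R) m v y)%:E)%E.
  by rewrite lee_fin payoff_ge0.
have e1 := @ge0_integralZl_EFin _ _ _ mu setT measurableT _ (fun v _ => n1 v) k1 c c0.
have e2 := @ge0_integralZl_EFin _ _ _ mu setT measurableT _ (fun v _ => n2 v) k2 M M0.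
rewrite -e1 -e2 -(@ge0_integralD _ _ _ mu setT measurableT).
- by apply: eq_integral => v _; rewrite payoff_add !payoff_scale EFinD !EFinM.
- by move=> v _; rewrite mule_ge0.
- exact: measurable_funeM.
- by move=> v _; rewrite mule_ge0.
- exact: measurable_funeM.
Qed.

Lemma mean_payoff_homo (psi1 psi2 : R -> R) m y : measurable_fun setT psi1 ->
  measurable_fun setT psi2 -> (forall z, 0 <= psi1 z) ->
  (forall z, psi1 z <= psi2 z) -> (mean psi1 m y <= mean psi2 m y)%E.
Proof.
move=> m1 m2 p1 p12; apply: ge0_le_integral => //.
- by move=> v _; rewrite lee_fin payoff_ge0.
- by apply/measurable_EFinP; exact: mpay.
- by apply/measurable_EFinP; exact: mpay.
- by move=> v _; rewrite lee_fin; exact: payoff_homo.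
Qed.

Variables (y l : R).
Hypothesis lP : forall m,
  (mean (fun z => (dead z)%:R) m y <= l%:E <= mean (fun=> 1%R) m y)%E.

Let decay (M : R) e : 0 <= M -> 0 < e -> exists m,
  (M%:E * mean (fun z => (~~ dead z)%:R) m y <= e%:E)%E.
Proof.
move=> M0 e0.
have [C [r [r0 r1 h]]] := survival_decay a_gt0 lam_gt0 s_gt0 GE prodP mdead lvl_true lvl_false.
have [m mP] := geometric_vanish (M * C) r0 r1 e0.
exists m; apply: (@le_trans _ _ (M%:E * (C * r ^+ m)%:E)%E).
  by apply: lee_wpmul2l; rewrite ?lee_fin//; exact: h.
by rewrite -EFinM lee_fin mulrA ltW.
Qed.

Section test_function.
Variables (psi : R -> R) (M c : R).
Hypotheses (mpsi : measurable_fun setT psi) (psiM : forall z, 0 <= psi z <= M).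
Hypothesis c_ge0 : 0 <= c.

Let psi0 z : 0 <= psi z. Proof. by case/andP: (psiM z). Qed.
Let M0 : 0 <= M. Proof. by case/andP: (psiM 0) => p0; exact: le_trans. Qed.

Let mweigh c1 c2 : measurable_fun setT (weigh c1 c2).
Proof. by apply: measurable_funD; exact: measurable_funM. Qed.

Let mean_dead_fin m : mean (fun z => (dead z)%:R) m y \is a fin_num.
Proof.
have /andP[h _] := lP m; rewrite ge0_fin_numE; first exact: le_lt_trans h (ltry _).
by apply: integral_ge0 => v _; rewrite lee_fin payoff_ge0.
Qed.

(** The transform exceeds the mean of the discounted indicator of [dead] by the weight of
    survival only.  [psi / c] dominates the former, and the latter vanishes. *)
Lemma supersolution_bound : (forall z, dead z -> c <= psi z) ->
  (forall z, ~~ dead z -> (one_step a b s G nu lvl psi z <= (psi z)%:E)%E) ->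
  c * l <= psi y.
Proof.
move=> hc step; apply/ler_addgt0Pr => e e0; have [m mP] := decay c_ge0 e0.
have up : (c%:E * mean (fun z => (dead z)%:R) m y <= (psi y)%:E)%E.
  have := mean_split m y c_ge0 (lexx 0); rewrite mul0e adde0 => <-.
  apply: (@mean_payoff_le _ _ _ _ _ _ _ prodP _ _ _ mdead _ _ (fun=> psi)) => //.
  - by move=> z; rewrite /weigh mul0r addr0 mulr_ge0.
  - move=> z; rewrite /weigh mul0r addr0; case: (boolP (dead z)) => dz.
      by rewrite mulr1 hc.
    by rewrite mulr0.
  - by move=> _ z dz; rewrite /weigh dz mul0r addr0 mulr1 hc.
rewrite -lee_fin EFinD EFinM.
have /andP[_] := lP m.
have -> : mean (fun=> 1%R) m y =
    mean (weigh 1 1) m y.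
  by congr (mean _ m y); apply/funext => z; rewrite /weigh; case: (dead z) => /=; lra.
rewrite mean_split// !mul1e => le.
apply: (@le_trans _ _ (c%:E * (mean (fun z => (dead z)%:R) m y +
    mean (fun z => (~~ dead z)%:R) m y))%E).
  exact: lee_wpmul2l.
by rewrite muleDr// ?fin_num_adde_defr// leeD.
Qed.

(** When the chain stops after [m] steps, [psi] is at most [c] if it is dead and at most [M]
    otherwise, and the weight of survival vanishes. *)
Lemma subsolution_bound : (forall z, dead z -> psi z <= c) ->
  (forall z, ~~ dead z -> ((psi z)%:E <= one_step a b s G nu lvl psi z)%E) ->
  psi y <= c * l.
Proof.
move=> hc step; apply/ler_addgt0Pr => e e0; have [m mP] := decay M0 e0.
have lo : ((psi y)%:E <= mean psi m y)%E.
  exact: (@mean_payoff_ge _ _ _ _ _ _ _ prodP _ _ _ mdead _ _ (fun=> psi)).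
rewrite -lee_fin EFinD EFinM; apply: le_trans lo _.
apply: (@le_trans _ _ (mean (weigh c M) m y)).
  apply: mean_payoff_homo => // z; rewrite /weigh; case: (boolP (dead z)) => dz /=.
    by rewrite mulr1 mulr0 addr0 hc.
  by rewrite mulr1 mulr0 add0r; case/andP: (psiM z).
rewrite mean_split//; apply: leeD => //; apply: lee_wpmul2l; first by rewrite lee_fin.
by case/andP: (lP m).
Qed.

Section generator_test.
Variables (f f' : R -> R) (D : set R).
Hypotheses (df : forall x : R, is_derive x 1 f (f' x)) (cf' : continuous f').
Hypothesis regionD : forall x z, ~~ dead x -> (lvl (b < x)%R <= z%:E)%E -> z <= x -> D z.
Hypothesis fM : forall z, D z -> `|f z| <= M.

Let alive_level x : ~~ dead x -> D x.
Proof.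
move=> ax; apply: (regionD ax) => //; case: ltP => bx; first by rewrite lvl_true lee_fin ltW.
case: lvl_false => [->|[r [-> dr]]]; first exact: leNye.
by move: ax; rewrite dr -ltNge lee_fin => /ltW.
Qed.

(** [D] is a region containing the lines followed by the drift from every position that
    is not dead; only there must [psi] be the smooth function [f]. *)
Lemma supersolution_generator : (forall z, D z -> psi z = f z) ->
  (forall (i : bool) z, D z -> (i -> b <= z) -> (~~ i -> z <= b) ->
    ((lam i)%:E * jump_mean nu psi i z <= ((lam i + s) * f z + a i * f' z)%:E)%E) ->
  (forall z, dead z -> c <= psi z) -> c * l <= psi y.
Proof.
move=> psif gen hc; apply: supersolution_bound => // x ax.
have Dx := alive_level ax; rewrite psif//.
have [bx|bx] := ltP b x.
  have bxE : lvl (b < x) = b%:E by rewrite bx.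
  have inD z : b <= z <= x -> D z.
    by move=> /andP[bz zx]; apply: (regionD ax) => //; rewrite bxE lee_fin.
  apply: (one_step_le a_gt0 lam_gt0 GE mpsi psi0 df cf' bxE bx) => [|z zr].
    by rewrite psif//; apply: inD; rewrite lexx ltW.
  by apply: gen; [exact: inD|rewrite bx; case/andP: zr|rewrite bx].
have bxE : (b < x) = false by rewrite ltNge bx.
have gen' z : (lvl false <= z%:E)%E -> z <= x ->
    ((lam (b < x)%R)%:E * jump_mean nu psi (b < x)%R z <=
     ((lam (b < x)%R + s) * f z + a (b < x)%R * f' z)%:E)%E.
  move=> lz zx; apply: gen; first by apply: (regionD ax) => //; rewrite bxE.
    by rewrite bxE.
  by move=> _; exact: le_trans bx.
case: lvl_false => [E|[r [E dr]]].
  have lx : lvl (b < x) = -oo%E by rewrite bxE.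
  apply: (one_step_le_free a_gt0 lam_gt0 (ltW s_gt0) GE mpsi psi0 df cf' (M := M) lx) => z zx.
    by apply: fM; apply: (regionD ax) => //; rewrite lx leNye.
  by apply: gen' => //; rewrite E leNye.
have lx : lvl (b < x) = r%:E by rewrite bxE.
have rx : r < x by move: ax; rewrite dr -ltNge.
apply: (one_step_le a_gt0 lam_gt0 GE mpsi psi0 df cf' lx rx) => [|z zr].
  by rewrite psif//; apply: (regionD ax); rewrite ?lx ?lexx// ltW.
by case/andP: zr => rz zx; apply: gen' => //; rewrite E lee_fin.
Qed.

(** Where [f] is negative, [psi = 0] and a discounted average of [psi] is at least 0. *)
Lemma subsolution_generator : (forall z, D z -> psi z = Num.max 0 (f z)) ->
  (forall (i : bool) z, D z -> (i -> b <= z) -> (~~ i -> z <= b) ->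
    (((lam i + s) * f z + a i * f' z)%:E <= (lam i)%:E * jump_mean nu psi i z)%E) ->
  (forall z, dead z -> psi z <= c) -> psi y <= c * l.
Proof.
move=> psif gen hc; apply: subsolution_bound => // x ax.
have Dx := alive_level ax; rewrite psif//.
have psi_ge z : D z -> f z <= psi z by move=> Dz; rewrite psif// le_max lexx orbT.
case: (leP 0 (f x)) => fx; last first.
  by apply: integral_ge0 => g _; apply: integral_ge0 => z _; rewrite lee_fin mulr_ge0 ?expR_ge0.
have [bx|bx] := ltP b x.
  have bxE : lvl (b < x) = b%:E by rewrite bx.
  have inD z : b <= z <= x -> D z.
    by move=> /andP[bz zx]; apply: (regionD ax) => //; rewrite bxE lee_fin.
  apply: (one_step_ge a_gt0 lam_gt0 GE mpsi psi0 df cf' bxE bx) => [|z zr].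
    by apply: psi_ge; apply: inD; rewrite lexx ltW.
  by apply: gen; [exact: inD|rewrite bx; case/andP: zr|rewrite bx].
have bxE : (b < x) = false by rewrite ltNge bx.
have gen' z : (lvl false <= z%:E)%E -> z <= x ->
    (((lam (b < x)%R + s) * f z + a (b < x)%R * f' z)%:E <=
     (lam (b < x)%R)%:E * jump_mean nu psi (b < x)%R z)%E.
  move=> lz zx; apply: gen; first by apply: (regionD ax) => //; rewrite bxE.
    by rewrite bxE.
  by move=> _; exact: le_trans bx.
case: lvl_false => [E|[r [E dr]]].
  have lx : lvl (b < x) = -oo%E by rewrite bxE.
  apply: (one_step_ge_free a_gt0 lam_gt0 (ltW s_gt0) GE mpsi psi0 df cf' (M := M) lx) => z zx.
    by apply: fM; apply: (regionD ax) => //; rewrite lx leNye.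
  by apply: gen' => //; rewrite E leNye.
have lx : lvl (b < x) = r%:E by rewrite bxE.
have rx : r < x by move: ax; rewrite dr -ltNge.
apply: (one_step_ge a_gt0 lam_gt0 GE mpsi psi0 df cf' lx rx) => [|z zr].
  by apply: psi_ge; apply: (regionD ax); rewrite ?lx ?lexx// ltW.
by case/andP: zr => rz zx; apply: gen' => //; rewrite E lee_fin.
Qed.

End generator_test.
End test_function.
End comparison.

(** * Comparison on large scales *)

Lemma is_derive_rescale (R : realType) (f f' : R -> R) (B : R) :
  (forall x : R, is_derive x 1 f (f' x)) ->
  forall y : R, is_derive y 1 (fun y : R => f (y / B)) (f' (y / B) / B).
Proof.
move=> df y; have df1 := df (y / B).
have dl : is_derive y 1 (fun y : R => y / B) B^-1.
  by apply: is_derive_eq; rewrite /GRing.scale/=; ring.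
by have := @is_derive1_comp R f (fun y : R => y / B) y _ _ df1 dl.
Qed.

Section scaled_comparison.
Context (R : realType) (a lam sg : bool -> R) (b s : R).
Hypotheses (a_gt0 : forall i, 0 < a i) (lam_gt0 : forall i, 0 < lam i)
  (sg_gt0 : forall i, 0 < sg i) (s_gt0 : 0 < s).
Variables (G nu : bool -> probability (measurableTypeR R) R).
Hypothesis GE : forall i (A : set R), measurable A ->
  G i A = exponential_prob (lam i) A.
Hypothesis nu_gt0 : forall i, nu i `]0%R, +oo[%classic = 1%E.
Hypotheses (mean1 : forall i, jump_moment nu i 1 = (a i / lam i)%:E)
  (mean2 : forall i, jump_moment nu i 2 = (sg i ^+ 2 / lam i)%:E).
Variable mu : probability (env source R) R.
Hypothesis prodP : product_law (source_law G nu) mu.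

Variables (low : \bar R) (dead : R -> bool) (D : set R).
Hypothesis mdead : measurable_fun setT dead.
Hypothesis low_barrier : low = -oo%E \/
  exists r, low = r%:E /\ dead =1 (fun y => y <= r).
Hypothesis regionD : forall x z, ~~ dead x ->
  ((if (b < x)%R then b%:E else low) <= z%:E)%E -> z <= x -> D z.

Definition scaled_level B (i : bool) : \bar R := if i then (b * B)%:E else (low * B%:E)%E.

(** All that is used about the transform [l] on scale [B]: it lies between the mean
    payoffs of the chain, for the process started from [x B] and switching at [b B]. *)
Definition brackets B x l := forall m,
  (mean_payoff a (b * B) (s / B ^+ 2) mu (scaled_level B) (fun y => dead (y / B))
     (fun y => (dead (y / B))%:R) m (x * B) <= l%:E <=
   mean_payoff a (b * B) (s / B ^+ 2) mu (scaled_level B) (fun y => dead (y / B))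
     (fun=> 1%R) m (x * B))%E.

Section test_function.
Variables (psi f f' : R -> R) (M Gd eps delta c : R).
Hypotheses (df : forall x : R, is_derive x 1 f (f' x)) (cf' : continuous f').
Hypotheses (mpsi : measurable_fun setT psi) (psiM : forall z, 0 <= psi z <= M).
Hypotheses (fM : forall z, D z -> `|f z| <= M) (f'G : forall z, D z -> `|f' z| <= Gd).
Hypotheses (Gd_ge0 : 0 <= Gd) (eps_gt0 : 0 < eps) (delta_gt0 : 0 < delta).
Hypothesis c_ge0 : 0 <= c.

Let M0 : 0 <= M. Proof. by case/andP: (psiM 0) => p0; exact: le_trans. Qed.

Let gen : exists2 B0, 0 < B0 & forall B, B0 <= B -> forall (i : bool) z, D z ->
  ((forall h, 0 <= h <= eps ->
     psi (z + h) <= f z + f' z * h + s / sg i ^+ 2 * (f z - delta) * h ^+ 2) ->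
   ((lam i)%:E * \int[nu i]_x (psi (z + x / B))%:E <=
     ((lam i + s / B ^+ 2) * f z + a i * (f' z / B))%:E)%E) /\
  ((forall h, 0 <= h <= eps ->
     f z + f' z * h + s / sg i ^+ 2 * (f z + delta) * h ^+ 2 <= psi (z + h)) ->
   (((lam i + s / B ^+ 2) * f z + a i * (f' z / B))%:E <=
      (lam i)%:E * \int[nu i]_x (psi (z + x / B))%:E)%E).
Proof.
have gi i := scaled_generator (lam_gt0 i) (sg_gt0 i) s_gt0 (nu_gt0 i) (mean1 i) (mean2 i)
  M0 Gd_ge0 eps_gt0 delta_gt0.
have [B0 B00 P0] := gi false; have [B1 B10 P1] := gi true.
exists (Num.max B0 B1) => [|B]; first by rewrite lt_max B00.
rewrite ge_max => /andP[b0 b1] [] z Dz; first by apply: P1 => //; [exact: fM|exact: f'G].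
by apply: P0 => //; [exact: fM|exact: f'G].
Qed.

Section at_scale.
Variable B : R.
Hypothesis B_gt0 : 0 < B.

Let mdiv : measurable_fun setT (fun y : R => y / B).
Proof. exact: measurable_funM. Qed.

Let mdeadB : measurable_fun setT (fun y : R => dead (y / B)).
Proof. exact: (measurableT_comp mdead mdiv). Qed.

Let mpsiB : measurable_fun setT (fun y : R => psi (y / B)).
Proof. exact: (measurableT_comp mpsi mdiv). Qed.

Let level_false : scaled_level B false = -oo%E \/
  exists r, scaled_level B false = r%:E /\ (fun y => dead (y / B)) =1 (fun y => y <= r).
Proof.
case: low_barrier => [E|[r [E dr]]]; [left|right].
  by rewrite /scaled_level E gt0_mulNye// lte_fin.
exists (r * B); split; first by rewrite /scaled_level E EFinM.
by move=> y; rewrite dr ler_pdivrMr.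
Qed.

Let regionB x z : ~~ dead (x / B) -> (scaled_level B (b * B < x)%R <= z%:E)%E ->
  z <= x -> D (z / B).
Proof.
move=> ax lz zx; apply: (regionD ax); last by rewrite ler_pM2r// invr_gt0.
move: lz; rewrite -ltr_pdivlMr//; case: ltP => _.
  by rewrite !lee_fin ler_pdivlMr.
by rewrite /scaled_level EFinM lee_pdivlMr.
Qed.

Let cf'B : continuous (fun y : R => f' (y / B) / B).
Proof.
move=> y; apply: cvgM; last exact: cvg_cst.
apply: (@continuous_comp _ _ _ (fun y : R => y / B) f'); last exact: cf'.
by apply: cvgM; [exact: cvg_id|exact: cvg_cst].
Qed.

Let sB : 0 < s / B ^+ 2. Proof. by rewrite divr_gt0// exprn_gt0. Qed.

Let jumpE i z : jump_mean nu (fun y => psi (y / B)) i z =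
  (\int[nu i]_x (psi (z / B + x / B))%:E)%E.
Proof. by apply: eq_integral => x _; rewrite mulrDl. Qed.

Let backK x : x * B / B = x. Proof. by rewrite mulfK// gt_eqF. Qed.

Let sides (i : bool) z : (i -> b * B <= z) -> (~~ i -> z <= b * B) ->
  (i -> b <= z / B) /\ (~~ i -> z / B <= b).
Proof. by move=> h1 h2; split=> /= hi; rewrite ?ler_pdivlMr ?ler_pdivrMr; auto. Qed.

Lemma supersolution_at_scale x l : brackets B x l ->
  (forall z, D z -> psi z = f z) -> (forall z, dead z -> c <= psi z) ->
  (forall (i : bool) z, D z -> (i -> b <= z) -> (~~ i -> z <= b) ->
   ((lam i)%:E * \int[nu i]_x (psi (z + x / B))%:E <=
     ((lam i + s / B ^+ 2) * f z + a i * (f' z / B))%:E)%E) ->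
  c * l <= psi x.
Proof.
move=> lP psif hc gn; rewrite -[x in psi x]backK.
apply: (supersolution_generator a_gt0 lam_gt0 sB GE prodP mdeadB (erefl _) level_false lP
  mpsiB (fun z => psiM (z / B)) c_ge0 (is_derive_rescale B df) cf'B
  (D := [set z | D (z / B)])) => //.
- by move=> z; exact: fM.
- by move=> z; exact: psif.
- move=> i z Dz h1 h2; rewrite jumpE; have [k1 k2] := sides h1 h2; exact: gn.
- by move=> z; exact: hc.
Qed.

Lemma subsolution_at_scale x l : brackets B x l ->
  (forall z, D z -> psi z = Num.max 0 (f z)) -> (forall z, dead z -> psi z <= c) ->
  (forall (i : bool) z, D z -> (i -> b <= z) -> (~~ i -> z <= b) ->
   (((lam i + s / B ^+ 2) * f z + a i * (f' z / B))%:E <=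
    (lam i)%:E * \int[nu i]_x (psi (z + x / B))%:E)%E) ->
  psi x <= c * l.
Proof.
move=> lP psif hc gn; rewrite -[x in psi x]backK.
apply: (subsolution_generator a_gt0 lam_gt0 sB GE prodP mdeadB (erefl _) level_false lP
  mpsiB (fun z => psiM (z / B)) c_ge0 (is_derive_rescale B df) cf'B
  (D := [set z | D (z / B)])) => //.
- by move=> z; exact: fM.
- by move=> z; exact: psif.
- move=> i z Dz h1 h2; rewrite jumpE; have [k1 k2] := sides h1 h2; exact: gn.
- by move=> z; exact: hc.
Qed.

End at_scale.

Lemma scaled_supersolution :
  (forall z, D z -> psi z = f z) -> (forall z, dead z -> c <= psi z) ->
  (forall (i : bool) z, D z -> (i -> b <= z) -> (~~ i -> z <= b) ->
   forall h, 0 <= h <= eps ->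
     psi (z + h) <= f z + f' z * h + s / sg i ^+ 2 * (f z - delta) * h ^+ 2) ->
  exists2 B0, 0 < B0 & forall B, B0 <= B -> forall x l, brackets B x l -> c * l <= psi x.
Proof.
move=> psif hc taylor; have [B0 B00 BP] := gen; exists B0 => // B B0B x l lP.
apply: (supersolution_at_scale (lt_le_trans B00 B0B) lP) => // i z Dz h1 h2.
by apply: (BP B B0B i z Dz).1; exact: taylor.
Qed.

Lemma scaled_subsolution :
  (forall z, D z -> psi z = Num.max 0 (f z)) -> (forall z, dead z -> psi z <= c) ->
  (forall (i : bool) z, D z -> (i -> b <= z) -> (~~ i -> z <= b) ->
   forall h, 0 <= h <= eps ->
     f z + f' z * h + s / sg i ^+ 2 * (f z + delta) * h ^+ 2 <= psi (z + h)) ->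
  exists2 B0, 0 < B0 & forall B, B0 <= B -> forall x l, brackets B x l -> psi x <= c * l.
Proof.
move=> psif hc taylor; have [B0 B00 BP] := gen; exists B0 => // B B0B x l lP.
apply: (subsolution_at_scale (lt_le_trans B00 B0B) lP) => // i z Dz h1 h2.
by apply: (BP B B0B i z Dz).2; exact: taylor.
Qed.

End test_function.
End scaled_comparison.

(** * Test functions *)

Section interface.
Context (R : realType) (sg : bool -> R) (b eps : R).
Hypothesis eps_gt0 : 0 < eps.

(** Position of the interface of a test function such that a jump of length [h <= eps] from
    [z], governed by the speed of the side of [b] where [z] lies, only meets speeds that
    are at least as large.  If [sg false <= sg true] then [b] itself will do; otherwise
    moving it to [b + eps] keeps all jumps from below [b] on one side of it. *)
Lemma interface_le : exists2 b', b <= b' <= b + eps & forall (i : bool) (z h x : R),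
  (i -> b <= z) -> (~~ i -> z <= b) -> h <= eps -> z < x < z + h ->
  (x < b' -> sg i <= sg false) /\ (b' < x -> sg i <= sg true).
Proof.
have [ss|ss] := leP (sg false) (sg true).
  exists b; first by rewrite lexx lerDl ltW.
  move=> i z h x h1 h2 he /andP[zx xz]; split=> xb; case: i h1 h2 => h1 h2 //.
  by have := h1 isT; move: eps_gt0; lra.
exists (b + eps); first by rewrite lexx lerDl ltW.
move=> i z h x h1 h2 he /andP[zx xz]; split=> xb; case: i h1 h2 => h1 h2 //; first exact: ltW.
by have := h2 isT; lra.
Qed.

(** Same choice with the two cases exchanged. *)
Lemma interface_ge : exists2 b', b <= b' <= b + eps & forall (i : bool) (z h x : R),
  (i -> b <= z) -> (~~ i -> z <= b) -> h <= eps -> z < x < z + h ->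
  (x < b' -> sg false <= sg i) /\ (b' < x -> sg true <= sg i).
Proof.
have [ss|ss] := leP (sg true) (sg false).
  exists b; first by rewrite lexx lerDl ltW.
  move=> i z h x h1 h2 he /andP[zx xz]; split=> xb; case: i h1 h2 => h1 h2 //.
  by have := h1 isT; lra.
exists (b + eps); first by rewrite lexx lerDl ltW.
move=> i z h x h1 h2 he /andP[zx xz]; split=> xb; case: i h1 h2 => h1 h2 //; first exact: ltW.
by have := h2 isT; lra.
Qed.

End interface.

Section bounds.
Context (R : realType) (a lam sg : bool -> R) (b s : R).
Hypotheses (a_gt0 : forall i, 0 < a i) (lam_gt0 : forall i, 0 < lam i)
  (sg_gt0 : forall i, 0 < sg i) (s_gt0 : 0 < s).
Variables (G nu : bool -> probability (measurableTypeR R) R).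
Hypothesis GE : forall i (A : set R), measurable A ->
  G i A = exponential_prob (lam i) A.
Hypothesis nu_gt0 : forall i, nu i `]0%R, +oo[%classic = 1%E.
Hypotheses (mean1 : forall i, jump_moment nu i 1 = (a i / lam i)%:E)
  (mean2 : forall i, jump_moment nu i 2 = (sg i ^+ 2 / lam i)%:E).
Variable mu : probability (env source R) R.
Hypothesis prodP : product_law (source_law G nu) mu.

Lemma step_size (L eta : R) : 0 <= L -> 0 < eta ->
  exists eps : R, [/\ 0 < eps, eps <= 1 & L * eps <= eta / 2].
Proof.
move=> L0 e0; have L1 : 0 < L + 1 by lra.
exists (Num.min 1 (eta / 2 / (L + 1))); split.
- by rewrite lt_min ltr01 !divr_gt0.
- by rewrite ge_min lexx.
apply: (@le_trans _ _ ((L + 1) * (eta / 2 / (L + 1)))).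
  apply: ler_pM => //; first by rewrite le_min ler01 !divr_ge0// ltW.
    by lra.
  by rewrite ge_min lexx orbT.
by rewrite mulrC divfK// gt_eqF.
Qed.

Let halve (i : bool) (p : R) : 2 * s / sg i ^+ 2 * p / 2 = s / sg i ^+ 2 * p.
Proof. by field; rewrite gt_eqF. Qed.

Let curve (i : bool) (p q h : R) : p <= q ->
  s / sg i ^+ 2 * p * h ^+ 2 <= s / sg i ^+ 2 * q * h ^+ 2.
Proof.
move=> pq; rewrite ler_wpM2r ?sqr_ge0// ler_wpM2l// divr_ge0 ?sqr_ge0//.
exact: ltW.
Qed.

Let slope (i : bool) (p q t : R) : 0 <= t -> p <= q ->
  2 * s / sg i ^+ 2 * p * t <= 2 * s / sg i ^+ 2 * q * t.
Proof.
move=> t0 pq; rewrite ler_wpM2r// ler_wpM2l// divr_ge0 ?sqr_ge0// mulr_ge0//.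
exact: ltW.
Qed.

Section rising.
Variable k : R.
Hypothesis bk : b <= k.

Let p := profile s (sg false) (sg true).
Let p' := profile' s (sg false) (sg true).
Let p_nd u w : u <= w -> p u <= p w. Proof. exact: profile_nd. Qed.
Let p'_nd u w : u <= w -> p' u <= p' w. Proof. exact: profile'_nd. Qed.
Let p'_ge0 u : 0 <= p' u. Proof. exact: profile'_ge0. Qed.
Let p_gt0 u : 0 < p u. Proof. exact: profile_gt0. Qed.

Let test (b' e z : R) := p (z - b') + e.
Let test' (b' z : R) := p' (z - b').

Let dtest (b' e z : R) : is_derive z 1 (test b' e) (test' b' z).
Proof.
have dl : is_derive z 1 (fun z : R => z - b') 1.
  by apply: is_derive_eq; ring.
have dp := @is_derive1_comp R p (fun z : R => z - b') z _ _
  (profile_derive s (sg_gt0 false) (sg_gt0 true) (z - b')) dl.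
have dp2 : is_derive z 1 (fun z : R => p (z - b')) (p' (z - b') * 1) := dp.
by apply: is_derive_eq; rewrite /test'; ring.
Qed.

Let ctest' (b' : R) : continuous (test' b').
Proof.
move=> z; apply: (@continuous_comp _ _ _ (fun z : R => z - b') p').
  by apply: cvgB; [exact: cvg_id|exact: cvg_cst].
exact: profile'_continuous.
Qed.

Let L := p' (k + 1 - b).

Let lip u w eps : u <= w -> w <= u + eps -> w <= k + 1 - b -> p w <= p u + L * eps.
Proof.
move=> uw we wk.
have h : p w <= p u + p' w * (w - u) by exact: profile_lipschitz.
have g : p' w * (w - u) <= L * eps.
  by apply: ler_pM; [exact: p'_ge0|rewrite subr_ge0|exact: p'_nd|rewrite lerBlDl].
by apply: le_trans h _; rewrite lerD2l.
Qed.

Let mtest b' e : measurable_fun setT (test b' e).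
Proof. by apply: continuous_measurable_fun; exact: (is_derive_continuous (dtest b' e)). Qed.

Let mdead : measurable_fun setT (fun y : R => k < y).
Proof. exact: measurable_fun_ltr. Qed.

Let region x z : ~~ (k < x) ->
  ((if (b < x)%R then b%:E else -oo) <= z%:E)%E -> z <= x -> [set z | z <= k] z.
Proof. by rewrite -leNgt /= => xk _ zx; exact: le_trans xk. Qed.

Local Notation bracket := (brackets a b s mu -oo%E (fun y => k < y)).

(** Supersolution [profile + eta], frozen at its value at [k] beyond [k]: a jump over [k] is
    paid with at most what the formula would give. *)
Lemma upper_transform_le eta : 0 < eta -> exists2 B0, 0 < B0 &
  forall B, B0 <= B -> forall x l, x <= k -> bracket B x l ->
  p (k - b) * l <= p (x - b) + eta.
Proof.
move=> eta0; have [eps [eps0 eps1 Leps]] := step_size (p'_ge0 (k + 1 - b)) eta0.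
have [b' /andP[bb' b'b] side] := interface_le sg b eps0.
have bk' := bk; have {}Leps : L * eps <= eta / 2 := Leps.
pose f := test b' eta; pose psi z := f (Num.min z k).
have psif z : z <= k -> psi z = f z by move=> zk; rewrite /psi; case: leP => //; lra.
have f_le z : z <= k -> 0 <= f z <= p (k + 1 - b) + eta.
  move=> zk; have := p_gt0 (z - b').
  have : p (z - b') <= p (k + 1 - b) by apply: p_nd; lra.
  by rewrite /f /test; lra.
have [] := @scaled_supersolution R a lam sg b s a_gt0 lam_gt0 sg_gt0 s_gt0 G nu GE nu_gt0
  mean1 mean2 mu prodP -oo%E (fun y => k < y) [set z | z <= k] mdead (or_introl erefl) region
  psi f (test' b') (p (k + 1 - b) + eta) L eps (eta / 2) (p (k - b)) (dtest b' eta) (@ctest' b').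
- by apply: measurableT_comp; [exact: mtest|exact: measurable_minr].
- by move=> z; apply: f_le; rewrite ge_min lexx orbT.
- by move=> z zk; have /andP[f0 fM] := f_le z zk; rewrite ger0_norm.
- by move=> z zk; rewrite ger0_norm ?p'_ge0//; apply: p'_nd; move: zk => /=; lra.
- exact: p'_ge0.
- exact: eps0.
- by rewrite divr_gt0.
- exact: ltW.
- by move=> z; exact: psif.
- move=> z kz; rewrite /psi; have -> : Num.min z k = k by case: leP => //; lra.
  rewrite /f /test; have h : p (k - b) <= p (k - b') + L * eps by apply: lip; lra.
  by lra.
- move=> i z /= zk h1 h2 h /andP[h0 he].
  have psi_le : psi (z + h) <= f (z + h).
    by rewrite /psi /f /test lerD2r; apply: p_nd; rewrite lerD2r ge_min lexx.
  apply: le_trans psi_le _.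
  apply: le_trans (taylor_le (dtest b' eta) (K := 2 * s / sg i ^+ 2 * p (z + eps - b')) h0 _) _.
    move=> x /andP[zx xz].
    have := @profile'_increment_le R s (sg false) (sg true) s_gt0 (sg_gt0 false) (sg_gt0 true)
      (z - b') (x - b') (sg i).
    have -> : x - b' - (z - b') = x - z by ring.
    move=> inc; apply: le_trans (inc _ (sg_gt0 i) _) _; first by lra.
      move=> u uzx; have [s1 s2] := side i z h (u + b') h1 h2 he ltac:(lra).
      by split=> u0; [apply: s1|apply: s2]; lra.
    by apply: slope; [lra|apply: p_nd; lra].
  rewrite halve lerD2l; apply: curve; rewrite /f /test.
  have h5 : p (z + eps - b') <= p (z - b') + L * eps by apply: lip; lra.
  by lra.
move=> B0 B00 BP; exists B0 => // B B0B x l xk lP.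
apply: le_trans (BP B B0B x l lP) _; rewrite psif// /f /test lerD2r.
by apply: p_nd; lra.
Qed.

(** Subsolution [profile - eta], cut at 0 to be nonnegative far below [b].  It is frozen only
    from [k + eps] on, so that jumps smaller than [eps] see the untruncated function. *)
Lemma upper_transform_ge eta : 0 < eta -> exists2 B0, 0 < B0 &
  forall B, B0 <= B -> forall x l, x <= k -> bracket B x l ->
  p (x - b) - 2 * eta <= (p (k - b) + eta) * l.
Proof.
move=> eta0; have [eps [eps0 eps1 Leps]] := step_size (p'_ge0 (k + 1 - b)) eta0.
have [b' /andP[bb' b'b] side] := interface_ge sg b eps0.
have bk' := bk; have {}Leps : L * eps <= eta / 2 := Leps.
pose f := test b' (- eta); pose psi z := Num.max 0 (f (Num.min z (k + eps))).
have psif z : z <= k + eps -> psi z = Num.max 0 (f z).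
  by move=> zk; rewrite /psi; congr (Num.max 0 (f _)); case: leP => //; lra.
have p_le z : z <= k + eps -> 0 <= p (z - b') <= p (k + 1 - b).
  by move=> zk; rewrite ltW ?p_gt0//=; apply: p_nd; lra.
have f_le z : z <= k + eps -> `|f z| <= p (k + 1 - b) + eta.
  by move=> /p_le pz; rewrite /f /test ler_norml; lra.
have [] := @scaled_subsolution R a lam sg b s a_gt0 lam_gt0 sg_gt0 s_gt0 G nu GE nu_gt0
  mean1 mean2 mu prodP -oo%E (fun y => k < y) [set z | z <= k] mdead (or_introl erefl) region
  psi f (test' b') (p (k + 1 - b) + eta) L eps eta (p (k - b) + eta) (dtest b' (- eta))
  (@ctest' b').
- apply: measurable_maxr => //.
  by apply: measurableT_comp; [exact: mtest|exact: measurable_minr].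
- move=> z; rewrite le_max lexx ge_max /=; apply/andP; split.
    by have := p_gt0 (k + 1 - b); lra.
  apply: le_trans (ler_norm _) _; apply: f_le; rewrite ge_min lexx orbT//.
- by move=> z zk; apply: f_le; move: zk => /=; lra.
- by move=> z zk; rewrite ger0_norm ?p'_ge0//; apply: p'_nd; move: zk => /=; lra.
- exact: p'_ge0.
- exact: eps0.
- exact: eta0.
- by have := p_gt0 (k - b); lra.
- by move=> z /= zk; apply: psif; lra.
- move=> z kz; rewrite /psi ge_max /f /test.
  have h : p (Num.min z (k + eps) - b') <= p (k - b) + L * eps.
    by apply: le_trans (_ : p (k + eps - b) <= _); [apply: p_nd; rewrite lerB// ge_min lexx orbT|apply: lip; lra].
  by have := p_gt0 (k - b); lra.
- move=> i z /= zk h1 h2 h /andP[h0 he].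
  have psi_ge : f (z + h) <= psi (z + h) by rewrite psif ?le_max ?lexx ?orbT//; lra.
  apply: le_trans psi_ge.
  apply: le_trans (taylor_ge (dtest b' (- eta)) (K := 2 * s / sg i ^+ 2 * p (z - b')) h0 _).
    by rewrite halve lerD2l; apply: curve; rewrite /f /test; lra.
  move=> x /andP[zx xz].
  have := @profile'_increment_ge R s (sg false) (sg true) s_gt0 (sg_gt0 false) (sg_gt0 true)
    (z - b') (x - b') (sg i).
  have -> : x - b' - (z - b') = x - z by ring.
  move=> inc; apply: (inc _ (sg_gt0 i) _); first by lra.
  move=> u uzx; have [s1 s2] := side i z h (u + b') h1 h2 he ltac:(lra).
  by split=> u0; [apply: s1|apply: s2]; lra.
move=> B0 B00 BP; exists B0 => // B B0B x l xk lP.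
apply: le_trans (BP B B0B x l lP); rewrite psif; last by lra.
rewrite le_max; apply/orP; right; rewrite /f /test.
have h : p (x - b) <= p (x - b') + L * eps by apply: lip; lra.
by lra.
Qed.

End rising.

Section falling.
Variable r : R.
Hypothesis rb : r <= b.

Let p := profile s (sg true) (sg false).
Let p' := profile' s (sg true) (sg false).
Let p_nd u w : u <= w -> p u <= p w. Proof. exact: profile_nd. Qed.
Let p'_nd u w : u <= w -> p' u <= p' w. Proof. exact: profile'_nd. Qed.
Let p'_ge0 u : 0 <= p' u. Proof. exact: profile'_ge0. Qed.
Let p_gt0 u : 0 < p u. Proof. exact: profile_gt0. Qed.

Let test (b' e z : R) := p (b' - z) + e.
Let test' (b' z : R) := - p' (b' - z).

Let dtest (b' e z : R) : is_derive z 1 (test b' e) (test' b' z).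
Proof.
have dl : is_derive z 1 (fun z : R => b' - z) (-1).
  by apply: is_derive_eq; ring.
have dp := @is_derive1_comp R p (fun z : R => b' - z) z _ _
  (profile_derive s (sg_gt0 true) (sg_gt0 false) (b' - z)) dl.
have dp2 : is_derive z 1 (fun z : R => p (b' - z)) (p' (b' - z) * -1) := dp.
by apply: is_derive_eq; rewrite /test'; ring.
Qed.

Let ctest' (b' : R) : continuous (test' b').
Proof.
move=> z; apply: cvgN; apply: (@continuous_comp _ _ _ (fun z : R => b' - z) p').
  by apply: cvgB; [exact: cvg_cst|exact: cvg_id].
exact: profile'_continuous.
Qed.

Let L := p' (b + 1 - r).

Let lip u w eps : u <= w -> w <= u + eps -> w <= b + 1 - r -> p w <= p u + L * eps.
Proof.
move=> uw we wk.
have h : p w <= p u + p' w * (w - u) by exact: profile_lipschitz.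
have g : p' w * (w - u) <= L * eps.
  by apply: ler_pM; [exact: p'_ge0|rewrite subr_ge0|exact: p'_nd|rewrite lerBlDl].
by apply: le_trans h _; rewrite lerD2l.
Qed.

Let mtest b' e : measurable_fun setT (test b' e).
Proof. by apply: continuous_measurable_fun; exact: (is_derive_continuous (dtest b' e)). Qed.

Let mdead : measurable_fun setT (fun y : R => y <= r).
Proof. exact: measurable_fun_ler. Qed.

Let region x z : ~~ (x <= r) ->
  ((if (b < x)%R then b%:E else r%:E) <= z%:E)%E -> z <= x -> [set z | r <= z] z.
Proof.
move=> _ + _ /=; case: ifP => _; rewrite lee_fin// => bz.
exact: le_trans bz.
Qed.

Let barrier : r%:E = -oo%E \/
  exists r', r%:E = r'%:E /\ (fun y => y <= r) =1 (fun y => y <= r').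
Proof. by right; exists r. Qed.

Local Notation bracket := (brackets a b s mu r%:E (fun y => y <= r)).

(** Mirror image of the upward passage.  Jumps go away from [r], and [r] is reached by the
    drift exactly, so that the test function can be frozen at [r]. *)
Lemma lower_transform_le eta : 0 < eta -> exists2 B0, 0 < B0 &
  forall B, B0 <= B -> forall x l, r <= x -> bracket B x l ->
  p (b - r) * l <= p (b - x) + 2 * eta.
Proof.
move=> eta0; have [eps [eps0 eps1 Leps]] := step_size (p'_ge0 (b + 1 - r)) eta0.
have [b' /andP[bb' b'b] side] := interface_le sg b eps0.
have rb' := rb; have {}Leps : L * eps <= eta / 2 := Leps.
pose f := test b' eta; pose psi z := f (Num.max z r).
have psif z : r <= z -> psi z = f z by move=> zr; rewrite /psi; congr f; case: leP => //; lra.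
have f_le z : r <= z -> 0 <= f z <= p (b + 1 - r) + eta.
  move=> zr; have := p_gt0 (b' - z).
  have : p (b' - z) <= p (b + 1 - r) by apply: p_nd; lra.
  by rewrite /f /test; lra.
have [] := @scaled_supersolution R a lam sg b s a_gt0 lam_gt0 sg_gt0 s_gt0 G nu GE nu_gt0
  mean1 mean2 mu prodP r%:E (fun y => y <= r) [set z | r <= z] mdead barrier region
  psi f (test' b') (p (b + 1 - r) + eta) L eps eta (p (b - r)) (dtest b' eta) (@ctest' b').
- by apply: measurableT_comp; [exact: mtest|exact: measurable_maxr].
- by move=> z; apply: f_le; rewrite le_max lexx orbT.
- by move=> z zr; have /andP[f0 fM] := f_le z zr; rewrite ger0_norm.
- by move=> z zr; rewrite normrN ger0_norm ?p'_ge0//; apply: p'_nd; move: zr => /=; lra.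
- exact: p'_ge0.
- exact: eps0.
- exact: eta0.
- exact: ltW.
- by move=> z; exact: psif.
- move=> z rz; rewrite /psi; have -> : Num.max z r = r by case: leP => //; lra.
  have h : p (b - r) <= p (b' - r) by apply: p_nd; lra.
  by rewrite /f /test; lra.
- move=> i z /= zr h1 h2 h /andP[h0 he].
  rewrite psif; last by lra.
  apply: le_trans (taylor_le (dtest b' eta) (K := 2 * s / sg i ^+ 2 * p (b' - z)) h0 _) _.
    move=> x /andP[zx xz].
    have := @profile'_increment_le R s (sg true) (sg false) s_gt0 (sg_gt0 true) (sg_gt0 false)
      (b' - x) (b' - z) (sg i).
    have -> : b' - z - (b' - x) = x - z by ring.
    move=> inc; rewrite /test' opprK addrC; apply: (inc _ (sg_gt0 i) _); first by lra.
    move=> u uzx; have [s1 s2] := side i z h (b' - u) h1 h2 he ltac:(lra).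
    by split=> u0; [apply: s2|apply: s1]; lra.
  by rewrite halve lerD2l; apply: curve; rewrite /f /test; lra.
move=> B0 B00 BP; exists B0 => // B B0B x l xr lP.
apply: le_trans (BP B B0B x l lP) _; rewrite psif// /f /test.
have h : p (b' - x) <= p (b - x) + L * eps by apply: lip; lra.
by lra.
Qed.

Lemma lower_transform_ge eta : 0 < eta -> exists2 B0, 0 < B0 &
  forall B, B0 <= B -> forall x l, r <= x -> bracket B x l ->
  p (b - x) - 2 * eta <= (p (b - r) + eta) * l.
Proof.
move=> eta0; have [eps [eps0 eps1 Leps]] := step_size (p'_ge0 (b + 1 - r)) eta0.
have [b' /andP[bb' b'b] side] := interface_ge sg b eps0.
have rb' := rb; have {}Leps : L * eps <= eta / 2 := Leps.
pose f := test b' (- eta); pose psi z := Num.max 0 (f (Num.max z r)).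
have psif z : r <= z -> psi z = Num.max 0 (f z).
  by move=> zr; rewrite /psi; congr (Num.max 0 (f _)); case: leP => //; lra.
have f_le z : r <= z -> `|f z| <= p (b + 1 - r) + eta.
  move=> zr; have := p_gt0 (b' - z).
  have : p (b' - z) <= p (b + 1 - r) by apply: p_nd; lra.
  by rewrite /f /test ler_norml; lra.
have [] := @scaled_subsolution R a lam sg b s a_gt0 lam_gt0 sg_gt0 s_gt0 G nu GE nu_gt0
  mean1 mean2 mu prodP r%:E (fun y => y <= r) [set z | r <= z] mdead barrier region
  psi f (test' b') (p (b + 1 - r) + eta) L eps (eta / 2) (p (b - r) + eta)
  (dtest b' (- eta)) (@ctest' b').
- apply: measurable_maxr => //.
  by apply: measurableT_comp; [exact: mtest|exact: measurable_maxr].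
- move=> z; rewrite le_max lexx ge_max /=; apply/andP; split.
    by have := p_gt0 (b + 1 - r); lra.
  by apply: le_trans (ler_norm _) _; apply: f_le; rewrite le_max lexx orbT.
- exact: f_le.
- by move=> z zr; rewrite normrN ger0_norm ?p'_ge0//; apply: p'_nd; move: zr => /=; lra.
- exact: p'_ge0.
- exact: eps0.
- by rewrite divr_gt0.
- by have := p_gt0 (b - r); lra.
- exact: psif.
- move=> z rz; rewrite /psi; have -> : Num.max z r = r by case: leP => //; lra.
  have h : p (b' - r) <= p (b - r) + L * eps by apply: lip; lra.
  by rewrite ge_max /f /test; have := p_gt0 (b - r); lra.
- move=> i z /= zr h1 h2 h /andP[h0 he].
  have psi_ge : f (z + h) <= psi (z + h) by rewrite psif ?le_max ?lexx ?orbT//; lra.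
  apply: le_trans psi_ge.
  apply: le_trans (taylor_ge (dtest b' (- eta))
    (K := 2 * s / sg i ^+ 2 * p (b' - (z + eps))) h0 _).
    rewrite halve lerD2l; apply: curve; rewrite /f /test.
    have h5 : p (b' - z) <= p (b' - (z + eps)) + L * eps by apply: lip; lra.
    by lra.
  move=> x /andP[zx xz].
  have := @profile'_increment_ge R s (sg true) (sg false) s_gt0 (sg_gt0 true) (sg_gt0 false)
    (b' - x) (b' - z) (sg i).
  have -> : b' - z - (b' - x) = x - z by ring.
  move=> inc; rewrite /test' opprK [leRHS]addrC; apply: le_trans (inc _ (sg_gt0 i) _).
  - by apply: slope; [lra|apply: p_nd; lra].
  - by lra.
  move=> u uzx; have [s1 s2] := side i z h (b' - u) h1 h2 he ltac:(lra).
  by split=> u0; [apply: s2|apply: s1]; lra.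
move=> B0 B00 BP; exists B0 => // B B0B x l xr lP.
apply: le_trans (BP B B0B x l lP); rewrite psif//.
rewrite le_max; apply/orP; right; rewrite /f /test.
have h : p (b - x) <= p (b' - x) by apply: p_nd; lra.
by lra.
Qed.

End falling.
End bounds.

(** * Laws of the data and limits *)

(** Half-open intervals are stable under intersection and generate the Borel sets. *)
Lemma probability_from_cdf (R : realType) (P Q : probability (measurableTypeR R) R) :
  (forall y, P `]-oo, y]%classic = Q `]-oo, y]%classic) ->
  forall A, measurable A -> P A = Q A.
Proof.
move=> PQ; apply: (@measure_unique _ R (measurableTypeR R) (@ocitv R)
  (fun n => `](1 *- n), n%:R]%classic)) => //.
- exact: ocitvI.
- by move=> n; exact: is_ocitv.
- exact: bigcup_itvT.
- move=> A /ocitvP[->|[[u w] /= uw ->]]; first by rewrite !measure0.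
  have E : `]u, w]%classic = `]-oo, w] `\` `]-oo, u].
    by rewrite -[RHS]setCK setCD setCitvl setUC -[LHS]setCK setCitv.
  have I : `]-oo, w]%classic `&` `]-oo, u]%classic = `]-oo, u]%classic.
    by rewrite setIidr//; apply: subset_itvl; rewrite bnd_simp ltW.
  have fin (m : probability (measurableTypeR R) R) (B : set R) : measurable B -> (m B < +oo)%E.
    by move=> mB; rewrite -ge0_fin_numE// fin_num_measure.
  rewrite E !measureD//; [|exact: fin|exact: fin].
  by rewrite I; congr (_ - _)%E; exact: PQ.
- by move=> n; rewrite -ge0_fin_numE// fin_num_measure.
Qed.

Lemma limit_from_bounds (R : realType) (L : R -> R) (p q : R) : 0 < p ->
  (forall B, 0 < B -> 0 <= L B <= 1) ->
  (forall eta, 0 < eta -> exists2 B0, 0 < B0 &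
     forall B, B0 <= B -> p * L B <= q + 2 * eta) ->
  (forall eta, 0 < eta -> exists2 B0, 0 < B0 &
     forall B, B0 <= B -> q - 2 * eta <= (p + eta) * L B) ->
  L B @[B --> +oo] --> q / p.
Proof.
move=> p0 L01 up lo; apply/cvgrPdist_le => e e0.
have eta0 : 0 < p * e / 3 by rewrite divr_gt0 ?mulr_gt0.
have [B1 B10 P1] := up _ eta0; have [B2 B20 P2] := lo _ eta0.
near=> B.
have b1 : B1 <= B by near: B; apply: nbhs_pinfty_ge; exact: num_real.
have b2 : B2 <= B by near: B; apply: nbhs_pinfty_ge; exact: num_real.
have u := P1 B b1; have w := P2 B b2.
have /andP[l0 l1] := L01 B (lt_le_trans B10 b1).
have w' : q - p * e <= p * L B by move: w; rewrite mulrDl; nra.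
have u' : p * L B <= q + p * e by move: u; nra.
have -> : q / p - L B = (q - p * L B) / p by field; rewrite gt_eqF.
rewrite normrM normfV (gtr0_norm p0) ler_pdivrMr// ler_norml; apply/andP; split; lra.
Unshelve. all: by end_near. Qed.

(** * The oscillating process of the statement *)

Section transfer.
Context (d : measure_display) (T : measurableType d) (R : realType) (P : probability T R).
Variables (V : T -> env source R) (mu : probability (env source R) R).
Hypotheses (mV : measurable_fun setT V)
  (muE : forall A, measurable A -> mu A = P (V @^-1` A)).

Variables (a : bool -> R) (b s y : R) (lvl : bool -> \bar R) (dead : R -> bool).
Hypothesis mdead : measurable_fun setT dead.
Variable tau : T -> \bar R.
Hypothesis sandwich : {ae P, forall w, forall m,
  payoff a b s lvl dead (fun z => (dead z)%:R) m (V w) y <= discount s (tau w) <=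
  payoff a b s lvl dead (fun=> 1) m (V w) y}.

Let mdeadR : measurable_fun setT (fun y => (dead y)%:R : R).
Proof. exact: measurable_indicator_of. Qed.

(** The sandwich is only almost sure and [tau] is not known to be measurable, hence the
    use of [ge0_ae_le_integral_nomeas].  With [m = 0] the upper bound is 1. *)
Lemma laplace_between : exists l, [/\ laplace P s tau = l%:E, 0 <= l <= 1 &
  forall m, (mean_payoff a b s mu lvl dead (fun z => (dead z)%:R) m y <= l%:E <=
             mean_payoff a b s mu lvl dead (fun=> 1%R) m y)%E].
Proof.
have mpay psi m : measurable_fun setT psi ->
    measurable_fun setT (fun v : env source R => payoff a b s lvl dead psi m v y).
  by move=> mpsi; apply: measurable_payoff => // j; exact: measurable_coord.
have lE : laplace P s tau = (\int[P]_w (discount s (tau w))%:E)%E.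
  by rewrite /laplace unlock.
have tau0 w : 0 <= discount s (tau w) by exact: discount_ge0.
have bounds m : (mean_payoff a b s mu lvl dead (fun z => (dead z)%:R) m y <=
    laplace P s tau <= mean_payoff a b s mu lvl dead (fun=> 1%R) m y)%E.
  have E (psi : R -> R) : measurable_fun setT psi -> (forall z, 0 <= psi z) ->
      mean_payoff a b s mu lvl dead psi m y =
      (\int[P]_w (payoff a b s lvl dead psi m (V w) y)%:E)%E.
    move=> mpsi psi0; rewrite /mean_payoff (ge0_integral_image mV muE)// => [|v].
      by apply/measurable_EFinP; exact: mpay.
    by rewrite lee_fin payoff_ge0.
  rewrite lE !E//; apply/andP; split; apply: ge0_ae_le_integral_nomeas.
  - by move=> w; rewrite lee_fin payoff_ge0.
  - by move=> w; rewrite lee_fin.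
  - by apply: filterS sandwich => w /(_ m) /andP[h1 h2]; rewrite lee_fin.
  - by move=> w; rewrite lee_fin.
  - by move=> w; rewrite lee_fin payoff_ge0.
  - by apply: filterS sandwich => w /(_ m) /andP[h1 h2]; rewrite lee_fin.
have l0 : (0 <= laplace P s tau)%E.
  by rewrite lE; apply: integral_ge0 => w _; rewrite lee_fin.
have l1 : (laplace P s tau <= 1)%E.
  have /andP[_] := bounds 0%N; rewrite /mean_payoff /= => /le_trans; apply.
  by rewrite if_same integral_probability_cst.
have fin : laplace P s tau \is a fin_num.
  by rewrite ge0_fin_numE//; exact: le_lt_trans l1 (ltry _).
exists (fine (laplace P s tau)); rewrite fineK//; split=> //.
by rewrite -!lee_fin fineK// l0.
Qed.

End transfer.

Section model.
Context (d : measure_display) (T : measurableType d) (R : realType)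
    (P : probability T R) (a lambda sigma : bool -> R) (F : bool -> R -> R)
    (gap jump : bool -> nat -> nat -> {RV P >-> R}).
Hypotheses
    (a_gt0 : forall i, 0 < a i)
    (lambda_gt0 : forall i, 0 < lambda i)
    (indep : mutually_independent (sources gap jump))
    (gap_exp : forall i n k (A : set R), measurable A ->
       distribution P (gap i n k) A = exponential_prob (lambda i) A)
    (jump_cdf : forall i n k (y : R), cdf (jump i n k) y = (F i y)%:E)
    (jump_gt0 : forall i n k, {ae P, forall w, 0 < jump i n k w})
    (xi_mean : forall i,
       ('E_P[fun w => copies a gap jump w i 0 1%R] = 0)%E)
    (sigma_ge0 : forall i, 0 <= sigma i)
    (xi_sq : forall i,
       ('E_P[fun w => (copies a gap jump w i 0 1 ^+ 2)%R] = (sigma i ^+ 2)%:E)%E).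

(** The sources, gathered into one random point of the space where the chain is defined. *)
Definition recorded (w : T) : env source R := fun j => sources gap jump j w.

Lemma measurable_recorded : measurable_fun setT recorded.
Proof. by apply: measurable_to_env => j; exact: measurable_funP. Qed.

Let measurable_variable (X : {RV P >-> R}) : measurable_fun setT (X : T -> measurableTypeR R).
Proof. exact: (@measurable_funP _ _ T R setT X). Qed.

Definition law_of (X : {RV P >-> R}) : probability (measurableTypeR R) R :=
  @image_law _ _ T (measurableTypeR R) R P X (measurable_variable X).

Definition gap_law i := law_of (gap i 0%N 0%N).
Definition jump_law i := law_of (jump i 0%N 0%N).

Lemma gap_lawE i (A : set R) : measurable A -> gap_law i A = exponential_prob (lambda i) A.
Proof. exact: gap_exp. Qed.

Lemma jump_law_gt0 i : jump_law i `]0%R, +oo[%classic = 1%E.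
Proof.
pose A := jump i 0%N 0%N @^-1` `]0, +oo[%classic.
rewrite (_ : jump_law i _ = P A)//; have mA : measurable A by exact: measurable_funPTI.
have : P (~` A) = 0%E.
  apply/negligibleP; first exact: measurableC.
  have [N [mN N0 sub]] := jump_gt0 i 0 0; exists N; split=> // w; move=> Aw; apply: sub => /=.
  by move=> jw; apply: Aw; rewrite /A /= in_itv/= jw.
rewrite probability_setC// => /eqP.
have : P A \is a fin_num by exact: fin_num_measure.
by case: (P A) => // p _; rewrite -EFinB eqe subr_eq0 => /eqP <-.
Qed.

Variable mu : probability (env source R) R.
Hypothesis muE : forall A, measurable A -> mu A = P (recorded @^-1` A).

Lemma recorded_law : product_law (source_law gap_law jump_law) mu.
Proof.
move=> J A uJ mA; rewrite muE; last by apply: sub_sigma_algebra; exists J, A.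
transitivity (P (\bigcap_(j in [set` J]) (sources gap jump j @^-1` A j))); first by [].
rewrite indep//; apply: eq_bigr => -[[[i n] k]|[[i n] k]] _ /=.
  by rewrite gap_lawE//; exact: gap_exp.
refine (@probability_from_cdf R (law_of (jump i n k)) (jump_law i) _ _ (mA _)) => y.
by have := jump_cdf i n k y; rewrite -(jump_cdf i 0 0 y).
Qed.

Lemma ae_good_recorded : {ae P, forall w, good (recorded w)}.
Proof.
apply: (ae_preimage measurable_recorded muE).
exact: (ae_good lambda_gt0 gap_lawE jump_law_gt0 recorded_law).
Qed.

Lemma jump_law_moments i : jump_moment jump_law i 1 = (a i / lambda i)%:E /\
  jump_moment jump_law i 2 = (sigma i ^+ 2 / lambda i)%:E.
Proof.
apply: (jump_moments_of_path a_gt0 lambda_gt0 gap_lawE recorded_law measurable_recorded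
  muE ae_good_recorded).
  by have := xi_mean i; rewrite unlock.
by have := xi_sq i; rewrite unlock.
Qed.

(** With [sigma i = 0] the second moment of the jumps would vanish, and so would their first
    moment, by [|x| <= e + x^2 / e]; but this is [a i / lambda i]. *)
Lemma sigma_gt0 i : 0 < sigma i.
Proof.
have [m1 m2] := jump_law_moments i.
rewrite lt_neqAle sigma_ge0 andbT eq_sym; apply/eqP => s0.
have e0 : 0 < a i / lambda i / 2 by rewrite !divr_gt0.
set e := a i / lambda i / 2 in e0.
have m2' : (\int[jump_law i]_x (`|x| ^+ 2)%:E = 0)%E.
  by move: m2; rewrite s0 expr0n mul0r.
have mabs n : measurable_fun setT (fun x : R => (`|x| ^+ n)%:E).
  by apply/measurable_EFinP; apply: measurable_funX; exact: normr_measurable.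
have : (jump_moment jump_law i 1 <= e%:E)%E.
  apply: (@le_trans _ _ (\int[jump_law i]_x (e%:E + e^-1%:E * (`|x| ^+ 2)%:E))%E).
    apply: ge0_le_integral => //.
    - exact: (mabs 1%N).
    - by apply: emeasurable_funD => //; apply: measurable_funeM; exact: (mabs 2%N).
    move=> x _; rewrite -EFinM -EFinD lee_fin expr1.
    have [xe|xe] := leP `|x| e; first by rewrite ler_wpDr// mulr_ge0 ?sqr_ge0// invr_ge0 ltW.
    by rewrite ler_wpDl ?(ltW e0)// mulrC expr2 -mulrA ler_peMr// ler_pdivlMr// mul1r ltW.
  rewrite ge0_integralD//.
  - rewrite ge0_integralZl_EFin//; [|exact: (mabs 2%N)|by rewrite invr_ge0 ltW].
    by rewrite m2' mule0 adde0 integral_probability_cst.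
  - by move=> x _; rewrite lee_fin ltW.
  - by move=> x _; rewrite -EFinM lee_fin mulr_ge0 ?sqr_ge0// invr_ge0 ltW.
  - by apply: measurable_funeM; exact: (mabs 2%N).
by rewrite m1 lee_fin /e; have := divr_gt0 (a_gt0 i) (lambda_gt0 i); lra.
Qed.

Lemma upper_brackets b x k s B : 0 < B -> 0 < s -> b <= k -> exists l,
  [/\ laplace P (s / B ^+ 2)
        (fun w => upper_passage (copies a gap jump w) (b * B) (x * B) (k * B)) = l%:E,
      0 <= l <= 1 & brackets a b s mu -oo%E (fun y => k < y) B x l].
Proof.
move=> B0 s0 bk; have sB : 0 < s / B ^+ 2 by rewrite divr_gt0// exprn_gt0.
have clock := ae_preimage measurable_recorded muE
  (ae_unbounded_clock (b * B) a_gt0 lambda_gt0 gap_lawE recorded_law (x * B)).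
have mdead : measurable_fun setT (fun y : R => k * B < y) by exact: measurable_fun_ltr.
have bkB : b * B <= k * B by rewrite ler_pM2r.
have [|l [lE l01 lP]] := laplace_between measurable_recorded muE mdead (a := a) (b := b * B)
    (s := s / B ^+ 2) (y := x * B) (lvl := free_level (b * B))
    (tau := fun w => upper_passage (copies a gap jump w) (b * B) (x * B) (k * B)).
  apply: filterS2 ae_good_recorded clock => w gw cw m.
  exact: payoff_upper.
exists l; split=> // m.
have -> : scaled_level b -oo%E B = free_level (b * B).
  by apply/funext => -[]//=; rewrite /scaled_level gt0_mulNye// lte_fin.
have -> : (fun y => k < y / B) = (fun y => k * B < y).
  by apply/funext => y; rewrite ltr_pdivlMr.
have -> : (fun y => (k < y / B)%R%:R) = (fun y => (k * B < y)%R%:R : R).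
  by apply/funext => y; rewrite ltr_pdivlMr.
exact: lP.
Qed.

Lemma lower_brackets b x r s B : 0 < B -> 0 < s -> r <= b -> exists l,
  [/\ laplace P (s / B ^+ 2)
        (fun w => lower_passage (copies a gap jump w) (b * B) (x * B) (r * B)) = l%:E,
      0 <= l <= 1 & brackets a b s mu r%:E (fun y => y <= r) B x l].
Proof.
move=> B0 s0 rb; have sB : 0 < s / B ^+ 2 by rewrite divr_gt0// exprn_gt0.
have clock := ae_preimage measurable_recorded muE
  (ae_unbounded_clock (b * B) a_gt0 lambda_gt0 gap_lawE recorded_law (x * B)).
have mdead : measurable_fun setT (fun y : R => y <= r * B) by exact: measurable_fun_ler.
have rbB : r * B <= b * B by rewrite ler_pM2r.
have [|l [lE l01 lP]] := laplace_between measurable_recorded muE mdead (a := a) (b := b * B)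
    (s := s / B ^+ 2) (y := x * B) (lvl := barrier_level (b * B) (r * B))
    (tau := fun w => lower_passage (copies a gap jump w) (b * B) (x * B) (r * B)).
  apply: filterS2 ae_good_recorded clock => w gw cw m.
  exact: payoff_lower.
exists l; split=> // m.
have -> : scaled_level b r%:E B = barrier_level (b * B) (r * B).
  by apply/funext => -[].
have -> : (fun y => y / B <= r) = (fun y => y <= r * B).
  by apply/funext => y; rewrite ler_pdivrMr.
have -> : (fun y => (y / B <= r)%R%:R) = (fun y => (y <= r * B)%R%:R : R).
  by apply/funext => y; rewrite ler_pdivrMr.
exact: lP.
Qed.

Lemma laplace_limit (U : R -> \bar R) (br : R -> R -> Prop) (p q : R) : 0 < p ->
  (forall B, 0 < B -> exists l, [/\ U B = l%:E, 0 <= l <= 1 & br B l]) ->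
  (forall eta, 0 < eta -> exists2 B0, 0 < B0 &
     forall B, B0 <= B -> forall l, br B l -> p * l <= q + 2 * eta) ->
  (forall eta, 0 < eta -> exists2 B0, 0 < B0 &
     forall B, B0 <= B -> forall l, br B l -> q - 2 * eta <= (p + eta) * l) ->
  U B @[B --> +oo] --> (q / p)%:E.
Proof.
move=> p0 UP up lo; apply/fine_cvgP; split.
  near=> B; have B0 : 0 < B by near: B; apply: nbhs_pinfty_gt; exact: num_real.
  by have [l [-> _ _]] := UP B B0.
apply: limit_from_bounds => //.
- by move=> B B0; have [l [-> l01 _]] := UP B B0.
- move=> eta e0; have [B0 B00 h] := up eta e0; exists B0 => // B B0B.
  by have [l [-> _ lP]] := UP B (lt_le_trans B00 B0B); exact: h lP.
move=> eta e0; have [B0 B00 h] := lo eta e0; exists B0 => // B B0B.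
by have [l [-> _ lP]] := UP B (lt_le_trans B00 B0B); exact: h lP.
Unshelve. all: by end_near. Qed.

Section limits.
Variables (s b : R).
Hypothesis s_gt0 : 0 < s.

Let mean1 i : jump_moment jump_law i 1 = (a i / lambda i)%:E.
Proof. by case: (jump_law_moments i). Qed.
Let mean2 i : jump_moment jump_law i 2 = (sigma i ^+ 2 / lambda i)%:E.
Proof. by case: (jump_law_moments i). Qed.

Lemma upper_limit x k : b <= k -> x <= k ->
  laplace P (s / B ^+ 2)
    (fun w => upper_passage (copies a gap jump w) (b * B) (x * B) (k * B)) @[B --> +oo] -->
  (profile s (sigma false) (sigma true) (x - b) /
   profile s (sigma false) (sigma true) (k - b))%:E.
Proof.
move=> bk xk.
apply: (laplace_limit (br := fun B l => brackets a b s mu -oo%E (fun y => k < y) B x l)).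
- exact: profile_gt0 s_gt0 (sigma_gt0 _) (sigma_gt0 _) _.
- by move=> B B0; exact: upper_brackets.
- move=> eta e0.
  have [B0 B00 h] := upper_transform_le a_gt0 lambda_gt0 sigma_gt0 s_gt0 gap_lawE jump_law_gt0
    mean1 mean2 recorded_law bk e0.
  by exists B0 => // B B0B l lP; apply: le_trans (h B B0B x l xk lP) _; rewrite lerD2l; lra.
move=> eta e0.
have [B0 B00 h] := upper_transform_ge a_gt0 lambda_gt0 sigma_gt0 s_gt0 gap_lawE jump_law_gt0
  mean1 mean2 recorded_law bk e0.
by exists B0 => // B B0B l lP; exact: (h B B0B x l xk lP).
Qed.

Lemma lower_limit x r : r <= b -> r <= x ->
  laplace P (s / B ^+ 2)
    (fun w => lower_passage (copies a gap jump w) (b * B) (x * B) (r * B)) @[B --> +oo] -->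
  (profile s (sigma true) (sigma false) (b - x) /
   profile s (sigma true) (sigma false) (b - r))%:E.
Proof.
move=> rb rx.
apply: (laplace_limit (br := fun B l => brackets a b s mu r%:E (fun y => y <= r) B x l)).
- exact: profile_gt0 s_gt0 (sigma_gt0 _) (sigma_gt0 _) _.
- by move=> B B0; exact: lower_brackets.
- move=> eta e0.
  have [B0 B00 h] := lower_transform_le a_gt0 lambda_gt0 sigma_gt0 s_gt0 gap_lawE jump_law_gt0
    mean1 mean2 recorded_law rb e0.
  by exists B0 => // B B0B l lP; exact: (h B B0B x l rx lP).
move=> eta e0.
have [B0 B00 h] := lower_transform_ge a_gt0 lambda_gt0 sigma_gt0 s_gt0 gap_lawE jump_law_gt0
  mean1 mean2 recorded_law rb e0.
by exists B0 => // B B0B l lP; exact: (h B B0B x l rx lP).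
Qed.

End limits.
End model.

Theorem corollary2 (d : measure_display) (T : measurableType d) (R : realType)
    (P : probability T R) (a lambda sigma : bool -> R) (F : bool -> R -> R)
    (gap jump : bool -> nat -> nat -> {RV P >-> R})
    (a_gt0 : forall i, 0 < a i)
    (lambda_gt0 : forall i, 0 < lambda i)
    (indep : mutually_independent (sources gap jump))
    (gap_exp : forall i n k (A : set R), measurable A ->
       distribution P (gap i n k) A = exponential_prob (lambda i) A)
    (jump_cdf : forall i n k (y : R), cdf (jump i n k) y = (F i y)%:E)
    (jump_gt0 : forall i n k, {ae P, forall w, 0 < jump i n k w})
    (xi_mean : forall i,
       ('E_P[fun w => copies a gap jump w i 0 1%R] = 0)%E)
    (sigma_ge0 : forall i, 0 <= sigma i)
    (xi_sq : forall i,
       ('E_P[fun w => (copies a gap jump w i 0 1 ^+ 2)%R] = (sigma i ^+ 2)%:E)%E)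
    (s b x k r : R) (s_gt0 : 0 < s) (b_gt0 : 0 < b)
    (k_ge : Num.max x b <= k) (r_le : r <= Num.min x b) :
  let sigma1 := sigma false in
  let sigma2 := sigma true in
  let s1 := Num.sqrt (2 * s) / sigma1 in
  let s2 := Num.sqrt (2 * s) / sigma2 in
  let upper (B : R) := laplace P (s / B ^+ 2)
    (fun w => upper_passage (copies a gap jump w) (b * B) (x * B) (k * B)) in
  let lower (B : R) := laplace P (s / B ^+ 2)
    (fun w => lower_passage (copies a gap jump w) (b * B) (x * B) (r * B)) in
  [/\ x <= b ->
      upper B @[B --> +oo%R] -->
        (sigma1 * expR (- ((b - x) * s1)) /
          (sigma1 * cosh ((k - b) * s2) + sigma2 * sinh ((k - b) * s2)))%:E,
      b <= x <= k ->
      upper B @[B --> +oo%R] -->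
        ((sigma1 * cosh ((x - b) * s2) + sigma2 * sinh ((x - b) * s2)) /
          (sigma1 * cosh ((k - b) * s2) + sigma2 * sinh ((k - b) * s2)))%:E,
      b <= x ->
      lower B @[B --> +oo%R] -->
        (sigma2 * expR (- ((x - b) * s2)) /
          (sigma1 * sinh ((b - r) * s1) + sigma2 * cosh ((b - r) * s1)))%:E
    & r <= x <= b ->
      lower B @[B --> +oo%R] -->
        ((sigma1 * sinh ((b - x) * s1) + sigma2 * cosh ((b - x) * s1)) /
          (sigma1 * sinh ((b - r) * s1) + sigma2 * cosh ((b - r) * s1)))%:E].
Proof.
move=> sigma1 sigma2 s1 s2 upper lower.
have [mu muE] : exists mu : probability (env source R) R,
    forall A, measurable A -> mu A = P (recorded gap jump @^-1` A).
  by exists (image_law P (measurable_recorded gap jump)).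
have sg0 := sigma_gt0 a_gt0 lambda_gt0 indep gap_exp jump_cdf jump_gt0 xi_mean sigma_ge0 xi_sq muE.
move: k_ge r_le; rewrite ge_max le_min => /andP[xk bk] /andP[rx rb].
have U := upper_limit a_gt0 lambda_gt0 indep gap_exp jump_cdf jump_gt0 xi_mean sigma_ge0 xi_sq
  muE s_gt0 bk xk.
have L := lower_limit a_gt0 lambda_gt0 indep gap_exp jump_cdf jump_gt0 xi_mean sigma_ge0 xi_sq
  muE s_gt0 rb rx.
have kb0 : 0 <= k - b by rewrite subr_ge0.
have rb0 : 0 <= b - r by rewrite subr_ge0.
have neg u : - (u * s1) = - u * s1 /\ - (u * s2) = - u * s2 by rewrite !mulNr.
rewrite (profile_ge0 _ _ _ kb0) in U.
rewrite (profile_ge0 _ _ _ rb0) in L.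
split=> [xb|/andP[bx _]|bx|/andP[_ xb]].
- by move: U; rewrite profile_le0 ?subr_le0// (neg _).1 opprB.
- by move: U; rewrite profile_ge0 ?subr_ge0.
- rewrite (neg _).2 opprB (addrC (sigma1 * _)).
  by move: L; rewrite profile_le0 ?subr_le0.
rewrite (addrC (sigma1 * sinh ((b - x) * _))) (addrC (sigma1 * _)).
by move: L; rewrite profile_ge0 ?subr_ge0.
Qed.
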